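(* Let $0<\nu_0<\nu_1<\infty$ and $\mathbf f\in C_b(V)$. Let $\mathbf u\in C_b(V)$ be a solution on $\mathbb R$ of $\frac{d}{dt}\mathbf u+\nu A\mathbf u+B(\mathbf u,\mathbf u)=\mathbf f$ with viscosity $\nu\in[\nu_0,\nu_1]$, and suppose that for some $n\ge1$ and some time interval $[s,t]$, $s<t$, $$\inf_{[s,t]}|P_n\mathbf u|^2>0 .$$ Choose $\mu_0\ge\nu_1/\nu_0$, let $N\ge 1$ and $\mu=\mu_0\nu_0\kappa_0^2N^2$. If $$N>\max\Big\{\frac{8}{\nu_0\kappa_0}M_V(\mathbf u),\ n,\ \frac{2M_1}{\inf_{[s,t]}|P_N\mathbf u|^2}\Big\},$$ then for every $\gamma\in[\nu_0,\nu_1]$, $$|\nu-\gamma|\le \frac{2M_2}{\inf_{[s,t]}|P_N\mathbf u|^2}\,\mathcal L(\gamma),\qquad \mathcal L(\gamma)=\|P_N\mathbb W(\gamma,P_N\mathbf u)-P_N\mathbf u\|_{C_b(H)},$$ where $$M_1=\frac{2\sqrt5\,c_0^2}{\nu_0\kappa_0^2}\,M_H(P_N\mathbf u)\,\big(M_V(P_N\mathbf u)\big)^2,$$ $$M_2=\mu\,\frac{1+\delta^{N^2}}{1-\delta^{N^2}}\,\|A^{-1}P_N\mathbf u\|_{C_b(H)}+\|A^{-1}\partial_tP_N\mathbf u\|_{C_b(H)}+\gamma\,\|P_N\mathbf u\|_{C_b(H)},\qquad \delta=e^{-\mu_0\nu_0\kappa_0^2(t-s)} .$$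
   Context: Domain and spaces: $L>0$, $\Omega=[0,L]^2$ with periodic boundary conditions, $\kappa_0=2\pi/L$. $H$ and $V$ are the closures, in $(L^2(\Omega))^2$ and $(H^1(\Omega))^2$ respectively, of the $L$-periodic, divergence-free, mean-zero, $\mathbb R^2$-valued trigonometric polynomials; $|\mathbf u|=\|\mathbf u\|_{L^2}$ is the norm of $H$ and $\|\mathbf u\|=\|\nabla\mathbf u\|_{L^2}$ the norm of $V$. $P_\sigma$ is the orthogonal (Helmholtz--Leray) projection of mean-zero periodic $L^2$ vector fields onto $H$; $A=-P_\sigma\Delta$ (which is $-\Delta$ here) and $B(\mathbf u,\mathbf v)=P_\sigma[(\mathbf u\cdot\nabla)\mathbf v]$, extended continuously with values in $V'$. For a normed space $X$, $C_b(X)$ is the space of bounded continuous maps $\mathbb R\to X$ with norm $\|\phi\|_{C_b(X)}=\sup_{t\in\mathbb R}\|\phi(t)\|_X$. Modal projection: for real $N\ge1$, $P_N$ keeps exactly the Fourier modes $\mathbf k\in\mathbb Z^2$ with $|\mathbf k|<N$ and sets the others to zero. Determining map: for $\gamma>0$ and $\phi\in C_b(V)$, $\mathbb W(\gamma,\phi)$ denotes the solution $\mathbf v\in C_b(V)$, on all of $\mathbb R$, of $\frac{d}{dt}\mathbf v+\gamma A\mathbf v+B(\mathbf v,\mathbf v)=\mathbf f+\mu(\phi-P_N\mathbf v)$ (which exists and is unique for the data occurring in the claim). Constants: $c_0=\sqrt{1+\frac1{2\pi}}$, and for $\phi\in C_b(V)$, $M_H(\phi)=\sqrt2\,\sqrt{\frac{1}{(\nu_0\kappa_0^2)^2}\|\mathbf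 f\|_{C_b(H)}^2+\mu_0^2\|\phi\|_{C_b(H)}^2}$, $M_V(\phi)=\sqrt2\,\sqrt{\frac{1}{(\nu_0\kappa_0^2)^2}\|\mathbf f\|_{C_b(V)}^2+\mu_0^2\|\phi\|_{C_b(V)}^2}$. *)

(* Defs.v *)
From HB Require Import structures.
From mathcomp Require Import all_boot all_order all_algebra.
From mathcomp Require Import all_classical all_reals all_analysis.

Set Implicit Arguments.
Unset Strict Implicit.
Unset Printing Implicit Defensive.
Import Order.TTheory GRing.Theory Num.Theory.
Import numFieldNormedType.Exports.

Local Open Scope classical_set_scope.
Local Open Scope ring_scope.

(* A vector field on the period cell is a representative [u], with [u i x] its
   i-th component at the point [x] of the plane; only its values on [Omega]
   count, and fields equal a.e. on [Omega] are not identified: all the notions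
   below depend on the a.e. class only.  For a tensor field, [G i j] stands for
   the j-th partial derivative of the i-th component. *)
Notation vfield R := ('I_2 -> R * R -> R).
Notation tfield R := ('I_2 -> 'I_2 -> R * R -> R).

Section PeriodicCell.
Context {R : realType} (L : R).

Definition Omega : set (measurableTypeR R * measurableTypeR R) :=
  `[0, L] `*` `[0, L].

Definition kappa0 : R := 2 * pi / L.

Definition leb2 :
    {measure set (measurableTypeR R * measurableTypeR R) -> \bar R} :=
  (@lebesgue_measure R \x @lebesgue_measure R)%E.

Definition integ (g : R * R -> R) : R := (\int[leb2]_(x in Omega) g x)%R.

Definition L2 (g : R * R -> R) : Prop :=
  measurable_fun Omega (g : measurableTypeR R * measurableTypeR R -> R) /\
  leb2.-integrable Omega (fun x => (g x ^+ 2)%:E).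

Definition ipH (u v : vfield R) : R := \sum_(i < 2) integ (fun x => u i x * v i x).

Definition normH (u : vfield R) : R := Num.sqrt (ipH u u).

Definition ipT (F G : tfield R) : R := \sum_(i < 2) ipH (F i) (G i).

Definition normT (G : tfield R) : R := Num.sqrt (ipT G G).

(* Modes k in Z^2 and the phase kappa_0 k.x. *)
Definition phase (k : int * int) (x : R * R) : R :=
  kappa0 * (k.1%:~R * x.1 + k.2%:~R * x.2).

Definition mode_norm (k : int * int) : R :=
  Num.sqrt ((k.1 ^+ 2 + k.2 ^+ 2)%:~R).

Definition basis_vec (j : 'I_2) : R * R := if j == ord0 then (1, 0) else (0, 1).

Definition cgrad (p : vfield R) : tfield R :=
  fun i j x => 'D_(basis_vec j) (p i) x.

(* The real form of a trigonometric polynomial with values in R^2. *)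
Definition trig_poly (p : vfield R) : Prop :=
  exists (K : seq (int * int)) (a b : int * int -> 'I_2 -> R),
    forall i x, p i x =
      \sum_(k <- K) (a k i * cos (phase k x) + b k i * sin (phase k x)).

Definition sol_trig_poly (p : vfield R) : Prop :=
  [/\ trig_poly p,
      forall x, \sum_(j < 2) cgrad p j j x = 0 &
      forall i, integ (p i) = 0].

Definition inH (u : vfield R) : Prop :=
  (forall i, L2 (u i)) /\
  (forall e, 0 < e -> exists2 p, sol_trig_poly p & normH (u - p) < e).

(* [H1_limit u G]: (u, G) is an L^2-limit of pairs (p, grad p); that is, u is
   in the H^1-closure of the polynomials, and G is its weak gradient. *)
Definition H1_limit (u : vfield R) (G : tfield R) : Prop :=
  [/\ forall i, L2 (u i),
      forall i j, L2 (G i j) &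
      forall e, 0 < e -> exists p,
        [/\ sol_trig_poly p, normH (u - p) < e & normT (G - cgrad p) < e]].

Definition inV (u : vfield R) : Prop := exists G, H1_limit u G.

(* For u in V the weak gradient is unique up to a null set. *)
Definition grad (u : vfield R) : tfield R :=
  xget (0 : tfield R) [set G | H1_limit u G].

Definition normV (u : vfield R) : R := normT (grad u).

(* The pairings <A u, w> and <B(u, v), w> of V' with V.  The projection P_sigma
   does not show, because w is divergence-free; the second integral converges
   on V, by the embedding of V in L^4, hence it is the continuous extension of
   B. *)
Definition pairA (u w : vfield R) : R := ipT (grad u) (grad w).

Definition pairB (u v w : vfield R) : R :=
  \sum_(i < 2) \sum_(j < 2) integ (fun x => u j x * grad v i j x * w i x).

(* A^-1 g is the element z of V with A z = g in V'. *)
Definition invA (g : vfield R) : vfield R :=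
  xget (0 : vfield R) [set z | inV z /\ forall w, inV w -> pairA z w = ipH g w].

(* P_N, in real form: the modes k and -k are both summed over, and
   Re (c_k e^(i kappa_0 k.x)) is the k-th summand, where
   c_k = L^-2 \int u e^(-i kappa_0 k.y) dy. *)
Definition projN (N : R) (u : vfield R) : vfield R := fun i x =>
  \sum_(k \in [set k | mode_norm k < N])
    (L ^- 2 * integ (fun y => u i y * cos (phase k y)) * cos (phase k x) +
     L ^- 2 * integ (fun y => u i y * sin (phase k y)) * sin (phase k x)).

(* Membership in C_b(X), where X is given by its carrier and its norm. *)
Definition Cb (inX : vfield R -> Prop) (normX : vfield R -> R)
    (phi : R -> vfield R) : Prop :=
  [/\ forall t, inX (phi t),
      forall t, normX (phi s - phi t) @[s --> t] --> 0 &
      exists C, forall t, normX (phi t) <= C].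

Definition CbV : (R -> vfield R) -> Prop := Cb inV normV.

Definition Cb_norm (normX : vfield R -> R) (phi : R -> vfield R) : R :=
  sup [set normX (phi t) | t in [set: R]].

(* The time derivative, as the limit in H of the difference quotients. *)
Definition dtH (phi : R -> vfield R) (t : R) : vfield R :=
  xget (0 : vfield R) [set z | inH z /\
    normH (fun i x => h^-1 * (phi (t + h) i x - phi t i x) - z i x)
      @[h --> 0^'] --> 0].

(* dv/dt + gamma A v + B(v, v) = F in V', at all times in R.  For v in C_b(V)
   and F in C_b(H) all the terms other than dv/dt are continuous with values in
   V', so that v is continuously differentiable with values in V' and the
   equation holds pointwise in time. *)
Definition nse_solution (gamma : R) (F v : R -> vfield R) : Prop :=
  forall (t : R) (w : vfield R), inV w ->
    is_derive t (1 : R) (fun s : R => ipH (v s) w)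
      (ipH (F t) w - gamma * pairA (v t) w - pairB (v t) (v t) w).

(* [v] is W(gamma, phi). *)
Definition determining_solution (f : R -> vfield R) (mu N gamma : R)
    (phi v : R -> vfield R) : Prop :=
  CbV v /\
  nse_solution gamma
    (fun t i x => f t i x + mu * (phi t i x - projN N (v t) i x)) v.

Definition c0 : R := Num.sqrt (1 + 1 / (2 * pi)).

(* M_H and M_V are the cases normX = normH and normX = normV. *)
Definition Mconst (normX : vfield R -> R) (nu0 mu0 : R)
    (f phi : R -> vfield R) : R :=
  Num.sqrt 2 * Num.sqrt
    (1 / (nu0 * kappa0 ^+ 2) ^+ 2 * Cb_norm normX f ^+ 2 +
     mu0 ^+ 2 * Cb_norm normX phi ^+ 2).

Definition M1const (nu0 mu0 : R) (f phi : R -> vfield R) : R :=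
  2 * Num.sqrt 5 * c0 ^+ 2 / (nu0 * kappa0 ^+ 2) *
  Mconst normH nu0 mu0 f phi * Mconst normV nu0 mu0 f phi ^+ 2.

(* [phi] stands for P_N u, and [d] for delta^(N^2). *)
Definition M2const (mu d gamma : R) (phi : R -> vfield R) : R :=
  mu * ((1 + d) / (1 - d)) * Cb_norm normH (fun t => invA (phi t)) +
  Cb_norm normH (fun t => invA (dtH phi t)) +
  gamma * Cb_norm normH phi.

(* inf_[s, t] |phi|^2 *)
Definition inf_energy (s t : R) (phi : R -> vfield R) : R :=
  inf [set normH (phi r) ^+ 2 | r in `[s, t]].

End PeriodicCell.

(* Main.v *)
(** In the coordinates of the Fourier coefficients along the unit vectors
    orthogonal to k, the fields u and v = W(gamma, P_N u) are trajectories of two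
    infinite systems of ODEs with the same force.  Nudging adds mu to the viscous
    rate of every mode below N, so all modes of z = v - u are damped at a rate at
    least nu0 kappa0^2 N^2; a Gronwall argument on the whole line, where bounded
    solutions keep no memory of an initial condition, gives
    |z| <= C |nu - gamma| / N.  In the same way b(w, w, A w) = 0 in two dimensions
    bounds the enstrophy of u and of v by that of f and P_N u.

    The pairing g of P_N z with A^-1 P_N u satisfies
    g' + mu g = (nu - gamma) |P_N u|^2 + remainder.  Multiplying by e^(mu r) and
    integrating over [s, t] bounds |nu - gamma| inf |P_N u|^2 by M2 times the loss
    plus the nonlinear remainder, which is at most |nu - gamma| M1 / N and is
    absorbed on the left because N > 2 M1 / inf |P_N u|^2.

    All trilinear estimates are Cauchy-Schwarz inequalities on the lattice with
    the weight max(|k|, N), in place of Ladyzhenskaya's inequality.  They are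
    applied to truncations to finitely many modes, and the truncation errors
    vanish because a trajectory bounded in V decays like |k|^-3, uniformly in
    time, by a bootstrap on single modes. *)

Require Import Defs.
From mathcomp Require Import all_boot all_order all_algebra.
From mathcomp Require Import all_classical all_reals all_analysis.
From mathcomp Require Import measurable_realfun.
From mathcomp.real_closed Require Import complex.
From mathcomp Require Import ring lra zify.
Import Order.TTheory GRing.Theory Num.Theory.
Import numFieldNormedType.Exports.
Local Open Scope classical_set_scope.
Local Open Scope ring_scope.
Set Implicit Arguments.
Unset Strict Implicit.
Unset Printing Implicit Defensive.

(** The weak equation can be tested mode by mode, so every balance is written for finitely many
    outputs, those in [box K], while the inputs of the nonlinear term range over all modes. The
    cancellations of the trilinear form hold when inputs and outputs lie in the same symmetric box;
    the interactions left over are an error. Since Gronwall's inequality is applied on the whole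
    line at fixed [K], this error must be small uniformly in time, and the L^2 convergence of
    Fourier series gives no such uniformity. The decay |k|^-3 does: the interactions left over are
    then dominated by the tail of one convergent series independent of time. The exponent 3 is what
    a force bounded in V allows.

    The weight max(|k|, N) is, up to constants, the square root of the damping rate of the mode k:
    viscosity above N, nudging below. The lattice sum of its power -4 is of order N^-2, so the
    trilinear term is at most a multiple of |u|_V / N times the dissipation; the condition on M_V(u)
    makes this fraction one fifth. *)

Notation Z2 := (int * int)%type.

(** * Inequalities for finite sums of reals *)

Section FiniteSums.
Context {R : realType}.

Lemma le_of_eq (a b : R) : a = b -> a <= b. Proof. by move->. Qed.

Lemma amgm (a b : R) : 2 * (a * b) <= a ^+ 2 + b ^+ 2.
Proof. by have := sqr_ge0 (a - b); rewrite sqrrB; lra. Qed.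

Lemma sum_CS (I : Type) (r : seq I) (a b : I -> R) :
  (\sum_(i <- r) a i * b i) ^+ 2 <=
  (\sum_(i <- r) a i ^+ 2) * (\sum_(i <- r) b i ^+ 2).
Proof.
elim: r => [|x r IH]; first by rewrite !big_nil expr2 !mul0r.
rewrite !big_cons.
set A := \sum_(i <- r) a i ^+ 2 in IH *; set B := \sum_(i <- r) b i ^+ 2 in IH *.
set S := \sum_(i <- r) a i * b i in IH *.
have A0 : 0 <= A by apply: sumr_ge0 => i _; exact: sqr_ge0.
have B0 : 0 <= B by apply: sumr_ge0 => i _; exact: sqr_ge0.
have SAB : `|S| <= Num.sqrt A * Num.sqrt B.
  by rewrite -sqrtrM // -sqrtr_sqr ler_sqrt ?mulr_ge0.
have H := amgm (`|a x| * Num.sqrt B) (`|b x| * Num.sqrt A).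
rewrite !exprMn !sqr_sqrtr // !real_normK ?num_real // in H.
have H2 : a x * b x * S <= `|a x| * `|b x| * (Num.sqrt A * Num.sqrt B).
  rewrite -normrM; apply: le_trans (ler_norm _) _.
  rewrite [leLHS]normrM; apply: ler_wpM2l => //.
have -> : (a x * b x + S) ^+ 2 =
  a x ^+ 2 * b x ^+ 2 + 2 * (a x * b x * S) + S ^+ 2 by ring.
nra.
Qed.

Lemma sum_CS_le (I : Type) (r : seq I) (a b : I -> R) (A B : R) :
  0 <= A -> 0 <= B ->
  \sum_(i <- r) a i ^+ 2 <= A ^+ 2 -> \sum_(i <- r) b i ^+ 2 <= B ^+ 2 ->
  \sum_(i <- r) a i * b i <= A * B.
Proof.
move=> A0 B0 hA hB; apply: le_trans (ler_norm _) _.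
rewrite -(ler_pXn2r (n := 2)) ?nnegrE ?mulr_ge0 //.
rewrite real_normK ?num_real // exprMn; apply: le_trans (sum_CS _ _ _) _.
by apply: ler_pM => //; apply: sumr_ge0 => i _; exact: sqr_ge0.
Qed.

Lemma sum_uniq_le (I : eqType) (F G : seq I) (f : I -> R) :
  uniq F -> {subset F <= G} -> (forall i, 0 <= f i) ->
  \sum_(i <- F) f i <= \sum_(i <- G) f i.
Proof.
elim: F G => [|x F IH] G /=; first by move=> _ _ f0; rewrite big_nil sumr_ge0.
move=> /andP[xF uF] sFG f0.
have xG : x \in G by apply: sFG; rewrite inE eqxx.
rewrite big_cons (perm_big _ (perm_to_rem xG)) big_cons lerD2l.
apply: IH => // y yF; have := sFG y; rewrite inE yF orbT => /(_ isT) yG.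
have yx : y != x by apply: contraNneq xF => <-.
by move: yG; rewrite (perm_mem (perm_to_rem xG)) inE (negPf yx).
Qed.

Lemma sum_sift (I : eqType) (F : seq I) (f : I -> R) (x : I) :
  uniq F -> \sum_(i <- F) (i == x)%:R * f i = (x \in F)%:R * f x.
Proof.
elim: F => [|y F IH] /=; first by rewrite big_nil mul0r.
move=> /andP[yF uF]; rewrite big_cons IH // inE eq_sym.
case: eqVneq => [->|_] /=; last by rewrite mul0r add0r.
by rewrite (negPf yF) /= mul0r addr0.
Qed.

Lemma le_sqrtP (x a : R) : 0 <= a -> x ^+ 2 <= a ^+ 2 -> x <= a.
Proof.
move=> a0 h; apply: le_trans (ler_norm _) _.
by rewrite -(ler_pXn2r (n := 2)) ?nnegrE // real_normK ?num_real.
Qed.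

Lemma le_eps (x y : R) : (forall e, 0 < e -> x <= y + e) -> x <= y.
Proof.
move=> h; rewrite leNgt; apply/negP => yx.
have := h ((x - y) / 2); rewrite divr_gt0 ?subr_gt0 // => /(_ isT); lra.
Qed.

End FiniteSums.

(** * Sums over the lattice *)

Section Lattice.
Context {R : realType}.

Definition irange (M : nat) : seq int := [seq n%:Z - M%:Z | n <- iota 0 (M.*2.+1)].

Lemma mem_irange (M : nat) (n : int) : (n \in irange M) = (`|n| <= M%:Z).
Proof.
apply/mapP/idP => [[m]|h].
  rewrite mem_iota add0n => /andP[_ h] ->; lia.
by exists (absz (n + M%:Z)); [rewrite mem_iota; lia|lia].
Qed.

Lemma uniq_irange M : uniq (irange M).
Proof. by rewrite map_inj_uniq ?iota_uniq // => x y; lia. Qed.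

(** The zero mode is left out: the fields have mean zero, and |k| is often divided by. *)
Definition box (M : nat) : seq Z2 :=
  [seq k <- allpairs pair (irange M) (irange M) | k != 0].

Lemma mem_box M (k : Z2) :
  (k \in box M) = [&& k != 0, `|k.1| <= M%:Z & `|k.2| <= M%:Z].
Proof.
rewrite mem_filter; congr (_ && _); case: k => a b.
rewrite -!mem_irange; apply/allpairsP/andP => [[[c d] [h1 h2 [-> ->]]]|[h1 h2]] //.
by exists (a, b).
Qed.

Lemma uniq_box M : uniq (box M).
Proof.
apply: filter_uniq; apply: allpairs_uniq; rewrite ?uniq_irange //.
by move=> [a b] [c d] _ _ /= [-> ->].
Qed.

Lemma boxN M (k : Z2) : (- k \in box M) = (k \in box M).
Proof. by rewrite !mem_box oppr_eq0 /= !normrN. Qed.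

Lemma sub_box M M' : (M <= M')%N -> {subset box M <= box M'}.
Proof. move=> h k; rewrite !mem_box => /and3P[-> ] /=; lia. Qed.

Lemma box_cover (F : seq Z2) : exists M, forall k, k \in F -> k != 0 -> k \in box M.
Proof.
elim: F => [|x F [M IH]]; first by exists 0.
exists (M + `|x.1|%N + `|x.2|%N)%N => k; rewrite inE => /orP[/eqP->|kF] k0.
  by rewrite mem_box k0 /=; lia.
by have := IH k kF k0; rewrite !mem_box => /and3P[-> ] /=; lia.
Qed.

Definition nk (k : Z2) : R := mode_norm k.

Lemma nk_sqr k : nk k ^+ 2 = k.1%:~R ^+ 2 + k.2%:~R ^+ 2.
Proof.
by rewrite sqr_sqrtr ?ler0z ?addr_ge0 ?sqr_ge0 // rmorphD /= !rmorphXn.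
Qed.

Lemma nk_ge0 k : 0 <= nk k. Proof. exact: sqrtr_ge0. Qed.

Lemma nk0 : nk 0 = 0.
Proof. by rewrite /nk /mode_norm /= expr0n /= addr0 sqrtr0. Qed.

Lemma nkN k : nk (- k) = nk k.
Proof. by rewrite /nk /mode_norm /= !sqrrN. Qed.

Lemma nk_ge1 k : k != 0 -> 1 <= nk k.
Proof.
move=> k0; rewrite -sqrtr1 /nk /mode_norm ler_sqrt.
  have h : (1 <= k.1 ^+ 2 + k.2 ^+ 2 :> int).
    case: k k0 => a b /=; rewrite xpair_eqE negb_and => /orP[]; nia.
  by rewrite -[1]/(1%:~R) ler_int.
by rewrite ler0z addr_ge0 ?sqr_ge0.
Qed.

Lemma nk_gt0 k : k != 0 -> 0 < nk k.
Proof. by move/nk_ge1; apply: lt_le_trans. Qed.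

(** Lagrange's identity: the squares of the two sides differ by (ad - bc)^2. *)
Lemma dot_le (a b c d : R) :
  `|a * c + b * d| <= Num.sqrt (a ^+ 2 + b ^+ 2) * Num.sqrt (c ^+ 2 + d ^+ 2).
Proof.
rewrite -sqrtrM ?addr_ge0 ?sqr_ge0 // -sqrtr_sqr ler_sqrt; last first.
  by rewrite mulr_ge0 ?addr_ge0 ?sqr_ge0.
rewrite -subr_ge0 (_ : _ - _ = (a * d - b * c) ^+ 2) ?sqr_ge0 //; ring.
Qed.

Lemma nkE k : nk k = Num.sqrt (k.1%:~R ^+ 2 + k.2%:~R ^+ 2).
Proof. by rewrite -nk_sqr sqrtr_sqr ger0_norm ?nk_ge0. Qed.

Definition dot (j l : Z2) : R := j.1%:~R * l.1%:~R + j.2%:~R * l.2%:~R.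
Definition crs (j l : Z2) : R := j.1%:~R * l.2%:~R - j.2%:~R * l.1%:~R.

Lemma dot_nk j l : `|dot j l| <= nk j * nk l.
Proof. by rewrite !nkE; exact: dot_le. Qed.

Lemma crs_nk j l : `|crs j l| <= nk j * nk l.
Proof.
have -> : crs j l = j.1%:~R * l.2%:~R + j.2%:~R * (- l.1%:~R) by rewrite /crs; ring.
apply: le_trans (dot_le _ _ _ _) _; rewrite sqrrN !nkE.
by rewrite [X in _ * Num.sqrt X <= _]addrC.
Qed.

Lemma nkD j l : nk (j + l) <= nk j + nk l.
Proof.
apply: le_sqrtP; first by rewrite addr_ge0 ?nk_ge0.
rewrite sqrrD !nk_sqr /= !rmorphD /=.
have := dot_nk j l; rewrite /dot => /(le_trans (ler_norm _)) h.
rewrite mulr2n; nra.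
Qed.

Lemma sum_telescope_le (g h : nat -> R) M :
  (forall m, g m.+1 <= h m - h m.+1) -> (forall m, 0 <= h m) ->
  \sum_(m < M) g m.+1 <= h 0%N.
Proof.
move=> gh h0; suff: \sum_(m < M) g m.+1 <= h 0%N - h M.
  by move/le_trans; apply; rewrite lerBlDr lerDl.
elim: M => [|M IH]; first by rewrite big_ord0 subrr.
by rewrite big_ord_recr /=; have := gh M; lra.
Qed.

(** The summand is even, so a finite set of integers is covered by 0 and two copies of an initial
    segment of the positive integers. *)
Lemma sum_int_le (g : nat -> R) (S : R) (F : seq int) :
  (forall m, 0 <= g m) -> (forall M, \sum_(m < M) g m.+1 <= S) -> uniq F ->
  \sum_(n <- F) g (absz n) <= g 0%N + 2 * S.
Proof.
move=> g0 gS uF.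
have [M hM] : exists M, forall n, n \in F -> (absz n <= M)%N.
  elim: {uF} F => [|x F [M IH]]; first by exists 0%N.
  exists (M + absz x)%N => n; rewrite inE => /orP[/eqP->|/IH h]; first exact: leq_addl.
  exact: leq_trans h (leq_addr _ _).
pose G := 0 :: map (fun m => (m.+1)%:Z) (iota 0 M) ++ map (fun m => - (m.+1)%:Z) (iota 0 M).
apply: (@le_trans _ _ (\sum_(n <- G) g (absz n))).
  apply: sum_uniq_le => // n /hM nM; rewrite inE mem_cat.
  case: n nM => [[|n]|n] nM //=; apply/orP; [left|right]; apply/mapP; exists n.
  - by rewrite mem_iota.
  - by [].
  - by rewrite mem_iota.
  - by rewrite NegzE.
rewrite big_cons big_cat !big_map /=.
have := gS M; rewrite -(big_mkord xpredT (fun m => g m.+1)) /index_iota subn0; lra.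
Qed.

(** The set is contained in the grid spanned by its own coordinates, where the double sum
    factors. *)
Lemma sum_Z2_le (g : nat -> R) (S : R) (F : seq Z2) :
  (forall m, 0 <= g m) ->
  (forall G : seq int, uniq G -> \sum_(n <- G) g (absz n) <= S) -> uniq F ->
  \sum_(k <- F) g (absz k.1) * g (absz k.2) <= S ^+ 2.
Proof.
move=> g0 gS uF.
pose I := undup (map fst F ++ map snd F).
apply: (@le_trans _ _ (\sum_(k <- allpairs pair I I) g (absz k.1) * g (absz k.2))).
  apply: sum_uniq_le => // [[a b] kF|k]; last exact: mulr_ge0.
  apply/allpairsP; exists (a, b); split=> //=; rewrite mem_undup mem_cat; apply/orP.
    by left; apply/mapP; exists (a, b).
  by right; apply/mapP; exists (a, b).
rewrite big_allpairs /=; under eq_bigr do rewrite -mulr_sumr.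
rewrite -mulr_suml -expr2 ler_pXn2r ?nnegrE ?sumr_ge0 ?gS ?undup_uniq //.
apply: le_trans (gS [::] isT); by rewrite big_nil.
Qed.

(** In place of an integral: since (x + 1 + a)^2 <= 2 ((x + 1)^2 + a^2), each term is below a
    difference of consecutive values of 2 / (x + a), and the sum telescopes. *)
Lemma sum_inv_sqr (a : R) (F : seq int) : 0 < a -> uniq F ->
  \sum_(n <- F) ((absz n)%:R ^+ 2 + a ^+ 2)^-1 <= (a ^+ 2)^-1 + 4 / a.
Proof.
move=> a0 uF.
have a20 : 0 < a ^+ 2 by rewrite exprn_gt0.
apply: le_trans (@sum_int_le (fun m => (m%:R ^+ 2 + a ^+ 2)^-1) (2 / a) F _ _ uF) _.
- by move=> m; rewrite invr_ge0 addr_ge0 ?sqr_ge0.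
- move=> M; rewrite -[X in 2 / X]add0r.
  apply: (@sum_telescope_le (fun m => (m%:R ^+ 2 + a ^+ 2)^-1) (fun m => 2 / (m%:R + a))) => m; last first.
    by rewrite divr_ge0 // addr_ge0 // ltW.
  have m0 : 0 <= m%:R :> R by [].
  rewrite -natr1; move: (m%:R) m0 => x x0.
  have -> : 2 / (x + a) - 2 / (x + 1 + a) = 2 / ((x + a) * (x + 1 + a)).
    by field; rewrite !gt_eqF //; lra.
  rewrite -[leLHS]mul1r ler_pdivrMr; last by nra.
  rewrite mulrAC ler_pdivlMr; last by nra.
  by have := sqr_ge0 (x + 1 - a); nra.
by rewrite expr0n /= add0r; lra.
Qed.

Definition wgt (N : R) (k : Z2) : R := Num.max (nk k) N.

Lemma wgt_gt0 (N : R) k : 0 < N -> 0 < wgt N k.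
Proof. by move=> N0; rewrite lt_max N0 orbT. Qed.

Lemma wgt1 k : k != 0 -> wgt 1 k = nk k.
Proof. by move=> k0; apply/max_idPl/nk_ge1. Qed.

Lemma wgt_sqr (N : R) k : 0 < N ->
  wgt N k ^+ 2 = Num.max (nk k ^+ 2) (N ^+ 2).
Proof.
move=> N0; rewrite /wgt; have [h|h] := leP (nk k) N.
  by rewrite max_r // ler_pXn2r ?nnegrE ?nk_ge0 // ltW.
by rewrite max_l // ler_pXn2r ?nnegrE ?nk_ge0 // ltW.
Qed.

Lemma nk_absz k : nk k ^+ 2 = (absz k.1)%:R ^+ 2 + (absz k.2)%:R ^+ 2.
Proof.
by rewrite nk_sqr; congr (_ + _); rewrite natr_absz intr_norm real_normK ?num_real.
Qed.

Lemma sum_wgt (N : R) (F : seq Z2) : 1 <= N -> uniq F ->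
  \sum_(k <- F) (wgt N k ^+ 4)^-1 <= (8 / N) ^+ 2.
Proof.
move=> N1 uF; have N0 : 0 < N by lra.
(* The number 7/10 is a rational just below 1 / sqrt 2. As 2 a^2 <= N^2, the arithmetic-geometric
   inequality bounds (x + a^2) (y + a^2) by max(x + y, N^2)^2, which splits the lattice sum into two
   sums over the integers; as N >= 1, each of these is at most 8 / N. *)
set a := 7 / 10 * N; have a0 : 0 < a by rewrite mulr_gt0.
apply: le_trans (_ : \sum_(k <- F)
   ((absz k.1)%:R ^+ 2 + a ^+ 2)^-1 * ((absz k.2)%:R ^+ 2 + a ^+ 2)^-1 <= _).
  apply: ler_sum => k _; rewrite -invfM lef_pV2 ?posrE; last 2 first.
  - by rewrite exprn_gt0 // wgt_gt0.
  - by rewrite mulr_gt0 // ltr_wpDl ?sqr_ge0 // exprn_gt0.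
  rewrite (_ : wgt N k ^+ 4 = (wgt N k ^+ 2) ^+ 2); last by rewrite -exprM.
  rewrite wgt_sqr // nk_absz.
  set x := (absz k.1)%:R ^+ 2; set y := (absz k.2)%:R ^+ 2.
  have x0 : 0 <= x by exact: sqr_ge0. have y0 : 0 <= y by exact: sqr_ge0.
  have h1 : x + y <= Num.max (x + y) (N ^+ 2) by rewrite le_max lexx.
  have h2 : N ^+ 2 <= Num.max (x + y) (N ^+ 2) by rewrite le_max lexx orbT.
  have n2 : 0 < N ^+ 2 by rewrite exprn_gt0.
  move: (Num.max _ _) h1 h2 => w h1 h2.
  have -> : a ^+ 2 = 49 / 100 * N ^+ 2 by rewrite /a; field.
  move: (N ^+ 2) h2 n2 => n h2 n2.
  apply: (@le_trans _ _ (((x + y + n) / 2) ^+ 2)); last first.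
    have w0 : 0 <= w by lra.
    rewrite ler_pXn2r ?nnegrE //; last lra.
    by rewrite ler_pdivrMr //; lra.
  have := sqr_ge0 (x - y); nra.
apply: le_trans (@sum_Z2_le (fun m => (m%:R ^+ 2 + a ^+ 2)^-1) ((a ^+ 2)^-1 + 4 / a) F _ _ uF) _.
- by move=> m; rewrite invr_ge0 addr_ge0 ?sqr_ge0.
- by move=> G uG; exact: sum_inv_sqr.
have ai : 0 < a^-1 by rewrite invr_gt0.
have h : (a ^+ 2)^-1 + 4 / a <= 8 / N.
  have -> : (a ^+ 2)^-1 + 4 / a = (100 / 49 / N + 40 / 7) / N by rewrite /a; field; rewrite gt_eqF.
  rewrite ler_pM2r ?invr_gt0 //.
  have : N^-1 <= 1 by rewrite invf_le1.
  lra.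
rewrite ler_pXn2r ?nnegrE //; last by rewrite divr_ge0 // ltW.
by rewrite addr_ge0 // ?invr_ge0 ?sqr_ge0 // mulr_ge0 // ltW.
Qed.

(** Integer powers of [rho] are half-integer powers of |k|. The bootstrap advances by half powers,
    and [rho] to the power -5, which is |k|^(-5/2), is summable over the lattice. *)
Definition rho (k : Z2) : R := Num.sqrt (nk k).

Lemma rho_sqr k : rho k ^+ 2 = nk k. Proof. by rewrite sqr_sqrtr ?nk_ge0. Qed.
Lemma rho_ge0 k : 0 <= rho k. Proof. exact: sqrtr_ge0. Qed.
Lemma rho_ge1 k : k != 0 -> 1 <= rho k.
Proof. by move=> k0; rewrite -sqrtr1 ler_sqrt ?nk_ge0 // nk_ge1. Qed.
Lemma rho_gt0 k : k != 0 -> 0 < rho k.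
Proof. by move/rho_ge1; apply: lt_le_trans. Qed.

Lemma rhoD j l : rho (j + l) <= rho j + rho l.
Proof.
apply: le_sqrtP; first by rewrite addr_ge0 ?rho_ge0.
rewrite rho_sqr; apply: le_trans (nkD _ _) _; rewrite sqrrD !rho_sqr.
by have := rho_ge0 j; have := rho_ge0 l; rewrite mulr2n; nra.
Qed.

Definition root4 (m : nat) : R := Num.sqrt (Num.sqrt (m.+1)%:R).

Lemma root4_4 m : root4 m ^+ 4 = m%:R + 1.
Proof.
by rewrite (exprM _ 2 2) sqr_sqrtr ?sqrtr_ge0 // sqr_sqrtr ?ler0n // natr1.
Qed.

Lemma root4_ge1 m : 1 <= root4 m.
Proof.
rewrite -[leLHS]sqrtr1 ler_sqrt ?sqrtr_ge0 // -[leLHS]sqrtr1 ler_sqrt ?ler0n //.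
by rewrite ler1n.
Qed.

(** The terms are (m + 1)^(-5/4), compared with differences of the primitive 4 (m + 1)^(-1/4). The
    bound 9 is the term at 0 plus twice the telescoped sum 4. *)
Lemma sum_root4 (F : seq int) : uniq F ->
  \sum_(n <- F) (root4 (absz n) ^+ 5)^-1 <= 9.
Proof.
move=> uF.
apply: le_trans (@sum_int_le (fun m => (root4 m ^+ 5)^-1) 4 F _ _ uF) _.
- by move=> m; rewrite invr_ge0 exprn_ge0 // sqrtr_ge0.
- move=> M; have {1}-> : 4 = 4 / root4 0 :> R by rewrite /root4 !sqrtr1 divr1.
  apply: (@sum_telescope_le (fun m => (root4 m ^+ 5)^-1) (fun m => 4 / root4 m)) => m; last first.
    by rewrite divr_ge0 // sqrtr_ge0.
  have := root4_4 m; have := root4_4 m.+1; rewrite -natr1.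
  have := root4_ge1 m; have := root4_ge1 m.+1.
  move: (root4 m.+1) (root4 m) => s r s1 r1 hs hr.
  have {hs hr} h : (s - r) * ((s + r) * (s ^+ 2 + r ^+ 2)) = 1.
    by transitivity (s ^+ 4 - r ^+ 4); [ring|rewrite hs hr; ring].
  have sr : r <= s.
    rewrite -subr_ge0 leNgt; apply/negP => sr.
    have : 0 < (s + r) * (s ^+ 2 + r ^+ 2) by nra.
    move=> hh; nra.
  have -> : 4 / r - 4 / s = 4 * (s - r) / (r * s).
    by field; rewrite !gt_eqF //; lra.
  have sp : 0 < s ^+ 5 by rewrite exprn_gt0 //; lra.
  rewrite ler_pdivlMr; last by nra.
  rewrite mulrC ler_pdivrMr //.
  have : (s + r) * (s ^+ 2 + r ^+ 2) <= 4 * s ^+ 3.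
    have : (s + r) * (s ^+ 2 + r ^+ 2) <= (2 * s) * (2 * s ^+ 2).
      by apply: ler_pM; nra.
    by move/le_trans; apply; apply: le_of_eq; ring.
  move=> h4.
  have h5 : 1 <= 4 * (s - r) * s ^+ 3.
    have hsr : 0 <= s - r by lra.
    have := ler_wpM2l hsr h4.
    by rewrite h (_ : (s - r) * (4 * s ^+ 3) = 4 * (s - r) * s ^+ 3) //; ring.
  have -> : 4 * (s - r) * s ^+ 5 = (4 * (s - r) * s ^+ 3) * s ^+ 2 by ring.
  have : 1 * s ^+ 2 <= (4 * (s - r) * s ^+ 3) * s ^+ 2.
    by apply: ler_wpM2r => //; exact: sqr_ge0.
  nra.
by rewrite /root4 !sqrtr1 expr1n invr1; lra.
Qed.

(** For k nonzero, (|k1| + 1) (|k2| + 1) <= (2 |k|)^2, so the summand is at most 2^5 times a product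
    of two summable functions of the coordinates; 2592 = 32 * 9^2. *)
Lemma sum_rho5 (F : seq Z2) : uniq F -> 0 \notin F ->
  \sum_(k <- F) (rho k ^+ 5)^-1 <= 2592.
Proof.
move=> uF F0.
apply: le_trans (_ : \sum_(k <- F) 32 * ((root4 (absz k.1) ^+ 5)^-1 *
   (root4 (absz k.2) ^+ 5)^-1) <= _); last first.
  rewrite -mulr_sumr (_ : 2592 = 32 * 9 ^+ 2); last by lra.
  rewrite ler_pM2l //; apply: (@sum_Z2_le (fun m => (root4 m ^+ 5)^-1)) => // [m|G uG]; last exact: sum_root4.
  by rewrite invr_ge0 exprn_ge0 // sqrtr_ge0.
rewrite big_seq [leRHS]big_seq; apply: ler_sum => k kF.
have k0 : k != 0 by apply: contraNneq F0 => <-.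
rewrite -invfM -exprMn.
set r := root4 _ * root4 _.
have r1 : 1 <= r by rewrite -[1]mulr1 ler_pM // root4_ge1.
have h4 : r ^+ 4 <= (2 * nk k) ^+ 2.
  rewrite exprMn !root4_4 exprMn nk_absz.
  have := nk_ge1 k0; rewrite -(@ler_pXn2r _ 2) ?nnegrE ?nk_ge0 // expr1n nk_absz.
  have : 0 <= (absz k.1)%:R :> R by []. have : 0 <= (absz k.2)%:R :> R by [].
  move: (absz k.1)%:R (absz k.2)%:R => x y y0 x0 h.
  by have := sqr_ge0 (x - 1); have := sqr_ge0 (y - 1); have := sqr_ge0 (x - y); nra.
have h2 : r ^+ 2 <= 2 * nk k.
  by apply: le_sqrtP; [rewrite mulr_ge0 ?nk_ge0|rewrite -exprM].
have h1 : r <= 2 * rho k.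
  apply: le_sqrtP; first by rewrite mulr_ge0 ?rho_ge0.
  by rewrite [leRHS]exprMn rho_sqr; have := nk_ge0 k; nra.
have p1 : 0 < rho k by exact: rho_gt0.
rewrite -[leLHS]mul1r ler_pdivrMr ?exprn_gt0 // mulrAC ler_pdivlMr; last first.
  by rewrite exprn_gt0 //; lra.
rewrite mul1r (_ : 32 = 2 ^+ 5); last by ring.
by rewrite -exprMn ler_pXn2r ?nnegrE //; lra.
Qed.

End Lattice.

(** * Square-summable sequences and convolution estimates *)

Section Convolutions.
Context {R : realType}.
Implicit Types (x y z : Z2 -> R) (F G : seq Z2).

(** An l^2 bound tested on finite sets, so that no infinite sum is formed; it is invariant under
    translations and reflections of the lattice. *)
Definition l2b x (X : R) :=
  forall F, uniq F -> \sum_(k <- F) x k ^+ 2 <= X ^+ 2.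

Lemma l2b_shift x X j F : l2b x X -> uniq F ->
  \sum_(l <- F) x (j + l) ^+ 2 <= X ^+ 2.
Proof.
move=> hx uF; rewrite -(big_map (fun l => j + l) xpredT (fun k => x k ^+ 2)).
by apply: hx; rewrite map_inj_uniq //; exact: addrI.
Qed.

Lemma l2b_shiftN x X j F : l2b x X -> uniq F ->
  \sum_(l <- F) x (j - l) ^+ 2 <= X ^+ 2.
Proof.
move=> hx uF; rewrite -(big_map (fun l => j - l) xpredT (fun k => x k ^+ 2)).
by apply: hx; rewrite map_inj_uniq // => a b /addrI /oppr_inj.
Qed.

Lemma l2b_le x y X : (forall k, `|x k| <= `|y k|) -> l2b y X -> l2b x X.
Proof.
move=> h hy F uF; apply: le_trans (hy F uF); apply: ler_sum => k _.
by rewrite -[leLHS]real_normK ?num_real // -[leRHS]real_normK ?num_real // ler_pXn2r ?nnegrE.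
Qed.

Lemma l2b_leX x X Y : 0 <= X -> X <= Y -> l2b x X -> l2b x Y.
Proof.
move=> X0 XY hx F uF; apply: le_trans (hx F uF) _.
by rewrite ler_pXn2r ?nnegrE // (le_trans X0).
Qed.

Lemma l2b_pt x X k : 0 <= X -> l2b x X -> `|x k| <= X.
Proof.
move=> X0 h; have := h [:: k] isT; rewrite big_seq1 => hk.
by rewrite -(@ler_pXn2r _ 2) ?nnegrE // real_normK ?num_real.
Qed.

(* Cauchy-Schwarz over pairs, with the weights split so that the remaining
   lattice sum is the convolution square of [wgt N ^- 2]. *)
Lemma tri_est (N : R) x y z (X Y Z : R) F G :
  1 <= N -> 0 <= X -> 0 <= Y -> 0 <= Z ->
  l2b x X -> l2b (fun k => wgt N k * y k) Y -> l2b (fun k => wgt N k * z k) Z ->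
  uniq F -> uniq G ->
  \sum_(j <- F) \sum_(l <- G) x j * y l * z (j + l) <= 8 / N * (X * Y * Z).
Proof.
move=> N1 X0 Y0 Z0 hx hy hz uF uG; have N0 : 0 < N by lra.
have N80 : 0 <= 8 / N by rewrite divr_ge0 // ltW.
have w0 k : wgt N k != 0 by rewrite gt_eqF // wgt_gt0.
pose A (p : Z2 * Z2) := x p.1 * ((wgt N p.2)^-1 * (wgt N (p.1 + p.2))^-1).
pose B (p : Z2 * Z2) := (wgt N p.2 * y p.2) * (wgt N (p.1 + p.2) * z (p.1 + p.2)).
have -> : \sum_(j <- F) \sum_(l <- G) x j * y l * z (j + l) =
    \sum_(p <- allpairs pair F G) A p * B p.
  rewrite big_allpairs; apply: eq_bigr => j _; apply: eq_bigr => l _.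
  by rewrite /A /B /=; field; rewrite !w0.
rewrite (_ : 8 / N * (X * Y * Z) = (8 / N * X) * (Y * Z)); last by ring.
apply: sum_CS_le; [exact: mulr_ge0|exact: mulr_ge0| |]; rewrite big_allpairs /=.
- rewrite exprMn mulrC; apply: (@le_trans _ _ (\sum_(j <- F) x j ^+ 2 * (8 / N) ^+ 2)).
    apply: ler_sum => j _; rewrite /A /=; under eq_bigr do rewrite exprMn.
    rewrite -mulr_sumr; apply: ler_wpM2l; first exact: sqr_ge0.
    apply: (@le_trans _ _ (\sum_(l <- G) (((wgt N l ^+ 4)^-1 + (wgt N (j + l) ^+ 4)^-1) / 2))).
      apply: ler_sum => l _.
      have := amgm ((wgt N l)^-1 ^+ 2) ((wgt N (j + l))^-1 ^+ 2).
      by rewrite -!exprM exprMn !exprVn; lra.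
    rewrite -mulr_suml big_split /= ler_pdivrMr // mulr_natr mulr2n.
    apply: lerD; first exact: sum_wgt.
    rewrite -(big_map (fun l => j + l) xpredT (fun k => (wgt N k ^+ 4)^-1)).
    by apply: sum_wgt => //; rewrite map_inj_uniq //; exact: addrI.
  by rewrite -mulr_suml ler_wpM2r ?sqr_ge0 // hx.
- rewrite exchange_big /= exprMn.
  apply: (@le_trans _ _ (\sum_(l <- G) (wgt N l * y l) ^+ 2 * Z ^+ 2)); last first.
    by rewrite -mulr_suml ler_wpM2r ?sqr_ge0 // hy.
  apply: ler_sum => l _; rewrite /B /=; under eq_bigr do rewrite exprMn.
  rewrite -mulr_sumr; apply: ler_wpM2l; first exact: sqr_ge0.
  have := l2b_shift l hz uF; under eq_bigr do rewrite addrC.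
  exact.
Qed.

(** As |k| <= |j| + |k - j|, the factor |k| falls on one of the two sequences; the products are then
    split by the arithmetic-geometric inequality into four l^2 sums. This starts the bootstrap from
    a bound in V. *)
Lemma conv_h1 x X F k :
  (forall k, 0 <= x k) -> x 0 = 0 -> l2b (fun k => nk k * x k) X -> uniq F ->
  nk k * \sum_(j <- F) x j * x (k - j) <= 2 * X ^+ 2.
Proof.
move=> x0 x00 hX uF.
have hx : l2b x X.
  apply: l2b_le hX => j; rewrite normrM (ger0_norm (nk_ge0 _)).
  have [->|j0] := eqVneq j 0; first by rewrite x00 normr0 mulr0.
  by rewrite ler_peMl // nk_ge1.
rewrite mulr_sumr.
apply: (@le_trans _ _ (\sum_(j <- F) (((nk j * x j) ^+ 2 + x (k - j) ^+ 2) / 2 +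
    ((nk (k - j) * x (k - j)) ^+ 2 + x j ^+ 2) / 2))).
  apply: ler_sum => j _.
  have h := nkD (R := R) j (k - j); rewrite addrC subrK in h.
  have h1 := amgm (nk j * x j) (x (k - j)).
  have h2 := amgm (nk (k - j) * x (k - j)) (x j).
  have := ler_wpM2r (mulr_ge0 (x0 j) (x0 (k - j))) h; lra.
rewrite big_split /= -!mulr_suml !big_split /=.
have := hX F uF; have := hx F uF.
have := l2b_shiftN k hx uF; have := l2b_shiftN k hX uF => /=; lra.
Qed.

(** Let p <= q be the values of [rho] at j and k - j, in increasing order. Then [rho k] <= 2 q, so q
    carries the decay to the power m + 3. The remaining factor p^-(m+4) q^-1 is at most p^-5, which
    is summable: one power is lost to reach a summable exponent. *)
Lemma conv_rho (m : nat) x (C : R) F k :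
  0 <= C -> (forall k, 0 <= x k) -> x 0 = 0 ->
  (forall k, k != 0 -> x k <= C / rho k ^+ m.+4) -> uniq F -> k != 0 ->
  \sum_(j <- F) x j * x (k - j) <= C ^+ 2 * 2 ^+ m.+3 * 5184 / rho k ^+ m.+3.
Proof.
move=> C0 x0 x00 hx uF k0.
have rk : 0 < rho k :> R by exact: rho_gt0.
have xz j : (j == 0) || (k - j == 0) -> x j * x (k - j) = 0.
  by case/orP => /eqP ->; rewrite x00 ?mul0r ?mulr0.
rewrite (bigID (fun j => (j == 0) || (k - j == 0))) /= big1 ?add0r //.
apply: (@le_trans _ _ (\sum_(j <- F | ~~ ((j == 0) || (k - j == 0)))
   (C ^+ 2 * 2 ^+ m.+3 / rho k ^+ m.+3) * ((rho j ^+ 5)^-1 + (rho (k - j) ^+ 5)^-1))).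
  apply: ler_sum => j; rewrite negb_or => /andP[j0 kj0].
  apply: (@le_trans _ _ (C / rho j ^+ m.+4 * (C / rho (k - j) ^+ m.+4))).
    by apply: ler_pM => //; exact: hx.
  have ra : 1 <= rho j :> R by exact: rho_ge1.
  have rb : 1 <= rho (k - j) :> R by exact: rho_ge1.
  have h := rhoD (R := R) j (k - j); rewrite addrC subrK in h.
  move: (rho j) (rho (k - j)) (rho k) ra rb h rk => a b c a1 b1 h c0.
  have a0 : 0 < a by lra. have b0 : 0 < b by lra.
  rewrite (_ : C / a ^+ m.+4 * (C / b ^+ m.+4) =
     (C ^+ 2 / c ^+ m.+3) * (c ^+ m.+3 / (a ^+ m.+4 * b ^+ m.+4))); last first.
    by field; rewrite !expf_neq0 ?gt_eqF.
  rewrite (_ : C ^+ 2 * 2 ^+ m.+3 / c ^+ m.+3 * _ =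
     (C ^+ 2 / c ^+ m.+3) * (2 ^+ m.+3 * ((a ^+ 5)^-1 + (b ^+ 5)^-1))); last by ring.
  apply: ler_wpM2l; first by rewrite divr_ge0 ?sqr_ge0 // exprn_ge0 // ltW.
  have wl (p q : R) : 1 <= p -> p <= q -> c <= p + q ->
      c ^+ m.+3 / (p ^+ m.+4 * q ^+ m.+4) <= 2 ^+ m.+3 * (p ^+ 5)^-1.
    move=> p1 pq cpq; have p0 : 0 < p by lra. have q0 : 0 < q by lra.
    have pq0 : 0 < p ^+ m.+4 * q ^+ m.+4 by apply: mulr_gt0; exact: exprn_gt0.
    rewrite ler_pdivrMr //.
    apply: (@le_trans _ _ ((2 * q) ^+ m.+3)).
      by rewrite lerXn2r ?nnegrE; lra.
    have -> : (2 * q) ^+ m.+3 = 2 ^+ m.+3 * q ^+ m.+3 by exact: exprMn.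
    have e4 : p ^+ m.+4 = p ^+ m * p ^+ 4 by rewrite -exprD addn4.
    have eq : q ^+ m.+4 = q * q ^+ m.+3 by exact: exprS.
    have -> : 2 ^+ m.+3 * (p ^+ 5)^-1 * (p ^+ m.+4 * q ^+ m.+4) =
        2 ^+ m.+3 * q ^+ m.+3 * (p ^+ m * (q / p)).
      rewrite e4 eq; move: (2 ^+ m.+3) (q ^+ m.+3) (p ^+ m) => A B D.
      by field; rewrite gt_eqF.
    rewrite -[leLHS]mulr1; apply: ler_wpM2l.
      by apply: mulr_ge0; apply: exprn_ge0 => //; exact: ltW.
    rewrite -[leLHS]mulr1; apply: ler_pM => //; first by rewrite exprn_ege1.
    by rewrite ler_pdivlMr // mul1r.
  have i0 (p : R) : 1 <= p -> 0 <= (p ^+ 5)^-1.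
    by move=> p1; rewrite invr_ge0 exprn_ge0 //; lra.
  rewrite mulrDr; have [ab|ab] := leP a b.
    apply: le_trans (wl a b a1 ab h) _; rewrite lerDl mulr_ge0 ?exprn_ge0 ?i0 //.
  rewrite [a ^+ _ * _]mulrC; apply: le_trans (wl b a b1 (ltW ab) _) _.
    by rewrite addrC.
  by rewrite lerDr mulr_ge0 ?exprn_ge0 ?i0.
rewrite -mulr_sumr (_ : C ^+ 2 * 2 ^+ m.+3 * 5184 / rho k ^+ m.+3 =
  (C ^+ 2 * 2 ^+ m.+3 / rho k ^+ m.+3) * 5184); last by ring.
apply: ler_wpM2l.
  by apply: divr_ge0; [apply: mulr_ge0|]; apply: exprn_ge0 => //; exact: ltW.
rewrite -big_filter big_split /=.
set H := [seq _ <- F | _].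
have uH : uniq H by exact: filter_uniq.
have -> : 5184 = 2592 + 2592 :> R by lra.
apply: lerD.
  by apply: sum_rho5 => //; rewrite mem_filter eqxx.
rewrite -(big_map (fun l => k - l) xpredT (fun k => (rho k ^+ 5)^-1)).
apply: sum_rho5; first by rewrite map_inj_uniq // => a b /addrI /oppr_inj.
apply/mapP => -[j]; rewrite mem_filter negb_or => /andP[/andP[_ /eqP h] _].
by move=> /esym.
Qed.

End Convolutions.

(** * Differential inequalities on the whole line *)

Section RealLine.
Context {R : realType}.

Lemma ge0_derive_ndecr (f df : R -> R) (s t : R) :
  (forall x, is_derive x (1 : R) f (df x)) -> s <= t ->
  (forall x, s <= x <= t -> 0 <= df x) -> f s <= f t.
Proof.
move=> hf st hd.
have [c cst h] := @MVT_segment R f df s t st (fun x _ => hf x)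
  (derivable_within_continuous (fun x _ => @ex_derive _ _ _ _ _ _ _ (hf x))).
by rewrite -subr_ge0 h mulr_ge0 ?subr_ge0 // hd.
Qed.

(** If [y] exceeded b / a at some time, its excess would be multiplied by at least e^(aT) on going
    back by T, against the upper bound [C]. *)
Lemma gronwall_bounded (y dy : R -> R) (a b C : R) :
  0 < a -> (forall t, is_derive t (1 : R) y (dy t)) ->
  (forall t, dy t <= b - a * y t) -> (forall t, y t <= C) ->
  forall t, y t <= b / a.
Proof.
move=> a0 hy hd hC t; rewrite leNgt; apply/negP => hlt.
set d := y t - b / a; have d0 : 0 < d by rewrite subr_gt0.
(* With e^x >= 1 + x, going back by this [T] makes the excess larger than C - b / a. *)
pose T := (`|C - b / a| + 1) / (a * d).
have T0 : 0 < T by rewrite divr_gt0 ?mulr_gt0 // ltr_wpDl.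
pose g s := expR (a * s) * (b / a - y s).
have hg s : is_derive s (1 : R) g (expR (a * s) * (b - a * y s - dy s)).
  have hy' := hy s.
  rewrite /g; apply: is_derive_eq; rewrite /GRing.scale /=.
  by field; rewrite gt_eqF.
have := @ge0_derive_ndecr g _ (t - T) t hg; rewrite lerBlDr lerDl ltW // => /(_ isT).
have h0 x : t - T <= x <= t -> 0 <= expR (a * x) * (b - a * y x - dy x).
  by move=> _; rewrite mulr_ge0 ?expR_ge0 // subr_ge0.
move=> /(_ h0); rewrite /g.
have -> : expR (a * t) = expR (a * (t - T)) * expR (a * T) by rewrite -expRD; congr expR; ring.
rewrite -mulrA ler_pM2l ?expR_gt0 // => h.
have := hC (t - T); have := expR_ge1Dx (a * T).
have aT : a * T * d = `|C - b / a| + 1.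
  by rewrite /T; field; rewrite !gt_eqF.
have := ler_norm (C - b / a).
have h' : d * expR (a * T) <= y (t - T) - b / a by rewrite /d; lra.
move=> h1 h2 h3.
have : d * (1 + a * T) <= d * expR (a * T) by rewrite ler_pM2l.
lra.
Qed.

End RealLine.

(** * Moduli of complex numbers *)

Notation cRe := complex.Re.
Notation cIm := complex.Im.

Ltac cring := apply/eqP; rewrite eq_complex /=; apply/andP; split; apply/eqP; ring.

Section ComplexModulus.
Context {R : realType}.
Implicit Types z w : R[i].

(** The modulus with values in [R], so that it enters real inequalities and real derivatives; the
    norm of [R[i]] is again a complex number. *)
Definition cn z : R := Num.sqrt (cRe z ^+ 2 + cIm z ^+ 2).

Lemma cn_sqr z : cn z ^+ 2 = cRe z ^+ 2 + cIm z ^+ 2.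
Proof. by rewrite sqr_sqrtr // addr_ge0 ?sqr_ge0. Qed.

Lemma cn_ge0 z : 0 <= cn z. Proof. exact: sqrtr_ge0. Qed.

Lemma cReD z w : cRe (z + w) = cRe z + cRe w. Proof. by case: z w => a b [c d]. Qed.
Lemma cImD z w : cIm (z + w) = cIm z + cIm w. Proof. by case: z w => a b [c d]. Qed.
Lemma cReN z : cRe (- z) = - cRe z. Proof. by case: z. Qed.
Lemma cImN z : cIm (- z) = - cIm z. Proof. by case: z. Qed.
Lemma cReB z w : cRe (z - w) = cRe z - cRe w. Proof. by rewrite cReD cReN. Qed.
Lemma cImB z w : cIm (z - w) = cIm z - cIm w. Proof. by rewrite cImD cImN. Qed.
Lemma cReM z w : cRe (z * w) = cRe z * cRe w - cIm z * cIm w.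
Proof. by case: z w => a b [c d]. Qed.
Lemma cImM z w : cIm (z * w) = cRe z * cIm w + cIm z * cRe w.
Proof. by case: z w => a b [c d]. Qed.
Lemma cReJ z : cRe (conjc z) = cRe z. Proof. by case: z. Qed.
Lemma cImJ z : cIm (conjc z) = - cIm z. Proof. by case: z. Qed.
Lemma cRe_sum (I : Type) (r : seq I) (P : pred I) (f : I -> R[i]) :
  cRe (\sum_(i <- r | P i) f i) = \sum_(i <- r | P i) cRe (f i).
Proof. by elim/big_rec2 : _ => // i x y _ <-; rewrite cReD. Qed.
Lemma cIm_sum (I : Type) (r : seq I) (P : pred I) (f : I -> R[i]) :
  cIm (\sum_(i <- r | P i) f i) = \sum_(i <- r | P i) cIm (f i).
Proof. by elim/big_rec2 : _ => // i x y _ <-; rewrite cImD. Qed.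

Lemma cn0 : cn 0 = 0. Proof. by rewrite /cn /= expr0n /= addr0 sqrtr0. Qed.
Lemma cnN z : cn (- z) = cn z.
Proof. by rewrite /cn cReN cImN !sqrrN. Qed.
Lemma cnJ z : cn (conjc z) = cn z.
Proof. by rewrite /cn cReJ cImJ sqrrN. Qed.
Lemma cnM z w : cn (z * w) = cn z * cn w.
Proof.
rewrite /cn cReM cImM -sqrtrM ?addr_ge0 ?sqr_ge0 //; congr Num.sqrt; ring.
Qed.
Lemma cn_real (x : R) : cn (x%:C)%C = `|x|.
Proof. by rewrite /cn /= expr0n /= addr0 sqrtr_sqr. Qed.
Lemma cn_i : cn ('i)%C = 1.
Proof. by rewrite /cn /= expr0n /= add0r expr1n sqrtr1. Qed.
Lemma cRe_le z : `|cRe z| <= cn z.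
Proof.
by rewrite -sqrtr_sqr ler_sqrt ?lerDl ?sqr_ge0 // addr_ge0 ?sqr_ge0.
Qed.
Lemma cIm_le z : `|cIm z| <= cn z.
Proof.
by rewrite -sqrtr_sqr ler_sqrt ?lerDr ?sqr_ge0 // addr_ge0 ?sqr_ge0.
Qed.
Lemma cn_dot z w : `|cRe z * cRe w + cIm z * cIm w| <= cn z * cn w.
Proof. by have := cRe_le (z * conjc w); rewrite cReM cReJ cImJ mulrN opprK cnM cnJ. Qed.
Lemma cnD z w : cn (z + w) <= cn z + cn w.
Proof.
apply: le_sqrtP; first by rewrite addr_ge0 ?cn_ge0.
have := ler_norm (cRe z * cRe w + cIm z * cIm w).
move/le_trans/(_ (cn_dot z w)).
rewrite cn_sqr cReD cImD !sqrrD !cn_sqr !mulr2n; lra.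
Qed.
Lemma cnB z w : cn (z - w) <= cn z + cn w.
Proof. by rewrite -(cnN w); exact: cnD. Qed.
Lemma cn_sum (I : Type) (r : seq I) (P : pred I) (f : I -> R[i]) :
  cn (\sum_(i <- r | P i) f i) <= \sum_(i <- r | P i) cn (f i).
Proof.
elim/big_ind2 : _ => [|x1 x2 y1 y2 h1 h2|//]; first by rewrite cn0.
by apply: le_trans (cnD _ _) _; exact: lerD.
Qed.
Lemma cn_le_ReIm z : cn z <= `|cRe z| + `|cIm z|.
Proof.
apply: le_sqrtP; first by rewrite addr_ge0.
rewrite cn_sqr sqrrD !real_normK ?num_real // lerD2r lerDl.
by rewrite mulrn_wge0 // mulr_ge0.
Qed.

End ComplexModulus.

(** * The trilinear form in Fourier coordinates *)

Section Trilinear.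
Context {R : realType}.
Implicit Types (a b c s r : Z2 -> R[i]) (F G H : seq Z2).

Definition prs F G H : seq (Z2 * Z2) :=
  [seq p <- allpairs pair F G | p.1 + p.2 \in H].

Lemma mem_prs F G H p :
  (p \in prs F G H) = [&& p.1 \in F, p.2 \in G & p.1 + p.2 \in H].
Proof.
rewrite mem_filter andbC andbA; congr (_ && _).
apply/allpairsP/andP => [[[j l] [h1 h2 ->]]//|[h1 h2]].
by exists p; rewrite -surjective_pairing.
Qed.

Lemma uniq_prs F G H : uniq F -> uniq G -> uniq (prs F G H).
Proof.
move=> uF uG; apply/filter_uniq/allpairs_uniq => //.
by move=> [? ?] [? ?] _ _ /= [-> ->].
Qed.

Lemma sum_prs (V : nmodType) F G H (f : Z2 -> Z2 -> V) :
  \sum_(p <- prs F G H) f p.1 p.2 =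
  \sum_(j <- F) \sum_(l <- G | j + l \in H) f j l.
Proof.
rewrite big_filter big_mkcond big_allpairs /=.
by apply: eq_bigr => j _; rewrite [RHS]big_mkcond.
Qed.

Lemma sum_prs_sift (V : nmodType) F G H (f : Z2 -> Z2 -> V) : uniq H ->
  \sum_(k <- H) \sum_(p <- prs F G [:: k]) f p.1 p.2 =
  \sum_(p <- prs F G H) f p.1 p.2.
Proof.
move=> uH; under eq_bigr do rewrite big_filter.
rewrite (exchange_big_dep xpredT) //= [RHS]big_filter [RHS]big_mkcond /=.
apply: eq_bigr => p _.
rewrite (eq_bigl (fun k => k == p.1 + p.2)); last by move=> k; rewrite inE eq_sym.
rewrite -big_filter; case: ifP => pH; first by rewrite filter_pred1_uniq ?big_seq1.
rewrite big_filter big_seq_cond big1 // => k /andP[kH /eqP kE].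
by rewrite -kE kH in pH.
Qed.

(** An injection of a finite set into itself permutes it. It is used for transpositions and for a
    three-cycle. *)
Lemma sum_invol (V : nmodType) (I : eqType) (r : seq I) (phi : I -> I)
    (f : I -> V) :
  uniq r -> injective phi -> {subset map phi r <= r} ->
  \sum_(p <- r) f (phi p) = \sum_(p <- r) f p.
Proof.
move=> ur iphi sub; rewrite -(big_map phi xpredT f); apply: perm_big.
have um : uniq (map phi r) by rewrite map_inj_uniq.
have [] := uniq_min_size um sub; first by rewrite size_map.
by move=> _ h; exact: uniq_perm.
Qed.

Definition symm F := [/\ uniq F, 0 \notin F & forall k, (- k \in F) = (k \in F)].

Lemma symm_box M : symm (box M).
Proof. by split; [exact: uniq_box|rewrite mem_box eqxx|move=> k; exact: boxN]. Qed.

(* [q j l] is the geometric factor of the interaction j + l = k: the Fourier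
   coefficient at j is a multiple of the unit vector orthogonal to j. *)
Definition q (j l : Z2) : R :=
  crs j l * dot l (j + l) / (nk j * nk l * nk (j + l)).

Lemma crsDr j l : crs j (j + l) = crs j l :> R.
Proof. by rewrite /crs /= !rmorphD /=; ring. Qed.

Lemma le_div1 (x y : R) : 0 <= y -> `|x| <= y -> `|x / y| <= 1.
Proof.
move=> y0; rewrite normrM normfV (ger0_norm y0).
have [->|yn0] := eqVneq y 0; first by rewrite invr0 mulr0 ler01.
by rewrite ler_pdivrMr ?lt_def ?yn0 // mul1r.
Qed.

(** Divided by the norms of their arguments, [crs] and [dot] are a sine and a cosine; one factor |l|
    is left, the derivative in (u . grad) v. *)
Lemma q_lel j l : `|q j l| <= nk l.
Proof.
have [l0|l0] := eqVneq l 0.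
  by rewrite /q l0 /crs /= mulr0 mulr0 subrr !mul0r normr0 nk0.
have -> : q j l = (crs j l / (nk j * nk l)) * (dot l (j + l) / (nk l * nk (j + l))) * nk l.
  rewrite /q !invfM; have := nk_gt0 (R := R) l0; move: (nk j)^-1 (nk (j + l))^-1 => A B.
  by move=> h; field; rewrite gt_eqF.
rewrite normrM (ger0_norm (nk_ge0 l)) -[leRHS]mul1r ler_wpM2r ?nk_ge0 //.
rewrite normrM mulr_ile1 // le_div1 ?mulr_ge0 ?nk_ge0 ?crs_nk ?dot_nk //.
Qed.

(** Integration by parts in Fourier form: [crs j l = crs j (j + l)], by incompressibility, so the
    derivative can be charged to the output mode. *)
Lemma q_lek j l : `|q j l| <= nk (j + l).
Proof.
have [l0|l0] := eqVneq (j + l) 0.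
  by rewrite /q l0 /dot /= !mulr0 addr0 !(mulr0, mul0r) normr0 nk0.
have -> : q j l = (crs j (j + l) / (nk j * nk (j + l))) *
    (dot l (j + l) / (nk l * nk (j + l))) * nk (j + l).
  rewrite /q crsDr !invfM; have := nk_gt0 (R := R) l0; move: (nk j)^-1 (nk l)^-1 => A B.
  by move=> h; field; rewrite gt_eqF.
rewrite normrM (ger0_norm (nk_ge0 _)) -[leRHS]mul1r ler_wpM2r ?nk_ge0 //.
rewrite normrM mulr_ile1 // le_div1 ?mulr_ge0 ?nk_ge0 ?crs_nk ?dot_nk //.
Qed.

Definition tterm a b c (j l : Z2) : R :=
  q j l * cRe ('i%C * (a j * b l * conjc (c (j + l)))).

(** Up to normalization this is the trilinear form <B(a, b), c> with inputs in [F] and [G] and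
    outputs in [H]. The three sets are separate because inputs and outputs are truncated at
    different stages. *)
Definition TT F G H a b c : R := \sum_(p <- prs F G H) tterm a b c p.1 p.2.

Lemma tterm_abs a b c j l :
  `|tterm a b c j l| <= `|q j l| * (cn (a j) * cn (b l) * cn (c (j + l))).
Proof.
rewrite normrM ler_wpM2l //; apply: le_trans (cRe_le _) _.
by rewrite !cnM cn_i mul1r cnJ.
Qed.

Lemma TT_abs F G H a b c :
  `|TT F G H a b c| <=
  \sum_(p <- prs F G H) `|q p.1 p.2| * (cn (a p.1) * cn (b p.2) * cn (c (p.1 + p.2))).
Proof.
apply: le_trans (ler_norm_sum _ _ _) _; apply: ler_sum => p _; exact: tterm_abs.
Qed.

Lemma sum_prs_le F G H (f : Z2 -> Z2 -> R) : (forall j l, 0 <= f j l) ->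
  \sum_(p <- prs F G H) f p.1 p.2 <= \sum_(j <- F) \sum_(l <- G) f j l.
Proof.
move=> f0; rewrite sum_prs; apply: ler_sum => j _; rewrite big_mkcond /=.
by apply: ler_sum => l _; case: ifP.
Qed.

(** The derivative stays on [b], which is estimated in V; the gain 1 / N comes from the weights on
    [a] and [c]. It is used with the difference of the two trajectories as [a] and [c]. *)
Lemma TT_est_vel (N A B D : R) F G H a b c :
  1 <= N -> 0 <= A -> 0 <= B -> 0 <= D -> uniq F -> uniq G ->
  l2b (fun k => wgt N k * cn (a k)) A -> l2b (fun k => nk k * cn (b k)) B ->
  l2b (fun k => wgt N k * cn (c k)) D ->
  `|TT F G H a b c| <= 8 / N * (A * B * D).
Proof.
move=> N1 A0 B0 D0 uF uG ha hb hc; apply: le_trans (TT_abs _ _ _ _ _ _) _.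
apply: (@le_trans _ _ (\sum_(p <- prs F G H) (nk p.2 * cn (b p.2)) * cn (a p.1) * cn (c (p.2 + p.1)))).
  apply: ler_sum => p _; rewrite [p.2 + p.1]addrC.
  rewrite (_ : nk p.2 * cn (b p.2) * cn (a p.1) * cn (c (p.1 + p.2)) =
    nk p.2 * (cn (a p.1) * cn (b p.2) * cn (c (p.1 + p.2)))); last by ring.
  by rewrite ler_wpM2r ?q_lel // !mulr_ge0 ?cn_ge0.
apply: le_trans (@sum_prs_le F G H (fun j l => nk l * cn (b l) * cn (a j) * cn (c (l + j))) _) _.
  by move=> j l; rewrite !mulr_ge0 ?cn_ge0 ?nk_ge0.
rewrite exchange_big /= (_ : A * B * D = B * A * D); last by ring.
exact: (tri_est N1 B0 A0 D0 hb ha hc).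
Qed.

Lemma l2b_wgt1 (x : Z2 -> R) X : x 0 = 0 -> l2b (fun k => nk k * x k) X ->
  l2b (fun k => wgt 1 k * x k) X.
Proof.
move=> x0; apply: l2b_le => k.
by have [->|k0] := eqVneq k 0; [rewrite x0 !mulr0|rewrite wgt1].
Qed.

(** The derivative is moved to the test sequence by [q_lek], so that [a] needs only an l^2 bound; on
    nonzero modes the weight at N = 1 is |k|. Here [c] comes from A^-1 P_N u, which has two
    derivatives to spare. *)
Lemma TT_est_test1 (A B D : R) F G H a b c :
  0 <= A -> 0 <= B -> 0 <= D -> uniq F -> uniq G ->
  b 0 = 0 -> c 0 = 0 ->
  l2b (fun k => cn (a k)) A -> l2b (fun k => nk k * cn (b k)) B ->
  l2b (fun k => nk k ^+ 2 * cn (c k)) D ->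
  `|TT F G H a b c| <= 8 * (A * B * D).
Proof.
move=> A0 B0 D0 uF uG b0 c0 ha hb hc; apply: le_trans (TT_abs _ _ _ _ _ _) _.
apply: (@le_trans _ _ (\sum_(p <- prs F G H) cn (a p.1) * cn (b p.2) *
    (nk (p.1 + p.2) * cn (c (p.1 + p.2))))).
  apply: ler_sum => p _.
  rewrite (_ : cn (a p.1) * cn (b p.2) * (nk (p.1 + p.2) * cn (c (p.1 + p.2))) =
    nk (p.1 + p.2) * (cn (a p.1) * cn (b p.2) * cn (c (p.1 + p.2)))); last by ring.
  by rewrite ler_wpM2r ?q_lek // !mulr_ge0 ?cn_ge0.
apply: le_trans (@sum_prs_le F G H (fun j l => cn (a j) * cn (b l) * (nk (j + l) * cn (c (j + l)))) _) _.
  by move=> j l; rewrite !mulr_ge0 ?cn_ge0 ?nk_ge0.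
rewrite -[8]divr1.
apply: (@tri_est _ 1 _ (fun k => cn (b k)) (fun k => nk k * cn (c k)) _ _ _ _ _ (lexx 1) A0 B0 D0 ha _ _ uF uG).
  by apply: l2b_wgt1 => //; rewrite b0 cn0.
apply: (@l2b_wgt1 (fun k => nk k * cn (c k))); first by rewrite c0 cn0 mulr0.
by apply: l2b_le hc => k; rewrite mulrA expr2.
Qed.

(** The same estimate with the roles of the two inputs exchanged, for the case where the second one
    is known only in l^2. *)
Lemma TT_est_test2 (A B D : R) F G H a b c :
  0 <= A -> 0 <= B -> 0 <= D -> uniq F -> uniq G ->
  a 0 = 0 -> c 0 = 0 ->
  l2b (fun k => nk k * cn (a k)) A -> l2b (fun k => cn (b k)) B ->
  l2b (fun k => nk k ^+ 2 * cn (c k)) D ->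
  `|TT F G H a b c| <= 8 * (A * B * D).
Proof.
move=> A0 B0 D0 uF uG a0 c0 ha hb hc; apply: le_trans (TT_abs _ _ _ _ _ _) _.
apply: (@le_trans _ _ (\sum_(p <- prs F G H) cn (b p.2) * cn (a p.1) *
    (nk (p.2 + p.1) * cn (c (p.2 + p.1))))).
  apply: ler_sum => p _; rewrite [p.2 + p.1]addrC.
  rewrite (_ : cn (b p.2) * cn (a p.1) * (nk (p.1 + p.2) * cn (c (p.1 + p.2))) =
    nk (p.1 + p.2) * (cn (a p.1) * cn (b p.2) * cn (c (p.1 + p.2)))); last by ring.
  by rewrite ler_wpM2r ?q_lek // !mulr_ge0 ?cn_ge0.
apply: le_trans (@sum_prs_le F G H (fun j l => cn (b l) * cn (a j) * (nk (l + j) * cn (c (l + j)))) _) _.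
  by move=> j l; rewrite !mulr_ge0 ?cn_ge0 ?nk_ge0.
rewrite exchange_big -[8]divr1 /= (_ : A * B * D = B * A * D); last by ring.
apply: (@tri_est _ 1 _ (fun k => cn (a k)) (fun k => nk k * cn (c k)) _ _ _ _ _ (lexx 1) B0 A0 D0 hb _ _ uG uF).
  by apply: l2b_wgt1 => //; rewrite a0 cn0.
apply: (@l2b_wgt1 (fun k => nk k * cn (c k))); first by rewrite c0 cn0 mulr0.
by apply: l2b_le hc => k; rewrite mulrA expr2.
Qed.

Lemma TT_addl F G H a a' b c :
  TT F G H (fun k => a k + a' k) b c = TT F G H a b c + TT F G H a' b c.
Proof.
rewrite -big_split; apply: eq_bigr => p _.
by rewrite /tterm /= -mulrDr -cReD; congr (_ * cRe _); ring.
Qed.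

Lemma TT_addm F G H a b b' c :
  TT F G H a (fun k => b k + b' k) c = TT F G H a b c + TT F G H a b' c.
Proof.
rewrite -big_split; apply: eq_bigr => p _.
by rewrite /tterm /= -mulrDr -cReD; congr (_ * cRe _); ring.
Qed.

(** The reality condition in these coordinates: the coefficients of a real field at k and -k are
    conjugate, and the unit vector orthogonal to k changes sign with k. *)
Definition rl s := forall k, s (- k) = - conjc (s k).

(** The map sending (j, l) to (j, -(j + l)) exchanges the last two members of the triad j, l, -(j +
    l) and changes the sign of [q]. *)
Lemma TT_antisym F a b c : symm F -> rl a -> rl b -> rl c ->
  TT F F F a b c = - TT F F F a c b.
Proof.
move=> [uF F0 sF] ra rb rc.
pose phi (p : Z2 * Z2) := (p.1, - (p.1 + p.2)).
have phiI : injective phi.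
  move=> [j l] [j' l'] h; have := congr1 snd h; have := congr1 fst h => /= ->.
  by move=> /oppr_inj/addrI ->.
have sphi : {subset map phi (prs F F F) <= prs F F F}.
  move=> _ /mapP[[j l] /[swap] -> ]; rewrite !mem_prs /= => /and3P[jF lF jlF].
  by rewrite jF sF jlF opprD addNKr sF.
rewrite /TT -(sum_invol _ (uniq_prs _ uF uF) phiI sphi) -sumrN.
apply: eq_bigr => -[j l] _; rewrite /tterm /phi /=.
have -> : j - (j + l) = - l by rewrite opprD addNKr.
rewrite (_ : q j (- (j + l)) = - q j l); last first.
  rewrite /q (_ : j - (j + l) = - l) ?opprD ?addNKr // -opprD !nkN.
  rewrite (_ : crs j (- (j + l)) = - crs j l); last first.
    by rewrite /crs /= !rmorphN /= !rmorphD /=; ring.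
  rewrite (_ : dot (- (j + l)) (- l) = dot l (j + l)); last first.
    by rewrite /dot /= !rmorphN /= !rmorphD /=; ring.
  by rewrite !mulNr (mulrAC (nk j)).
rewrite !mulNr; congr (- (_ * _)).
rewrite rb rc; case: (a j) (b (j + l)) (c l) => a1 a2 [b1 b2] [c1 c2] /=; ring.
Qed.

Lemma TT_self0 F a b : symm F -> rl a -> rl b -> TT F F F a b b = 0.
Proof. by move=> sF ra rb; have := TT_antisym sF ra rb rb; lra. Qed.

Lemma rl_scale s (g : Z2 -> R) : rl s -> (forall k, g (- k) = g k) ->
  rl (fun k => (g k)%:C%C * s k).
Proof.
move=> rs gN k; rewrite rs gN; case: (s k) => x y.
by cring.
Qed.

Lemma rlB s s' : rl s -> rl s' -> rl (fun k => s k - s' k).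
Proof.
move=> h h' k; rewrite h h'; case: (s k) (s' k) => x y [x' y'].
by cring.
Qed.

(** The sum is compared with its average over the six permutations of the triad j, l, -(j + l),
    generated by the transposition [phi] and the three-cycle [psi]. The amplitude [P] is invariant
    under them by the reality condition, and the six geometric factors times |k|^2 add up to zero, a
    polynomial identity in the coordinates. *)
Lemma TT_enstrophy F s : symm F -> rl s ->
  TT F F F s s (fun k => (nk k ^+ 2)%:C%C * s k) = 0.
Proof.
move=> [uF F0 sF] rs.
pose phi (p : Z2 * Z2) := (p.1, - (p.1 + p.2)).
have phiI : injective phi.
  move=> [j l] [j' l'] h; have := congr1 snd h; have := congr1 fst h => /= ->.
  by move=> /oppr_inj/addrI ->.
have sphi : {subset map phi (prs F F F) <= prs F F F}.
  move=> _ /mapP[[j l] /[swap] -> ]; rewrite !mem_prs /= => /and3P[jF lF jlF].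
  by rewrite jF sF jlF opprD addNKr sF.
pose psi (p : Z2 * Z2) := (p.2, - (p.1 + p.2)).
have psiI : injective psi.
  move=> [j l] [j' l'] h; have := congr1 snd h; have := congr1 fst h => /= ->.
  by move=> /oppr_inj/addIr ->.
have spsi : {subset map psi (prs F F F) <= prs F F F}.
  move=> _ /mapP[[j l] /[swap] -> ]; rewrite !mem_prs /= => /and3P[jF lF jlF].
  by rewrite lF sF jlF addrC opprD subrK sF.
have uP := uniq_prs F uF uF.
pose P (j l : Z2) := cRe ('i%C * (s j * s l * conjc (s (j + l)))) / (nk j * nk l * nk (j + l)).
pose e (p : Z2 * Z2) := P p.1 p.2 * (crs p.1 p.2 * dot p.2 (p.1 + p.2) * nk (p.1 + p.2) ^+ 2).
have eE : TT F F F s s (fun k => (nk k ^+ 2)%:C%C * s k) = \sum_(p <- prs F F F) e p.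
  apply: eq_bigr => -[j l] _; rewrite /tterm /e /P /q /=.
  case: (s j) (s l) (s (j + l)) => a1 a2 [b1 b2] [c1 c2] /=; ring.
have PS p : P (phi p).1 (phi p).2 = P p.1 p.2.
  case: p => j l; rewrite /P /phi /=.
  have -> : j - (j + l) = - l by rewrite opprD addNKr.
  rewrite !rs !nkN; case: (s j) (s l) (s (j + l)) => a1 a2 [b1 b2] [c1 c2] /=.
  by rewrite mulrAC; congr (_ / _); ring.
have PC p : P (psi p).1 (psi p).2 = P p.1 p.2.
  case: p => j l; rewrite /P /psi /=.
  have -> : l - (j + l) = - j by rewrite addrC opprD subrK.
  rewrite !rs !nkN; case: (s j) (s l) (s (j + l)) => a1 a2 [b1 b2] [c1 c2] /=.
  by rewrite (_ : nk l * nk (j + l) * nk j = nk j * nk l * nk (j + l)); [congr (_ / _)|]; ring.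
have S f : \sum_(p <- prs F F F) f (phi p) = \sum_(p <- prs F F F) f p :> R.
  exact: sum_invol uP phiI sphi.
have Cy f : \sum_(p <- prs F F F) f (psi p) = \sum_(p <- prs F F F) f p :> R.
  exact: sum_invol uP psiI spsi.
have key p : e p + e (phi p) + e (psi p) + e (phi (psi p)) + e (psi (psi p)) +
    e (phi (psi (psi p))) = 0.
  rewrite /e !PS !PC -!mulrDr; case: p => j l.
  rewrite (_ : crs _ _ * _ * _ + _ + _ + _ + _ + _ = 0) ?mulr0 //.
  rewrite /phi /psi /= /crs /dot /= !nk_sqr /= !rmorphD /= !rmorphN /= !rmorphD /=.
  by rewrite !rmorphN /= !rmorphD /=; ring.
rewrite eE; have : \sum_(p <- prs F F F) (e p + e (phi p) + e (psi p) + e (phi (psi p)) +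
    e (psi (psi p)) + e (phi (psi (psi p)))) = 0 by rewrite big1 // => p _; exact: key.
rewrite !big_split /= (S e) (Cy e) (Cy (fun p => e (phi p))) (S e).
rewrite (Cy (fun p => e (psi p))) (Cy e) (Cy (fun p => e (phi (psi p)))).
rewrite (Cy (fun p => e (phi p))) (S e); lra.
Qed.

End Trilinear.

(** * The nonlinear term as a limit of truncated convolutions *)

Section Quadratic.
Context {R : realType}.
Implicit Types (a b c s r : Z2 -> R[i]) (F G H : seq Z2).

Definition Bs F s k : R[i] :=
  \sum_(p <- prs F F [:: k]) (q p.1 p.2)%:C%C * ('i%C * (s p.1 * s p.2)).

(** Convergence of the convolution along boxes, one mode at a time; no rate and no uniformity in
    time is asked, because L^2 theory supplies none. *)
Definition isB (kap : R) s k (b : R[i]) : Prop :=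
  forall e : R, 0 < e -> exists M0, forall M, (M0 <= M)%N ->
    cn (b - kap%:C%C * Bs (box M) s k) <= e.

Lemma Bs_dot F H s c : uniq H ->
  \sum_(k <- H) cRe (Bs F s k * conjc (c k)) = TT F F H s s c.
Proof.
move=> uH; rewrite /TT -(sum_prs_sift _ _ _ uH); apply: eq_bigr => k _.
rewrite /Bs mulr_suml cRe_sum big_seq [RHS]big_seq; apply: eq_bigr => -[j l].
rewrite mem_prs inE => /and3P[_ _ /eqP /= <-]; rewrite /tterm.
case: (s j) (s l) (c (j + l)) => a1 a2 [b1 b2] [c1 c2] /=; ring.
Qed.

Lemma isB_le kap s k (b : R[i]) (X : R) : 0 <= kap -> isB kap s k b ->
  (forall M, cn (Bs (box M) s k) <= X) -> cn b <= kap * X.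
Proof.
move=> kap0 hb hX; apply: le_eps => e e0; have [M h] := hb e e0.
rewrite -[b](subrK (kap%:C%C * Bs (box M) s k)) addrC.
apply: le_trans (cnD _ _) _; apply: lerD; last exact: h.
by rewrite cnM cn_real ger0_norm // ler_wpM2l.
Qed.

Lemma Bs_conv F s k : uniq F ->
  cn (Bs F s k) <= nk k * \sum_(j <- F) cn (s j) * cn (s (k - j)).
Proof.
move=> uF; apply: le_trans (cn_sum _ _ _) _.
apply: (@le_trans _ _ (\sum_(p <- prs F F [:: k]) nk k * (cn (s p.1) * cn (s p.2)))).
  rewrite big_seq [leRHS]big_seq; apply: ler_sum => -[j l].
  rewrite mem_prs inE => /and3P[_ _ /eqP /= jlk].
  rewrite !cnM cn_i mul1r cn_real ler_wpM2r ?mulr_ge0 ?cn_ge0 //.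
  by rewrite -jlk q_lek.
rewrite -mulr_sumr ler_wpM2l ?nk_ge0 //.
rewrite (sum_prs _ _ _ (fun j l => cn (s j) * cn (s l))).
apply: ler_sum => j _.
rewrite (eq_bigl (fun l => l == k - j)); last first.
  by move=> l; rewrite inE -subr_eq0 -[in RHS]subr_eq0 opprB addrCA addrA.
rewrite big_mkcond (eq_bigr (fun l => (l == k - j)%:R * (cn (s j) * cn (s (k - j))))); last first.
  by move=> l _; case: eqP => [->|_]; rewrite ?mul1r ?mul0r.
rewrite (@sum_sift _ _ F (fun=> cn (s j) * cn (s (k - j)))) //.
by rewrite ler_piMl ?mulr_ge0 ?cn_ge0 // lern1 leq_b1.
Qed.

Lemma sum_subD (I : eqType) (A B : seq I) (f : I -> R) :
  uniq A -> uniq B -> {subset A <= B} ->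
  \sum_(i <- B) f i = \sum_(i <- A) f i + \sum_(i <- B | i \notin A) f i.
Proof.
move=> uA uB AB; rewrite (bigID (fun i => i \in A)) /=; congr (_ + _).
rewrite -big_filter; apply: perm_big; apply: uniq_perm => //; first exact: filter_uniq.
move=> i; rewrite mem_filter; apply/andP/idP => [[]//|iA]; split=> //; exact: AB.
Qed.

(** The size of an interaction when the two inputs decay like |k|^-3 and the test sequence like
    |k|^-1: the factor |l| in the bound of [q] takes two powers of [rho] from the second input. *)
Definition majT (p : Z2 * Z2) : R :=
  (rho p.1 ^+ 6 * rho p.2 ^+ 4 * rho (p.1 + p.2) ^+ 2)^-1.

Definition majS M : R := \sum_(p <- prs (box M) (box M) (box M)) majT p.

Lemma majT_ge0 p : 0 <= majT p.
Proof. by rewrite invr_ge0 !mulr_ge0 ?exprn_ge0 ?rho_ge0. Qed.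

Lemma prs_sub F G H F' G' H' : {subset F <= F'} -> {subset G <= G'} ->
  {subset H <= H'} -> {subset prs F G H <= prs F' G' H'}.
Proof.
move=> h1 h2 h3 p; rewrite !mem_prs => /and3P[/h1 -> /h2 -> /h3 ->//].
Qed.

Lemma uniq_prs_box M M' M'' : uniq (prs (box M) (box M') (box M'')).
Proof. by apply: uniq_prs; exact: uniq_box. Qed.

Lemma majS_mono M M' : (M <= M')%N -> majS M <= majS M'.
Proof.
move=> h; apply: sum_uniq_le; [exact: uniq_prs_box| |exact: majT_ge0].
by apply: prs_sub; exact: sub_box.
Qed.

(** The last two factors have total degree 6, so they are bounded by the power -6, hence -5, of the
    smaller of [rho l] and [rho (j + l)]. Either is summable over l at fixed j, and the first factor
    is summable over j. *)
Lemma majS_bound M : majS M <= 2592 * 5184.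
Proof.
have bx0 : 0 \notin box M by rewrite mem_box eqxx.
apply: (@le_trans _ _ (\sum_(p <- prs (box M) (box M) (box M))
   (rho p.1 ^+ 5)^-1 * ((rho p.2 ^+ 5)^-1 + (p.1 + p.2 \in box M)%:R * (rho (p.1 + p.2) ^+ 5)^-1))).
  rewrite /majS big_seq [leRHS]big_seq; apply: ler_sum => -[j l].
  rewrite mem_prs /= => /and3P[jF lF jlF]; rewrite jlF mul1r /majT /=.
  have nz k : k \in box M -> 1 <= rho k :> R.
    by move=> kF; apply: rho_ge1; apply: contraNneq bx0 => <-.
  move: (rho j) (rho l) (rho (j + l)) (nz _ jF) (nz _ lF) (nz _ jlF) => a b c a1 b1 c1.
  have a0 : 0 < a by lra. have b0 : 0 < b by lra. have c0 : 0 < c by lra.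
  have mono (x : R) (n m : nat) : 1 <= x -> (n <= m)%N -> (x ^+ m)^-1 <= (x ^+ n)^-1.
    move=> x1 nm; rewrite lef_pV2 ?posrE ?exprn_gt0 ?ler_weXn2l //; lra.
  rewrite -mulrA invfM; apply: ler_pM; rewrite ?invr_ge0 ?mulr_ge0 ?exprn_ge0 ?(ltW a0) ?(ltW b0) ?(ltW c0) //.
    exact: mono.
  have [bc|cb] := leP b c.
    apply: (@le_trans _ _ (b ^+ 5)^-1); last by rewrite lerDl invr_ge0 exprn_ge0 // ltW.
    apply: le_trans (mono b 5 6 b1 isT); rewrite lef_pV2 ?posrE ?mulr_gt0 ?exprn_gt0 //.
    by rewrite (exprD b 4 2) ler_wpM2l ?exprn_ge0 ?(ltW b0) // lerXn2r ?nnegrE ?(ltW b0) ?(ltW c0).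
  apply: (@le_trans _ _ (c ^+ 5)^-1); last by rewrite lerDr invr_ge0 exprn_ge0 // ltW.
  apply: le_trans (mono c 5 6 c1 isT); rewrite lef_pV2 ?posrE ?mulr_gt0 ?exprn_gt0 //.
  by rewrite (exprD c 4 2) ler_wpM2r ?exprn_ge0 ?(ltW c0) // lerXn2r ?nnegrE ?(ltW b0) ?(ltW c0) ?(ltW cb).
apply: le_trans (@sum_prs_le _ (box M) (box M) (box M) (fun j l => (rho j ^+ 5)^-1 *
  ((rho l ^+ 5)^-1 + (j + l \in box M)%:R * (rho (j + l) ^+ 5)^-1)) _) _.
  move=> j l; rewrite mulr_ge0 ?addr_ge0 ?mulr_ge0 ?invr_ge0 ?exprn_ge0 ?rho_ge0 //.
apply: (@le_trans _ _ (\sum_(j <- box M) (rho j ^+ 5)^-1 * 5184)); last first.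
  rewrite -mulr_suml; apply: ler_wpM2r; first exact: ler0n.
  by apply: sum_rho5 => //; exact: uniq_box.
apply: ler_sum => j _; rewrite -mulr_sumr ler_wpM2l ?invr_ge0 ?exprn_ge0 ?rho_ge0 //.
rewrite big_split /= (_ : 5184 = 2592 + 2592); last by lra.
apply: lerD; first by rewrite sum_rho5 // uniq_box.
rewrite (eq_bigr (fun l => if j + l \in box M then (rho (j + l) ^+ 5)^-1 else 0)); last first.
  by move=> l _; case: ifP; rewrite ?mul1r ?mul0r.
rewrite -big_mkcond -(big_map (fun l => j + l) (fun k => k \in box M) (fun k => (rho k ^+ 5)^-1)).
rewrite -big_filter; apply: sum_rho5.
  by rewrite filter_uniq // map_inj_uniq ?uniq_box //; exact: addrI.
by rewrite mem_filter (negPf bx0).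
Qed.

Lemma majS_tail (e : R) : 0 < e ->
  exists K0, forall K M, (K0 <= K)%N -> (K <= M)%N -> majS M - majS K <= e.
Proof.
move=> e0; pose A := [set majS M | M in [set: nat]].
have hA : has_sup A.
  split; first by exists (majS 0), 0%N.
  by exists (2592 * 5184) => _ [M _ <-]; exact: majS_bound.
have [_ [K0 _ <-] hK] := sup_adherent e0 hA.
exists K0 => K M K0K KM.
have : majS M <= sup A by apply: (ub_le_sup hA.2); exists M.
have := majS_mono K0K; lra.
Qed.

(** The interactions lost when the inputs shrink from [box M] to [box K] are, term by term,
    dominated by terms of [majS M] that are absent from [majS K]. *)
Lemma TT_tail (C C' : R) K M s c : 0 <= C -> 0 <= C' -> (K <= M)%N ->
  (forall k, k != 0 -> cn (s k) <= C / rho k ^+ 6) ->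
  (forall k, k != 0 -> cn (c k) <= C' / rho k ^+ 2) ->
  `|TT (box M) (box M) (box K) s s c - TT (box K) (box K) (box K) s s c| <=
  C ^+ 2 * C' * (majS M - majS K).
Proof.
move=> C0 C'0 KM hs hc.
pose f (p : Z2 * Z2) := tterm s s c p.1 p.2.
have s1 : {subset prs (box K) (box K) (box K) <= prs (box M) (box M) (box K)}.
  by apply: prs_sub => //; exact: sub_box.
have s2 : {subset prs (box M) (box M) (box K) <= prs (box M) (box M) (box M)}.
  by apply: prs_sub => //; exact: sub_box.
rewrite /TT /majS (sum_subD f (uniq_prs_box _ _ _) (uniq_prs_box _ _ _) s1).
rewrite (sum_subD majT (uniq_prs_box _ _ _) (uniq_prs_box _ _ _) (fun p h => s2 p (s1 p h))).
rewrite addrAC subrr add0r addrAC subrr add0r.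
apply: le_trans (ler_norm_sum _ _ _) _; rewrite mulr_sumr.
apply: (@le_trans _ _ (\sum_(i <- prs (box M) (box M) (box K) |
    i \notin prs (box K) (box K) (box K)) C ^+ 2 * C' * majT i)).
  rewrite big_seq_cond [leRHS]big_seq_cond; apply: ler_sum => -[j l] /andP[+ _].
  rewrite mem_prs !mem_box /= => /and3P[/and3P[j0 _ _] /and3P[l0 _ _] /and3P[jl0 _ _]].
  apply: le_trans (tterm_abs _ _ _ _ _) _; rewrite /majT /=.
  have h1 := hs j j0; have h2 := hs l l0; have h3 := hc _ jl0.
  have rl0 : 0 < rho l :> R by exact: rho_gt0.
  rewrite (_ : C ^+ 2 * C' * _ = rho l ^+ 2 * (C / rho j ^+ 6 * (C / rho l ^+ 6) *
     (C' / rho (j + l) ^+ 2))); last first.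
    have rj0 : 0 < rho j :> R by exact: rho_gt0.
    have rjl0 : 0 < rho (j + l) :> R by exact: rho_gt0.
    by field; rewrite !gt_eqF.
  apply: ler_pM; rewrite ?mulr_ge0 ?cn_ge0 //; first by rewrite rho_sqr q_lel.
  by apply: ler_pM; rewrite ?mulr_ge0 ?cn_ge0 //; apply: ler_pM; rewrite ?cn_ge0.
rewrite -!mulr_sumr ler_wpM2l ?mulr_ge0 ?sqr_ge0 //.
rewrite -big_filter -[leRHS]big_filter; apply: sum_uniq_le; [apply: filter_uniq; exact: uniq_prs_box| |].
  move=> p hp; rewrite mem_filter in hp; case/andP: hp => h1 h2.
  by rewrite mem_filter h1; exact: s2 h2.
exact: majT_ge0.
Qed.

Lemma seq_max_nat (I : eqType) (r : seq I) (P : I -> nat -> Prop) :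
  (forall i, i \in r -> exists n, forall m, (n <= m)%N -> P i m) ->
  exists n, forall m, (n <= m)%N -> forall i, i \in r -> P i m.
Proof.
elim: r => [|x r IH] h; first by exists 0%N.
have [n1 h1] := IH (fun i ir => h i (mem_behead (s := x :: r) ir)).
have [n2 h2] := h x (mem_head _ _).
exists (maxn n1 n2) => m; rewrite geq_max => /andP[m1 m2] i; rewrite inE.
by move=> /orP[/eqP ->|ir]; [exact: h2|exact: h1].
Qed.

(** There are finitely many outputs, so the limits in [isB] are reached together; the threshold
    depends on [s], [c] and [b], which is harmless when [M] is eliminated at a fixed time. *)
Lemma pairing_lim (kap : R) K s c b (d : R) : 0 < d ->
  (forall k, k != 0 -> isB kap s k (b k)) ->
  exists M0, forall M, (M0 <= M)%N ->
  `|\sum_(k <- box K) cRe (b k * conjc (c k)) -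
    kap * TT (box M) (box M) (box K) s s c| <= d.
Proof.
move=> d0 hb.
pose S := \sum_(k <- box K) cn (c k).
have S0 : 0 <= S by apply: sumr_ge0 => k _; exact: cn_ge0.
have S1 : 0 < S + 1 by lra.
have [M0 hM0] : exists M0, forall M, (M0 <= M)%N -> forall k, k \in box K ->
    cn (b k - kap%:C%C * Bs (box M) s k) <= d / (S + 1).
  apply: seq_max_nat => k; rewrite mem_box => /and3P[k0 _ _].
  exact: hb (divr_gt0 d0 S1).
exists M0 => M /hM0 hM.
have -> : \sum_(k <- box K) cRe (b k * conjc (c k)) - kap * TT (box M) (box M) (box K) s s c =
  \sum_(k <- box K) cRe ((b k - kap%:C%C * Bs (box M) s k) * conjc (c k)).
  rewrite -(Bs_dot (box M) s c (uniq_box K)) mulr_sumr -sumrB; apply: eq_bigr => k _.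
  by case: (b k) (Bs (box M) s k) (c k) => b1 b2 [x1 x2] [c1 c2] /=; ring.
apply: le_trans (ler_norm_sum _ _ _) _.
apply: (@le_trans _ _ (\sum_(k <- box K) d / (S + 1) * cn (c k))).
  rewrite big_seq [leRHS]big_seq; apply: ler_sum => k kK.
  apply: le_trans (cRe_le _) _; rewrite cnM cnJ ler_wpM2r ?cn_ge0 //; exact: hM.
rewrite -mulr_sumr -/S mulrAC ler_pdivrMr // ler_wpM2l ?(ltW d0) //; lra.
Qed.

(* The truncation error of the energy budget is controlled by the tail of one
   fixed convergent lattice sum, hence uniformly over [s], [c] and [b]. *)
Lemma pairing_err (kap C C' e : R) : 0 <= kap -> 0 <= C -> 0 <= C' -> 0 < e ->
  exists K0, forall K, (K0 <= K)%N -> forall s c b,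
  (forall k, k != 0 -> cn (s k) <= C / rho k ^+ 6) ->
  (forall k, k != 0 -> cn (c k) <= C' / rho k ^+ 2) ->
  (forall k, k != 0 -> isB kap s k (b k)) ->
  `|\sum_(k <- box K) cRe (b k * conjc (c k)) -
    kap * TT (box K) (box K) (box K) s s c| <= e.
Proof.
move=> kap0 C0 C'0 e0.
have A0 : 0 < kap * (C ^+ 2 * C') + 1.
  by rewrite ltr_wpDl // !mulr_ge0 // sqr_ge0.
have [K0 hK0] := majS_tail (divr_gt0 e0 A0).
exists K0 => K K0K s c b hs hc hb; apply: le_eps => d d0.
have [M0 hM0] := @pairing_lim kap K s c b d d0 hb.
pose M := maxn M0 K.
have hM := hM0 M (leq_maxl _ _); have KM : (K <= M)%N by exact: leq_maxr.
have hT : `|kap * (TT (box M) (box M) (box K) s s c - TT (box K) (box K) (box K) s s c)| <= e.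
  rewrite normrM ger0_norm //.
  apply: (@le_trans _ _ (kap * (C ^+ 2 * C' * (e / (kap * (C ^+ 2 * C') + 1))))).
    rewrite ler_wpM2l //; apply: le_trans (TT_tail C0 C'0 KM hs hc) _.
    by rewrite ler_wpM2l ?mulr_ge0 ?sqr_ge0 // hK0.
  rewrite mulrA; move: A0; move: (kap * (C ^+ 2 * C')) => x x0.
  rewrite mulrCA ler_piMr ?(ltW e0) // ler_pdivrMr // mul1r; lra.
move: hM hT; rewrite mulrBr !ler_norml => /andP[h1 h2] /andP[h3 h4].
by apply/andP; split; lra.
Qed.

End Quadratic.

(** * Complete trajectories in Fourier coordinates *)

Section Dynamics.
Context {R : realType}.

Lemma is_derive_bigseq (I : eqType) (F : seq I) (h dh : I -> R -> R) (t : R) :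
  (forall i, i \in F -> is_derive t (1 : R) (h i) (dh i t)) ->
  is_derive t (1 : R) (fun s => \sum_(i <- F) h i s) (\sum_(i <- F) dh i t).
Proof.
elim: F => [|x F IH] hd.
  rewrite big_nil (_ : (fun s => _) = cst 0); first exact: is_derive_cst.
  by apply/funext => s; rewrite big_nil.
rewrite big_cons (_ : (fun s => _) = h x \+ (fun s => \sum_(i <- F) h i s)); last first.
  by apply/funext => s; rewrite big_cons.
apply: is_deriveD; first by apply: hd; rewrite inE eqxx.
by apply: IH => i iF; apply: hd; rewrite inE iF orbT.
Qed.

Definition cder (z : R -> R[i]) (t : R) (d : R[i]) : Prop :=
  is_derive t (1 : R) (fun s => cRe (z s)) (cRe d) /\
  is_derive t (1 : R) (fun s => cIm (z s)) (cIm d).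

Lemma cder_dot (z w : R -> R[i]) t dz dw : cder z t dz -> cder w t dw ->
  is_derive t (1 : R) (fun s => cRe (z s * conjc (w s)))
    (cRe (dz * conjc (w t)) + cRe (z t * conjc dw)).
Proof.
move=> [z1 z2] [w1 w2].
have -> : (fun s => cRe (z s * conjc (w s))) =
  (fun s => cRe (z s)) * (fun s => cRe (w s)) + (fun s => cIm (z s)) * (fun s => cIm (w s)).
  by apply/funext => s; rewrite cReM cReJ cImJ mulrN opprK.
apply: is_derive_eq (is_deriveD (is_deriveM z1 w1) (is_deriveM z2 w2)) _.
by rewrite /GRing.scale /= !cReM !cReJ !cImJ; ring.
Qed.

Lemma cn_sqr_dot (z : R[i]) : cn z ^+ 2 = cRe (z * conjc z).
Proof. by rewrite cn_sqr cReM cReJ cImJ; ring. Qed.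

Lemma cder_cn_sqr (z : R -> R[i]) t dz : cder z t dz ->
  is_derive t (1 : R) (fun s => cn (z s) ^+ 2) (2 * cRe (dz * conjc (z t))).
Proof.
move=> hz; rewrite (_ : (fun s => _) = (fun s => cRe (z s * conjc (z s)))); last first.
  by apply/funext => s; rewrite cn_sqr_dot.
rewrite (_ : 2 * _ = cRe (dz * conjc (z t)) + cRe (z t * conjc dz)); first exact: cder_dot.
by rewrite !cReM !cReJ !cImJ; ring.
Qed.

Lemma cderB (z w : R -> R[i]) t dz dw : cder z t dz -> cder w t dw ->
  cder (fun s => z s - w s) t (dz - dw).
Proof.
move=> [z1 z2] [w1 w2]; split.
  rewrite (_ : (fun s => _) = (fun s => cRe (z s)) - (fun s => cRe (w s))).
    by apply: is_derive_eq; rewrite cReB.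
  by apply/funext => s; rewrite cReB.
rewrite (_ : (fun s => _) = (fun s => cIm (z s)) - (fun s => cIm (w s))).
  by apply: is_derive_eq; rewrite cImB.
by apply/funext => s; rewrite cImB.
Qed.

Lemma cReMl (x : R) z : cRe (x%:C%C * z) = x * cRe z.
Proof. by case: z => a b /=; ring. Qed.

Lemma cRe_dot_le (z w : R[i]) : cRe (z * conjc w) <= cn z * cn w.
Proof. by have := cRe_le (z * conjc w); rewrite cnM cnJ ler_norml => /andP[]. Qed.

Lemma young (a g x : R) : 0 < a -> 2 * (g * x) <= g ^+ 2 / a + a * x ^+ 2.
Proof.
move=> a0; rewrite -(ler_pM2r a0) [leRHS]mulrDl divfK ?gt_eqF //.
have := sqr_ge0 (g - a * x); nra.
Qed.

(** Young's inequality in the balance of |z|^2 leaves half of the damping, and the whole-line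
    Gronwall lemma then returns the exact ratio g / a. *)
Lemma mode_decay (z h : R -> R[i]) (a g C : R) : 0 < a ->
  (forall t, cder z t (- (a%:C%C * z t) + h t)) ->
  (forall t, cn (h t) <= g) -> (forall t, cn (z t) <= C) ->
  forall t, cn (z t) <= g / a.
Proof.
move=> a0 hz hg hC t.
have g0 : 0 <= g by apply: le_trans (cn_ge0 _) (hg t).
apply: le_sqrtP; first by rewrite divr_ge0 // ltW.
rewrite (_ : (g / a) ^+ 2 = g ^+ 2 / a / a); last by field; rewrite gt_eqF.
move: t; apply: (gronwall_bounded (C := C ^+ 2) a0 (fun t => cder_cn_sqr (hz t))) => t; last first.
  by rewrite lerXn2r ?nnegrE ?cn_ge0 // (le_trans (cn_ge0 (z t))).
have -> : cRe ((- (a%:C%C * z t) + h t) * conjc (z t)) =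
    - (a * cn (z t) ^+ 2) + cRe (h t * conjc (z t)).
  by rewrite cn_sqr; case: (z t) (h t) => z1 z2 [h1 h2] /=; ring.
have h1 := cRe_dot_le (h t) (z t).
have h2 : cn (h t) * cn (z t) <= g * cn (z t) by rewrite ler_wpM2r ?cn_ge0.
have := young g (cn (z t)) a0; lra.
Qed.

(* The Fourier coefficients of a bounded complete trajectory with viscosity
   [nu]; [B] is the nonlinear term and [G] collects the forcing. *)
Record traj (kap nu : R) (U B G : R -> Z2 -> R[i]) : Prop := Traj {
  traj_rl : forall t, rl (U t);
  traj_0 : forall t, U t 0 = 0;
  traj_h1 : exists2 C, 0 <= C & forall t, l2b (fun k => nk k * cn (U t k)) C;
  traj_B : forall t k, k != 0 -> isB kap (U t) k (B t k);
  traj_ode : forall t k, k != 0 -> cder (fun s => U s k) t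
    (- ((nu * kap ^+ 2 * nk k ^+ 2)%:C%C * U t k) + (G t k - B t k)) }.

(** A mode is bounded by its forcing divided by its viscous rate, of order |k|^2. The nonlinear
    forcing is |k| times a convolution, so the net gain is |k|, two powers of [rho]. The condition
    on [m] comes from the other forcing: bounded by a multiple of |k|^-1, it yields no more than
    |k|^-3. *)
Lemma traj_decay_step (kap nu : R) U B G (Cg b : R) (m : nat) :
  0 < kap -> 0 < nu -> traj kap nu U B G -> 0 <= Cg -> 0 <= b -> (m <= 4)%N ->
  (forall t k, nk k * cn (G t k) <= Cg) ->
  (forall t k M, k != 0 ->
    \sum_(j <- box M) cn (U t j) * cn (U t (k - j)) <= b / rho k ^+ m) ->
  exists2 C, 0 <= C & forall t k, k != 0 -> cn (U t k) <= C / rho k ^+ (m + 2).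
Proof.
move=> kap0 nu0 tr Cg0 b0 m4 hG hb.
have nk20 : 0 < nu * kap ^+ 2 by rewrite mulr_gt0 // exprn_gt0.
exists ((Cg + kap * b) / (nu * kap ^+ 2)).
  by rewrite divr_ge0 ?(ltW nk20) // addr_ge0 // mulr_ge0 // ltW.
move=> t k k0.
have [C C0 hC] := traj_h1 tr.
have k1 := nk_ge1 (R := R) k0; have kp : 0 < nk k :> R by lra.
have r1 := rho_ge1 (R := R) k0; have rp : 0 < rho k :> R by lra.
have rE : rho k ^+ 2 = nk k :> R by exact: rho_sqr.
have := @mode_decay (fun s => U s k) (fun s => G s k - B s k) (nu * kap ^+ 2 * nk k ^+ 2)
  (Cg / nk k + kap * (nk k * (b / rho k ^+ m))) C.
rewrite mulr_gt0 ?exprn_gt0 // => /(_ isT (fun s => traj_ode tr s k0)) h.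
apply: le_trans (h _ _ t) _.
- move=> s; apply: le_trans (cnB _ _) _; apply: lerD.
    by rewrite ler_pdivlMr // mulrC.
  apply: isB_le (ltW kap0) (traj_B tr s k0) _ => M.
  apply: le_trans (Bs_conv _ _ (uniq_box M)) _.
  by rewrite ler_wpM2l ?nk_ge0 // hb.
- move=> s; have := l2b_pt k C0 (hC s); apply: le_trans.
  by rewrite ger0_norm ?mulr_ge0 ?nk_ge0 ?cn_ge0 // ler_peMl ?cn_ge0.
have rm : 0 < rho k ^+ m :> R by rewrite exprn_gt0.
have np : 0 < nu * kap ^+ 2 * nk k ^+ 2 by rewrite mulr_gt0 // exprn_gt0.
have kn : rho k ^+ m <= nk k ^+ 2 :> R.
  by rewrite -rE -exprM; apply: ler_weXn2l.
rewrite ler_pdivrMr // exprD rE.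
rewrite (_ : _ / (rho k ^+ m * nk k) * _ = (Cg / nk k) * (nk k ^+ 2 / rho k ^+ m) +
    kap * (nk k * (b / rho k ^+ m))); last by field; rewrite !gt_eqF.
rewrite lerD2r ler_peMr ?divr_ge0 ?(ltW kp) //.
by rewrite ler_pdivlMr // mul1r.
Qed.

(** The exponents of [rho] go 4, 5, 6: [conv_h1] gives 4, then each application of [conv_rho] costs
    one power and the damping returns two. *)
Lemma traj_decay (kap nu : R) U B G (Cg : R) :
  0 < kap -> 0 < nu -> traj kap nu U B G -> 0 <= Cg ->
  (forall t k, nk k * cn (G t k) <= Cg) ->
  exists2 C, 0 <= C & forall t k, k != 0 -> cn (U t k) <= C / rho k ^+ 6.
Proof.
move=> kap0 nu0 tr Cg0 hG; have [X X0 hX] := traj_h1 tr.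
have U0 t : cn (U t 0) = 0 by rewrite (traj_0 tr) cn0.
have [C4 C40 h4] : exists2 C, 0 <= C & forall t k, k != 0 -> cn (U t k) <= C / rho k ^+ 4.
  apply: (@traj_decay_step _ _ _ _ _ Cg (2 * X ^+ 2) 2 kap0 nu0 tr) => //.
    by rewrite mulr_ge0 // sqr_ge0.
  move=> t k M k0; rewrite rho_sqr ler_pdivlMr ?nk_gt0 // mulrC.
  by apply: conv_h1 => // [j|]; [exact: cn_ge0|exact: uniq_box].
have next m : (m <= 1)%N ->
    (exists2 C, 0 <= C & forall t k, k != 0 -> cn (U t k) <= C / rho k ^+ m.+4) ->
    (exists2 C, 0 <= C & forall t k, k != 0 -> cn (U t k) <= C / rho k ^+ (m.+3 + 2)).
  move=> m1 [D D0 hD].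
  apply: (traj_decay_step (b := D ^+ 2 * 2 ^+ m.+3 * 5184) (m := m.+3) kap0 nu0 tr Cg0 _ _ hG).
  - by apply: mulr_ge0; [apply: mulr_ge0; exact: exprn_ge0|exact: ler0n].
  - by rewrite !ltnS.
  move=> t k M k0; apply: (@conv_rho _ m (fun k => cn (U t k)) D _ _ D0 _ _ _ _ k0).
  - by move=> j; exact: cn_ge0.
  - exact: U0.
  - exact: hD.
  - exact: uniq_box.
have h5 := next 0%N isT (ex_intro2 _ _ C4 C40 h4).
by have := next 1%N isT h5.
Qed.

Lemma l2b_box (x : Z2 -> R) (X : R) (K0 : nat) : x 0 = 0 ->
  (forall K, (K0 <= K)%N -> \sum_(k <- box K) x k ^+ 2 <= X ^+ 2) -> l2b x X.
Proof.
move=> x0 h F uF; have [M hM] := box_cover F.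
apply: le_trans (h (maxn K0 M) (leq_maxl _ _)).
rewrite (bigID (fun k => k == 0)) /= big1 ?add0r => [|k /eqP ->]; last first.
  by rewrite x0 expr0n.
rewrite -big_filter; apply: sum_uniq_le; first exact: filter_uniq.
  move=> k; rewrite mem_filter => /andP[k0 kF].
  by apply: (sub_box (leq_maxr K0 M)); exact: hM.
by move=> k; exact: sqr_ge0.
Qed.

Lemma sum_sqrt_CS (F : seq Z2) (x y : Z2 -> R) (X : R) :
  0 <= X -> uniq F -> l2b x X ->
  \sum_(k <- F) x k * y k <= X * Num.sqrt (\sum_(k <- F) y k ^+ 2).
Proof.
move=> X0 uF hx; apply: sum_CS_le => //; first exact: hx.
by rewrite sqr_sqrtr // sumr_ge0 // => k _; exact: sqr_ge0.
Qed.

Definition low (N : R) (k : Z2) : R := ((nk k < N)%R)%:R.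

Lemma low_ge0 N k : 0 <= low N k. Proof. exact: ler0n. Qed.
Lemma low_le1 N k : low N k <= 1. Proof. by rewrite lern1 leq_b1. Qed.

Lemma rho_decay (C : R) k : 0 <= C -> k != 0 -> C / rho k ^+ 6 <= C / rho k ^+ 2.
Proof.
move=> C0 k0; have r1 := rho_ge1 (R := R) k0.
have r0 : 0 < rho k :> R by lra.
by rewrite ler_wpM2l // lef_pV2 ?posrE ?exprn_gt0 // ler_weXn2l.
Qed.

(* The two low-pass dissipation mechanisms, viscosity and nudging, add up to at
   least [wgt N k ^+ 2]. *)
Lemma dissipation (kap nu0 nu mu N : R) k : 0 < N -> 0 < kap -> 0 < nu0 ->
  nu0 <= nu -> nu0 * kap ^+ 2 * N ^+ 2 <= mu ->
  nu0 * kap ^+ 2 * wgt N k ^+ 2 <= nu * kap ^+ 2 * nk k ^+ 2 + mu * low N k.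
Proof.
move=> N0 kap0 nu00 nunu hmu.
have A0 : 0 < nu0 * kap ^+ 2 by rewrite mulr_gt0 // exprn_gt0.
have k20 : 0 <= kap ^+ 2 * nk k ^+ 2 by rewrite mulr_ge0 // sqr_ge0.
rewrite /low /wgt; have [h|h] := ltP (nk k) N.
  rewrite mulr1; apply: le_trans hmu _.
  by rewrite lerDr -mulrA mulr_ge0 //; lra.
by rewrite /= mulr0n mulr0 addr0 -(mulrA nu0) -(mulrA nu); apply: ler_wpM2r.
Qed.

Lemma l2b_nk (z : Z2 -> R[i]) (X : R) k : 0 <= X ->
  l2b (fun k => nk k * cn (z k)) X -> nk k * cn (z k) <= X.
Proof. by move=> X0 /(l2b_pt k X0); rewrite ger0_norm ?mulr_ge0 ?nk_ge0 ?cn_ge0. Qed.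

Lemma forcing_bound (mu N Ff P X : R) (f p u : R[i]) k : 0 <= mu ->
  nk k * cn f <= Ff -> nk k * cn p <= P -> nk k * cn u <= X ->
  nk k * cn (f + (mu * low N k)%:C%C * (p - u)) <= Ff + mu * (P + X).
Proof.
move=> mu0 hf hp hu.
apply: le_trans (ler_wpM2l (nk_ge0 _) (cnD _ _)) _; rewrite mulrDr; apply: lerD => //.
rewrite cnM cn_real ger0_norm ?mulr_ge0 ?low_ge0 // mulrCA -mulrA ler_wpM2l //.
apply: le_trans (_ : 1 * (nk k * cn (p - u)) <= _).
  by rewrite ler_wpM2r ?low_le1 // mulr_ge0 ?nk_ge0 ?cn_ge0.
rewrite mul1r; apply: le_trans (ler_wpM2l (nk_ge0 _) (cnB _ _)) _; rewrite mulrDr.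
exact: lerD.
Qed.

(** In the balance of the sum of |k|^2 |U_k|^2 the nonlinear term cancels up to the truncation
    error, and viscosity with nudging damps every mode at the rate [a] at least. The forcing is
    bounded by Ff + mu P, whence the quotient. *)
Lemma traj_enstrophy (kap nu0 nu mu N : R) U B (f p : R -> Z2 -> R[i]) (Ff P : R) :
  0 < kap -> 0 < nu0 -> nu0 <= nu -> 0 < N -> nu0 * kap ^+ 2 * N ^+ 2 <= mu ->
  0 <= Ff -> 0 <= P ->
  (forall t, l2b (fun k => nk k * cn (f t k)) Ff) ->
  (forall t, l2b (fun k => nk k * cn (p t k)) P) ->
  traj kap nu U B (fun t k => f t k + (mu * low N k)%:C%C * (p t k - U t k)) ->
  forall t, l2b (fun k => nk k * cn (U t k)) ((Ff + mu * P) / (nu0 * kap ^+ 2 * N ^+ 2)).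
Proof.
move=> kap0 nu00 nunu N0 hmu Ff0 P0 hf hp tr t.
set a := nu0 * kap ^+ 2 * N ^+ 2 in hmu *.
have a0 : 0 < a by rewrite !mulr_gt0 // exprn_gt0.
have mu0 : 0 < mu by lra.
have nu0' : 0 < nu by lra.
have [X X0 hX] := traj_h1 tr.
have hG s k : nk k * cn (f s k + (mu * low N k)%:C%C * (p s k - U s k)) <= Ff + mu * (P + X).
  by apply: forcing_bound => //; [exact: ltW|exact: l2b_nk|exact: l2b_nk|exact: l2b_nk].
have [C C0 hC] := traj_decay kap0 nu0' tr (addr_ge0 Ff0 (mulr_ge0 (ltW mu0) (addr_ge0 P0 X0))) hG.
set g := Ff + mu * P; have g0 : 0 <= g by rewrite addr_ge0 // mulr_ge0 // ltW.
have ga0 : 0 <= g / a by rewrite divr_ge0 // ltW.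
apply: (@l2b_box _ _ 0); first by rewrite nk0 mul0r.
move=> K1 _; apply: le_eps => e e0.
(* The factor 2 in the derivative of a square turns this error into e * a, and the rate a in
   Gronwall's lemma turns that into e. *)
have e20 : 0 < e * a / 2 by rewrite divr_gt0 // mulr_gt0.
have [K0 hK0] := pairing_err (ltW kap0) C0 C0 e20.
pose K := maxn K0 K1.
apply: le_trans (_ : \sum_(k <- box K) (nk k * cn (U t k)) ^+ 2 <= _).
  by apply: sum_uniq_le; [exact: uniq_box|apply: sub_box; exact: leq_maxr|move=> k; exact: sqr_ge0].
rewrite (_ : (g / a) ^+ 2 + e = (g ^+ 2 / a + e * a) / a); last by field; rewrite gt_eqF.
pose y s := \sum_(k <- box K) (nk k * cn (U s k)) ^+ 2.
pose G s k := f s k + (mu * low N k)%:C%C * (p s k - U s k).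
pose dU s k := - ((nu * kap ^+ 2 * nk k ^+ 2)%:C%C * U s k) + (G s k - B s k).
have dy s : is_derive s (1 : R) y (\sum_(k <- box K) nk k ^+ 2 * (2 * cRe (dU s k * conjc (U s k)))).
  apply: (is_derive_bigseq (h := fun k s => (nk k * cn (U s k)) ^+ 2)
    (dh := fun k s => nk k ^+ 2 * (2 * cRe (dU s k * conjc (U s k))))) => k.
  rewrite mem_box => /and3P[k0 _ _].
  rewrite (_ : (fun s => _) = nk k ^+ 2 *: (fun s => cn (U s k) ^+ 2)); last first.
    by apply/funext => x; rewrite exprMn.
  have h := cder_cn_sqr (traj_ode tr s k0).
  exact: is_deriveZ h.
apply: (gronwall_bounded (y := y) (C := X ^+ 2) a0 dy) => [s|s]; last first.
  by apply: hX; exact: uniq_box.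
have y0 : 0 <= y s by apply: sumr_ge0 => k _; exact: sqr_ge0.
(* Here the exponent 6 is used up: after multiplication by |k|^2 it leaves the exponent 2 that
   [pairing_err] asks of its test sequence. *)
have hc k : k != 0 -> cn ((nk k ^+ 2)%:C%C * U s k) <= C / rho k ^+ 2.
  move=> k0; rewrite cnM cn_real ger0_norm ?sqr_ge0 //.
  apply: le_trans (ler_wpM2l (sqr_ge0 _) (hC s k k0)) _.
  have r0 : 0 < rho k :> R by exact: rho_gt0.
  rewrite -rho_sqr le_eqVlt; apply/orP; left; apply/eqP.
  by field; rewrite gt_eqF.
have hB : - (e * a / 2) <= \sum_(k <- box K) nk k ^+ 2 * cRe (B s k * conjc (U s k)).
  have := hK0 K (leq_maxl _ _) (U s) (fun k => (nk k ^+ 2)%:C%C * U s k) (B s)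
    (hC s) hc (fun k => traj_B tr s (k := k)).
  rewrite (TT_enstrophy (symm_box K) (traj_rl tr s)) mulr0 subr0.
  rewrite (eq_bigr (fun k => nk k ^+ 2 * cRe (B s k * conjc (U s k)))); last first.
    by move=> k _; case: (B s k) (U s k) => b1 b2 [u1 u2] /=; ring.
  by rewrite ler_norml => /andP[].
have hk k : k \in box K -> nk k ^+ 2 * cRe (dU s k * conjc (U s k)) <=
    - (a * (nk k * cn (U s k)) ^+ 2) + (nk k * cn (f s k)) * (nk k * cn (U s k)) +
    mu * ((nk k * cn (p s k)) * (nk k * cn (U s k))) - nk k ^+ 2 * cRe (B s k * conjc (U s k)).
  move=> kK.
  have -> : cRe (dU s k * conjc (U s k)) =
    - ((nu * kap ^+ 2 * nk k ^+ 2 + mu * low N k) * cn (U s k) ^+ 2) +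
    cRe (f s k * conjc (U s k)) + mu * low N k * cRe (p s k * conjc (U s k)) -
    cRe (B s k * conjc (U s k)).
    rewrite /dU /G cn_sqr.
    by case: (U s k) (f s k) (p s k) (B s k) => u1 u2 [f1 f2] [p1 p2] [b1 b2] /=; ring.
  have d1 := dissipation k N0 kap0 nu00 nunu hmu.
  have d2 : a <= nu * kap ^+ 2 * nk k ^+ 2 + mu * low N k.
    apply: le_trans d1; rewrite /a ler_wpM2l //.
      by rewrite mulr_ge0 ?sqr_ge0 // ltW.
    by rewrite wgt_sqr // le_max lexx orbT.
  have d3 := ler_wpM2r (sqr_ge0 (cn (U s k))) d2.
  have h1 := cRe_dot_le (f s k) (U s k); have h2 := cRe_dot_le (p s k) (U s k).
  have h3 : mu * low N k * cRe (p s k * conjc (U s k)) <= mu * (cn (p s k) * cn (U s k)).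
    rewrite -mulrA ler_wpM2l ?(ltW mu0) //.
    apply: le_trans (_ : low N k * (cn (p s k) * cn (U s k)) <= _).
      by rewrite ler_wpM2l ?low_ge0.
    by rewrite ler_piMl ?low_le1 // mulr_ge0 ?cn_ge0.
  rewrite (_ : - (a * (nk k * cn (U s k)) ^+ 2) + _ + _ - _ = nk k ^+ 2 *
    (- (a * cn (U s k) ^+ 2) + cn (f s k) * cn (U s k) + mu * (cn (p s k) * cn (U s k)) -
     cRe (B s k * conjc (U s k)))); last by ring.
  by rewrite ler_wpM2l ?sqr_ge0 //; lra.
have hsum : \sum_(k <- box K) nk k ^+ 2 * cRe (dU s k * conjc (U s k)) <=
    - (a * y s) + g * Num.sqrt (y s) + e * a / 2.
  rewrite big_seq; apply: le_trans (ler_sum _ hk) _; rewrite -big_seq.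
  rewrite !big_split /= !sumrN -!mulr_sumr -/(y s).
  have h1 := sum_sqrt_CS (fun k => nk k * cn (U s k)) Ff0 (uniq_box K) (hf s).
  have h2 := sum_sqrt_CS (fun k => nk k * cn (U s k)) P0 (uniq_box K) (hp s).
  have := ler_wpM2l (ltW mu0) h2; rewrite /g mulrDl -/(y s) in h1 *; lra.
rewrite (eq_bigr (fun k => 2 * (nk k ^+ 2 * cRe (dU s k * conjc (U s k))))); last first.
  by move=> k _; ring.
rewrite -mulr_sumr.
have : 2 * (g * Num.sqrt (y s)) <= g ^+ 2 / a + a * y s.
  by rewrite -{2}(sqr_sqrtr y0); exact: young.
lra.
Qed.

End Dynamics.

(** * Distance of the two trajectories and the viscosity gap *)

Section Gap.
Context {R : realType}.

Lemma TT_eq (F G H : seq Z2) (a a' b b' c c' : Z2 -> R[i]) :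
  {in F, a =1 a'} -> {in G, b =1 b'} -> {in H, c =1 c'} ->
  TT F G H a b c = TT F G H a' b' c'.
Proof.
move=> ha hb hc; rewrite /TT big_seq [RHS]big_seq; apply: eq_bigr => p.
by rewrite mem_prs => /and3P[/ha h1 /hb h2 /hc h3]; rewrite /tterm h1 h2 h3.
Qed.

(** The bound on [a] is known over the box only. The form reads its arguments in the box, so [a] may
    be set to zero outside, which makes the bound global. *)
Lemma TT_est_box (N A B : R) K (a b : Z2 -> R[i]) : 1 <= N -> 0 <= A -> 0 <= B ->
  l2b (fun k => nk k * cn (b k)) B ->
  \sum_(k <- box K) (wgt N k * cn (a k)) ^+ 2 <= A ^+ 2 ->
  `|TT (box K) (box K) (box K) a b a| <= 8 / N * (A ^+ 2 * B).
Proof.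
move=> N1 A0 B0 hb hA.
pose a' k := if k \in box K then a k else 0.
have ea : {in box K, a =1 a'} by move=> k kK; rewrite /a' kK.
have ha' : l2b (fun k => wgt N k * cn (a' k)) A.
  move=> F uF; apply: le_trans hA.
  rewrite (bigID (fun k => k \in box K)) /= [X in _ + X]big1 ?addr0; last first.
    by move=> k /negPf kK; rewrite /a' kK cn0 mulr0 expr0n.
  rewrite (eq_bigr (fun k => (wgt N k * cn (a k)) ^+ 2)); last first.
    by move=> k kK; rewrite /a' kK.
  rewrite -big_filter; apply: sum_uniq_le; first exact: filter_uniq.
    by move=> k; rewrite mem_filter => /andP[].
  by move=> k; exact: sqr_ge0.
rewrite (TT_eq ea (fun k _ => erefl (b k)) ea).
rewrite (_ : A ^+ 2 * B = A * B * A); last by ring.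
apply: TT_est_vel => //; exact: uniq_box.
Qed.

(** With z = V - U, the difference of the two quadratic terms is B(V, z) + B(z, U), and the first
    part vanishes against z. The remaining gradient falls on [U], so the smallness condition bears
    on [U] alone. *)
Lemma TT_diff K (U V : Z2 -> R[i]) : rl U -> rl V ->
  TT (box K) (box K) (box K) V V (fun k => V k - U k) -
  TT (box K) (box K) (box K) U U (fun k => V k - U k) =
  TT (box K) (box K) (box K) (fun k => V k - U k) U (fun k => V k - U k).
Proof.
move=> rU rV; set z := fun k => V k - U k.
have Vz : V = fun k => U k + z k by apply/funext => k; rewrite /z addrC subrK.
rewrite {2}Vz TT_addm (TT_self0 (symm_box K) rV (rlB rV rU)) addr0.
by rewrite {1}Vz TT_addl addrAC subrr add0r.
Qed.

(** The difference z is driven by (nu - gam) A u. Let W be the weighted square sum of z, comparable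
    to its dissipation: the drive paired with z is at most |nu - gam| kap^2 Um sqrt W, and W >= N^2
    |z|^2 produces the factor 1 / N. *)
Lemma traj_diff (kap nu0 nu gam mu N Ff Um : R) U V B B' (f : R -> Z2 -> R[i]) :
  0 < kap -> 0 < nu0 -> nu0 <= nu -> nu0 <= gam -> 1 <= N ->
  nu0 * kap ^+ 2 * N ^+ 2 <= mu -> 0 <= Ff ->
  (forall t, l2b (fun k => nk k * cn (f t k)) Ff) ->
  0 <= Um -> (forall t, l2b (fun k => nk k * cn (U t k)) Um) ->
  8 * Um <= nu0 * kap * N / 5 ->
  traj kap nu U B f ->
  traj kap gam V B' (fun t k => f t k + (mu * low N k)%:C%C * (U t k - V t k)) ->
  forall t, l2b (fun k => cn (V t k - U t k)) (`|nu - gam| * (5 / 4 * Um / (nu0 * N))).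
Proof.
move=> kap0 nu00 nunu nugam N1 hmu Ff0 hf Um0 hU small trU trV t.
have N0 : 0 < N by lra.
set D := nu - gam.
have c0 : 0 < nu0 * kap ^+ 2 by rewrite mulr_gt0 // exprn_gt0.
have mu0 : 0 < mu by apply: lt_le_trans hmu; rewrite mulr_gt0 // exprn_gt0.
(* The balance of |z|^2 contains twice the dissipation; the trilinear term takes a fifth of it and
   Young's inequality for the viscous difference two fifths, which leaves 2 * 2/5 = 4/5. *)
set a := 4 / 5 * (nu0 * kap ^+ 2 * N ^+ 2).
have a0 : 0 < a by rewrite mulr_gt0 // mulr_gt0 // exprn_gt0.
have [X X0 hX] := traj_h1 trV.
have nu0' : 0 < nu by lra. have gam0 : 0 < gam by lra.
have [C1 C10 hC1] := traj_decay kap0 nu0' trU Ff0 (fun s k => l2b_nk k Ff0 (hf s)).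
have GF0 : 0 <= Ff + mu * (Um + X) by rewrite addr_ge0 // mulr_ge0 ?addr_ge0 // ltW.
have [C2 C20 hC2] := traj_decay kap0 gam0 trV GF0 (fun s k => forcing_bound _ (ltW mu0)
  (l2b_nk k Ff0 (hf s)) (l2b_nk k Um0 (hU s)) (l2b_nk k X0 (hX s))).
have C120 : 0 <= C1 + C2 by exact: addr_ge0.
pose z s k := V s k - U s k.
have zdec s k : k != 0 -> cn (z s k) <= (C1 + C2) / rho k ^+ 2.
  move=> k0; apply: le_trans (rho_decay C120 k0); apply: le_trans (cnB _ _) _.
  by rewrite mulrDl addrC lerD ?hC1 ?hC2.
set Z := `|D| * _.
have Z0 : 0 <= Z.
  by rewrite mulr_ge0 // divr_ge0 ?mulr_ge0 ?divr_ge0 // ltW.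
apply: (@l2b_box _ _ _ 0); first by rewrite (traj_0 trU) (traj_0 trV) subr0 cn0.
move=> K1 _; apply: le_eps => e e0.
(* There are two truncation errors, one per trajectory, and the derivative of the square doubles
   them: e * a in all. *)
have e20 : 0 < e * a / 4 by rewrite divr_gt0 // mulr_gt0.
have [KU hKU] := pairing_err (ltW kap0) C10 C120 e20.
have [KV hKV] := pairing_err (ltW kap0) C20 C120 e20.
pose K := maxn K1 (maxn KU KV).
have KUK : (KU <= K)%N by rewrite !leq_max leqnn orbT.
have KVK : (KV <= K)%N by rewrite !leq_max leqnn !orbT.
apply: le_trans (_ : \sum_(k <- box K) cn (z t k) ^+ 2 <= _).
  by apply: sum_uniq_le; [exact: uniq_box|apply: sub_box; exact: leq_maxl|move=> k; exact: sqr_ge0].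
pose b := (`|D| * kap ^+ 2 * Um) ^+ 2 / (4 / 5 * (nu0 * kap ^+ 2)) + e * a.
rewrite (_ : Z ^+ 2 + e = b / a); last first.
  by rewrite /b /Z /a; field; rewrite !gt_eqF.
pose y s := \sum_(k <- box K) cn (z s k) ^+ 2.
pose dU s k := - ((nu * kap ^+ 2 * nk k ^+ 2)%:C%C * U s k) + (f s k - B s k).
pose dV s k := - ((gam * kap ^+ 2 * nk k ^+ 2)%:C%C * V s k) +
  (f s k + (mu * low N k)%:C%C * (U s k - V s k) - B' s k).
have dy s : is_derive s (1 : R) y (\sum_(k <- box K) 2 * cRe ((dV s k - dU s k) * conjc (z s k))).
  apply: (is_derive_bigseq (h := fun k s => cn (z s k) ^+ 2)
    (dh := fun k s => 2 * cRe ((dV s k - dU s k) * conjc (z s k)))) => k.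
  rewrite mem_box => /and3P[k0 _ _].
  exact: cder_cn_sqr (cderB (traj_ode trV s k0) (traj_ode trU s k0)).
have hz s F : uniq F -> \sum_(k <- F) cn (z s k) ^+ 2 <= (X + Um) ^+ 2 * 4.
  move=> uF.
  apply: le_trans (_ : \sum_(k <- F) 2 * ((nk k * cn (V s k)) ^+ 2 + (nk k * cn (U s k)) ^+ 2) <= _).
    apply: ler_sum => k _.
    have [->|k0] := eqVneq k 0.
      by rewrite /z (traj_0 trU) (traj_0 trV) subr0 cn0 nk0 !mul0r expr0n /= addr0 mulr0.
    have h1 : cn (z s k) <= nk k * cn (V s k) + nk k * cn (U s k).
      rewrite -mulrDr; apply: le_trans (cnB _ _) _.
      by rewrite ler_peMl ?addr_ge0 ?cn_ge0 // nk_ge1.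
    have h2 : cn (z s k) ^+ 2 <= (nk k * cn (V s k) + nk k * cn (U s k)) ^+ 2.
      by rewrite lerXn2r ?nnegrE ?cn_ge0 // addr_ge0 ?mulr_ge0 ?cn_ge0 ?nk_ge0.
    by apply: le_trans h2 _; have := amgm (nk k * cn (V s k)) (nk k * cn (U s k)); nra.
  rewrite -mulr_sumr big_split /=.
  by have := hX s F uF; have := hU s F uF; nra.
apply: (gronwall_bounded (y := y) (C := (X + Um) ^+ 2 * 4) a0 dy) => [s|s]; last first.
  by apply: hz; exact: uniq_box.
pose W := \sum_(k <- box K) (wgt N k * cn (z s k)) ^+ 2.
have W0 : 0 <= W by apply: sumr_ge0 => k _; exact: sqr_ge0.
have yW : N ^+ 2 * y s <= W.
  rewrite mulr_sumr; apply: ler_sum => k _; rewrite exprMn ler_wpM2r ?sqr_ge0 //.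
  by rewrite wgt_sqr // le_max lexx orbT.
have hBU := hKU K KUK (U s) (z s) (B s) (hC1 s) (zdec s) (fun k => traj_B trU s (k := k)).
have hBV := hKV K KVK (V s) (z s) (B' s) (hC2 s) (zdec s) (fun k => traj_B trV s (k := k)).
have hT := TT_diff K (traj_rl trU s) (traj_rl trV s).
have hTe := @TT_est_box N (Num.sqrt W) Um K (z s) (U s) N1 (sqrtr_ge0 _) Um0 (hU s).
rewrite sqr_sqrtr // in hTe; have {}hTe := hTe (lexx _).
have hTk : `|kap * TT (box K) (box K) (box K) (z s) (U s) (z s)| <= nu0 * kap ^+ 2 / 5 * W.
  rewrite normrM (gtr0_norm kap0); apply: le_trans (ler_wpM2l (ltW kap0) hTe) _.
  rewrite (_ : kap * (8 / N * (W * Um)) = (kap / N * (8 * Um)) * W); last by field; rewrite gt_eqF.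
  rewrite ler_wpM2r //; apply: le_trans (ler_wpM2l _ small) _.
    by rewrite divr_ge0 // ltW.
  by apply: le_of_eq; field; rewrite gt_eqF.
have hk k : k \in box K -> cRe ((dV s k - dU s k) * conjc (z s k)) <=
    - (nu0 * kap ^+ 2 * (wgt N k * cn (z s k)) ^+ 2) +
    `|D| * kap ^+ 2 * ((nk k * cn (U s k)) * (wgt N k * cn (z s k))) -
    (cRe (B' s k * conjc (z s k)) - cRe (B s k * conjc (z s k))).
  move=> kK.
  have -> : cRe ((dV s k - dU s k) * conjc (z s k)) =
    - ((gam * kap ^+ 2 * nk k ^+ 2 + mu * low N k) * cn (z s k) ^+ 2) +
    D * kap ^+ 2 * nk k ^+ 2 * cRe (U s k * conjc (z s k)) -
    (cRe (B' s k * conjc (z s k)) - cRe (B s k * conjc (z s k))).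
    rewrite /dU /dV /z /D cn_sqr.
    by case: (U s k) (V s k) (f s k) (B s k) (B' s k) => u1 u2 [v1 v2] [f1 f2] [b1 b2] [b3 b4] /=; ring.
  rewrite lerD2r; apply: lerD.
    rewrite lerN2 exprMn mulrA ler_wpM2r ?sqr_ge0 //; exact: dissipation.
  apply: le_trans (ler_norm _) _.
  have kn0 : 0 <= kap ^+ 2 * nk k ^+ 2 by rewrite mulr_ge0 ?sqr_ge0.
  rewrite -mulrA -mulrA normrM -mulrA ler_wpM2l // mulrA normrM (ger0_norm kn0).
  rewrite -(mulrA (kap ^+ 2)) ler_wpM2l ?sqr_ge0 //.
  apply: le_trans (ler_wpM2l (sqr_ge0 _) (cRe_le _)) _; rewrite cnM cnJ.
  rewrite (_ : nk k ^+ 2 * _ = nk k * cn (U s k) * (nk k * cn (z s k))); last by ring.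
  rewrite ler_wpM2l ?mulr_ge0 ?nk_ge0 ?cn_ge0 // ler_wpM2r ?cn_ge0 //.
  by rewrite le_max lexx.
have hsum : \sum_(k <- box K) cRe ((dV s k - dU s k) * conjc (z s k)) <=
    - (nu0 * kap ^+ 2 * W) + `|D| * kap ^+ 2 * Um * Num.sqrt W +
    nu0 * kap ^+ 2 / 5 * W + e * a / 2.
  rewrite big_seq; apply: le_trans (ler_sum _ hk) _; rewrite -big_seq.
  rewrite !big_split /= !sumrN -!mulr_sumr -/W sumrB.
  have h1 := sum_sqrt_CS (fun k => wgt N k * cn (z s k)) Um0 (uniq_box K) (hU s).
  have := ler_wpM2l (mulr_ge0 (normr_ge0 D) (sqr_ge0 kap)) h1; rewrite -/W.
  move: hBU hBV hTk; rewrite -hT mulrBr !ler_norml => /andP[h2 h3] /andP[h4 h5] /andP[h6 h7].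
  rewrite mulrA; lra.
rewrite -mulr_sumr.
have hy := young (`|D| * kap ^+ 2 * Um) (Num.sqrt W) (mulr_gt0 (_ : 0 < 4 / 5) c0).
rewrite sqr_sqrtr // in hy.
have {}hy := hy (divr_gt0 (ltr0n _ 4) (ltr0n _ 5)).
have : a * y s <= 4 / 5 * (nu0 * kap ^+ 2) * W.
  have c45 : 0 <= 4 / 5 * (nu0 * kap ^+ 2) by apply: mulr_ge0 => //; exact: ltW.
  have := ler_wpM2l c45 yW.
  by rewrite (_ : 4 / 5 * (nu0 * kap ^+ 2) * (N ^+ 2 * y s) = a * y s) // /a; ring.
rewrite /b; lra.
Qed.

(** A^-1 P_N removes the two derivatives from (nu - gam) A u, leaving |P_N u|^2, and it selects the
    modes of z seen by the loss; the nudging contributes exactly -mu g to g'. The nonlinear terms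
    involve all modes of z, hence the bound on the whole difference. The end values of g contribute
    1 + d and the integrated source 1 - d, which is the origin of the quotient in M2. *)
Lemma viscosity_gap (kap nu gam mu N s t m zeta Um Vm Pb Lw Qa Qd : R) K U V B B'
    (f : R -> Z2 -> R[i]) :
  0 < kap -> 0 < mu -> 0 <= gam -> s < t ->
  traj kap nu U B f ->
  traj kap gam V B' (fun t k => f t k + (mu * low N k)%:C%C * (U t k - V t k)) ->
  0 <= zeta -> 0 <= Um -> 0 <= Vm -> 0 <= Pb -> 0 <= Lw -> 0 <= Qa -> 0 <= Qd ->
  (forall x, l2b (fun k => cn (V x k - U x k)) (`|nu - gam| * zeta)) ->
  (forall x, l2b (fun k => nk k * cn (U x k)) Um) ->
  (forall x, l2b (fun k => nk k * cn (V x k)) Vm) ->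
  (forall x, l2b (fun k => low N k * cn (U x k)) Pb) ->
  (forall x, l2b (fun k => low N k * cn (V x k - U x k)) Lw) ->
  (forall x, l2b (fun k => low N k / (kap ^+ 2 * nk k ^+ 2) * cn (U x k)) Qa) ->
  (forall x, l2b (fun k => low N k / (kap ^+ 2 * nk k ^+ 2) *
     cn (- ((nu * kap ^+ 2 * nk k ^+ 2)%:C%C * U x k) + (f x k - B x k))) Qd) ->
  (forall x, s <= x <= t -> m <= \sum_(k <- box K) (low N k * cn (U x k)) ^+ 2) ->
  forall d, d = expR (- (mu * (t - s))) ->
  `|nu - gam| * (m - 8 / kap * (zeta * (Um + Vm) * Pb)) <=
  (mu * ((1 + d) / (1 - d)) * Qa + Qd + gam * Pb) * Lw.
Proof.
move=> kap0 mu0 gam0 st trU trV zeta0 Um0 Vm0 Pb0 Lw0 Qa0 Qd0 hz hU hV hP hL hQa hQd hm d dE.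
set D := nu - gam.
pose z x k := V x k - U x k.
pose iA k := low N k / (kap ^+ 2 * nk k ^+ 2).
have iA0 k : 0 <= iA k.
  by rewrite divr_ge0 ?low_ge0 // mulr_ge0 ?sqr_ge0.
have lowl k : low N k ^+ 2 = low N k by rewrite /low; case: (nk k < N); rewrite ?expr1n ?expr0n.
pose dU x k := - ((nu * kap ^+ 2 * nk k ^+ 2)%:C%C * U x k) + (f x k - B x k).
pose dV x k := - ((gam * kap ^+ 2 * nk k ^+ 2)%:C%C * V x k) +
  (f x k + (mu * low N k)%:C%C * (U x k - V x k) - B' x k).
pose g x := \sum_(k <- box K) iA k * cRe (z x k * conjc (U x k)).
pose dg x := \sum_(k <- box K) iA k *
  (cRe ((dV x k - dU x k) * conjc (U x k)) + cRe (z x k * conjc (dU x k))).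
have hg x : is_derive x (1 : R) g (dg x).
  apply: (is_derive_bigseq (h := fun k x => iA k * cRe (z x k * conjc (U x k)))
    (dh := fun k x => iA k * (cRe ((dV x k - dU x k) * conjc (U x k)) +
       cRe (z x k * conjc (dU x k))))) => k; rewrite mem_box => /and3P[k0 _ _].
  have oU := traj_ode trU x k0; have oV := traj_ode trV x k0.
  exact: is_deriveZ (cder_dot (cderB oV oU) oU).
have CS2 (x y : Z2 -> R) A A' : 0 <= A -> 0 <= A' -> l2b x A -> l2b y A' ->
    \sum_(k <- box K) x k * y k <= A * A'.
  by move=> A0 A'0 hx hy; apply: sum_CS_le => //; [apply: hx|apply: hy]; exact: uniq_box.
have hgb x : `|g x| <= Lw * Qa.
  apply: le_trans (ler_norm_sum _ _ _) _.
  apply: le_trans (CS2 _ _ _ _ Lw0 Qa0 (hL x) (hQa x)).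
  apply: ler_sum => k _; rewrite normrM (ger0_norm (iA0 k)).
  apply: le_trans (ler_wpM2l (iA0 k) (cRe_le _)) _; rewrite cnM cnJ.
  rewrite (_ : low N k * _ * _ = iA k * (low N k * cn (z x k) * cn (U x k))); last first.
    by rewrite /iA /z; ring.
  rewrite /iA -{1}lowl; apply: le_of_eq; ring.
pose Phi x k := (iA k)%:C%C * U x k.
have hPhi x : l2b (fun k => nk k ^+ 2 * cn (Phi x k)) (Pb / kap ^+ 2).
  move=> F uF; rewrite expr_div_n ler_pdivlMr ?exprn_gt0 // mulr_suml.
  apply: le_trans (hP x F uF); apply: ler_sum => k _.
  have h : nk k ^+ 2 * cn (Phi x k) * kap ^+ 2 <= low N k * cn (U x k).
    rewrite /Phi cnM cn_real (ger0_norm (iA0 k)) /iA.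
    have [->|k0] := eqVneq k 0.
      by rewrite nk0 expr0n /= !mul0r mulr_ge0 ?low_ge0 ?cn_ge0.
    have nkp := nk_gt0 (R := R) k0.
    by apply: le_of_eq; field; rewrite !gt_eqF.
  rewrite -(exprMn 2 (nk k ^+ 2 * cn (Phi x k))); apply: lerXn2r => //; rewrite nnegrE.
    by apply: mulr_ge0; [apply: mulr_ge0; [exact: sqr_ge0|exact: cn_ge0]|exact: sqr_ge0].
  by rewrite mulr_ge0 ?low_ge0 ?cn_ge0.
have Pk0 : 0 <= Pb / kap ^+ 2 by rewrite divr_ge0 // sqr_ge0.
(* The outputs stay in a fixed box and the trilinear bounds do not depend on the input box, so a
   limit in [M] at each time suffices. The test sequence is not z, so both parts of the difference
   of quadratic terms remain. *)
have hBt x : `|\sum_(k <- box K) iA k * (cRe (B' x k * conjc (U x k)) - cRe (B x k * conjc (U x k)))| <=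
    `|D| * (8 / kap * (zeta * (Um + Vm) * Pb)).
  apply: le_eps => e e0; have e2 : 0 < e / 2 by rewrite divr_gt0.
  have [M1 h1] := @pairing_lim _ kap K (U x) (Phi x) (B x) _ e2 (fun k => traj_B trU x (k := k)).
  have [M2 h2] := @pairing_lim _ kap K (V x) (Phi x) (B' x) _ e2 (fun k => traj_B trV x (k := k)).
  pose M := maxn M1 M2.
  have {}h1 := h1 M (leq_maxl _ _). have {}h2 := h2 M (leq_maxr _ _).
  have Vz : V x = fun k => U x k + z x k by apply/funext => k; rewrite /z addrC subrK.
  have eT : TT (box M) (box M) (box K) (V x) (V x) (Phi x) -
      TT (box M) (box M) (box K) (U x) (U x) (Phi x) =
      TT (box M) (box M) (box K) (z x) (V x) (Phi x) +
      TT (box M) (box M) (box K) (U x) (z x) (Phi x).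
    by rewrite {1}Vz TT_addl {1}Vz TT_addm; lra.
  have Dz0 : 0 <= `|D| * zeta by rewrite mulr_ge0.
  have P00 : Phi x 0 = 0 by rewrite /Phi (traj_0 trU) mulr0.
  have b1 := TT_est_test1 (box K) Dz0 Vm0 Pk0 (uniq_box M) (uniq_box M)
    (traj_0 trV x) P00 (hz x) (hV x) (hPhi x).
  have b2 := TT_est_test2 (box K) Um0 Dz0 Pk0 (uniq_box M) (uniq_box M)
    (traj_0 trU x) P00 (hU x) (hz x) (hPhi x).
  rewrite (eq_bigr (fun k => cRe (B' x k * conjc (Phi x k)) - cRe (B x k * conjc (Phi x k)))); last first.
    move=> k _; rewrite /Phi; case: (B x k) (B' x k) (U x k) => b3 b4 [b5 b6] [u1 u2] /=; ring.
  rewrite sumrB.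
  have hk : `|kap * (TT (box M) (box M) (box K) (V x) (V x) (Phi x) -
      TT (box M) (box M) (box K) (U x) (U x) (Phi x))| <= `|D| * (8 / kap * (zeta * (Um + Vm) * Pb)).
    rewrite eT normrM (gtr0_norm kap0).
    apply: le_trans (ler_wpM2l (ltW kap0) (le_trans (ler_normD _ _) (lerD b1 b2))) _.
    by apply: le_of_eq; field; rewrite !gt_eqF.
  move: h1 h2 hk; rewrite mulrBr !ler_norml => /andP[q1 q2] /andP[q3 q4] /andP[q5 q6].
  by apply/andP; split; lra.
(* The sign of nu - gam does not depend on time; multiplying by it turns the source into one bounded
   below by |D| m. *)
pose sg : R := if 0 <= D then 1 else -1.
have sgD : sg * D = `|D|.
  rewrite /sg; case: ifP => h; rewrite ?mul1r ?mulN1r; first by rewrite ger0_norm.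
  by rewrite ltr0_norm // ltNge h.
have sgn y : sg * y <= `|y|.
  rewrite /sg; case: ifP => _; rewrite ?mul1r ?mulN1r; first exact: ler_norm.
  by rewrite -normrN; exact: ler_norm.
set T := 8 / kap * _ in hBt *.
pose E := gam * (Lw * Pb) + Lw * Qd + `|D| * T.
have key x : s <= x <= t -> `|D| * m - E <= sg * (dg x + mu * g x).
  move=> sxt.
  have -> : dg x + mu * g x =
      D * (\sum_(k <- box K) (low N k * cn (U x k)) ^+ 2) -
      gam * (\sum_(k <- box K) low N k * cRe (z x k * conjc (U x k))) -
      (\sum_(k <- box K) iA k * (cRe (B' x k * conjc (U x k)) - cRe (B x k * conjc (U x k)))) +
      \sum_(k <- box K) iA k * cRe (z x k * conjc (dU x k)).
    rewrite !mulr_sumr -big_split /= -!sumrB -big_split /=.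
    rewrite big_seq [RHS]big_seq; apply: eq_bigr => k; rewrite mem_box => /and3P[k0 _ _].
    have nkp := nk_gt0 (R := R) k0.
    have hk : iA k * (kap ^+ 2 * nk k ^+ 2) = low N k.
      by rewrite /iA divfK // mulf_neq0 ?expf_neq0 ?gt_eqF.
    have hl : iA k * low N k = iA k.
      by rewrite /iA mulrAC -expr2 lowl.
    rewrite exprMn lowl.
    rewrite (_ : cRe ((dV x k - dU x k) * conjc (U x k)) =
      (kap ^+ 2 * nk k ^+ 2) * (D * cn (U x k) ^+ 2 - gam * cRe (z x k * conjc (U x k))) -
      low N k * (mu * cRe (z x k * conjc (U x k))) -
      (cRe (B' x k * conjc (U x k)) - cRe (B x k * conjc (U x k)))); last first.
      rewrite /dU /dV /z /D cn_sqr.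
      by case: (U x k) (V x k) (f x k) (B x k) (B' x k) => u1 u2 [v1 v2] [f1 f2] [b1 b2] [b3 b4] /=; ring.
    move: (cRe (z x k * conjc (U x k))) (cRe (B' x k * conjc (U x k)) - _) (cRe (z x k * conjc (dU x k))) => r1 r2 r3.
    transitivity ((iA k * (kap ^+ 2 * nk k ^+ 2)) * (D * cn (U x k) ^+ 2 - gam * r1) -
      (iA k * low N k) * (mu * r1) - iA k * r2 + iA k * r3 + mu * (iA k * r1)); first by ring.
    by rewrite hk hl; ring.
  set S1 := \sum_(k <- _) _; set S2 := \sum_(k <- _) _; set S3 := \sum_(k <- _) _; set S4 := \sum_(k <- _) _.
  have h1 : `|D| * m <= `|D| * S1 by rewrite ler_wpM2l // hm.
  have h2 : `|S2| <= Lw * Pb.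
    apply: le_trans (ler_norm_sum _ _ _) _.
    apply: le_trans (CS2 _ _ _ _ Lw0 Pb0 (hL x) (hP x)).
    apply: ler_sum => k _; rewrite normrM (ger0_norm (low_ge0 _ _)).
    apply: le_trans (ler_wpM2l (low_ge0 _ _) (cRe_le _)) _; rewrite cnM cnJ.
    by rewrite -{1}lowl; apply: le_of_eq; rewrite /z; ring.
  have h3 := hBt x; rewrite -/S3 in h3.
  have h4 : `|S4| <= Lw * Qd.
    apply: le_trans (ler_norm_sum _ _ _) _.
    apply: le_trans (CS2 _ _ _ _ Lw0 Qd0 (hL x) (hQd x)).
    apply: ler_sum => k _; rewrite normrM (ger0_norm (iA0 k)).
    apply: le_trans (ler_wpM2l (iA0 k) (cRe_le _)) _; rewrite cnM cnJ.
    rewrite /iA -{1}lowl; apply: le_of_eq; rewrite /z /dU; ring.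
  have e2 := sgn (gam * S2); have e3 := sgn S3; have e4 := sgn (- S4).
  rewrite normrM (ger0_norm gam0) in e2; rewrite normrN in e4.
  have h2' := ler_wpM2l gam0 h2.
  have -> : sg * (D * S1 - gam * S2 - S3 + S4) = (sg * D) * S1 - sg * (gam * S2) - sg * S3 + sg * S4.
    by ring.
  by rewrite sgD /E; rewrite mulrN in e4; lra.
pose A := `|D| * m - E.
(* By [key] this function is nondecreasing on [s, t]; comparing its values at the ends replaces an
   integration. *)
pose h x := expR (mu * x) * (sg * g x - A / mu).
have hh x : is_derive x (1 : R) h (expR (mu * x) * (sg * (dg x + mu * g x) - A)).
  have hg' := hg x.
  rewrite /h; apply: is_derive_eq; rewrite /GRing.scale /=.
  by field; rewrite gt_eqF.
have h0 x : s <= x <= t -> 0 <= expR (mu * x) * (sg * (dg x + mu * g x) - A).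
  by move=> hx; rewrite mulr_ge0 ?expR_ge0 // subr_ge0 key.
have := ge0_derive_ndecr hh (ltW st) h0; rewrite /h.
have es : expR (mu * s) = expR (mu * t) * d by rewrite dE -expRD; congr expR; ring.
rewrite es -mulrA ler_pM2l ?expR_gt0 // => hfin.
have d0 : 0 < d by rewrite dE expR_gt0.
have d1 : d < 1.
  by rewrite dE expR_lt1 oppr_lt0 mulr_gt0 // subr_gt0.
have hs := le_trans (sgn (- g s)) (_ : `|- g s| <= _); rewrite normrN in hs.
have ht := le_trans (sgn (g t)) (hgb t).
have {}hs := hs _ (hgb s).
have hA : A / mu * (1 - d) <= (1 + d) * (Lw * Qa).
  rewrite mulrN in hs.
  have := ler_wpM2l (ltW d0) hs; lra.
have hA2 : A <= mu * ((1 + d) / (1 - d)) * Qa * Lw.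
  have d1' : 0 < 1 - d by rewrite subr_gt0.
  have := ler_wpM2l (ltW mu0) hA.
  rewrite (_ : mu * (A / mu * (1 - d)) = A * (1 - d)); last by field; rewrite gt_eqF.
  rewrite -ler_pdivlMr // => /le_trans; apply.
  by apply: le_of_eq; field; rewrite gt_eqF.
rewrite /A /E in hA2; lra.
Qed.

End Gap.

(** * Fourier analysis on the period cell *)

Section CellIntegrals.
Context {R : realType}.
Variable L : R.
Hypothesis L0 : 0 < L.
Implicit Types (f g h : R * R -> R).

Local Notation mT := (measurableTypeR R).
Local Notation Om := (Omega L).
Local Notation mu2 := (@leb2 R).

Definition meas g := measurable_fun Om (g : mT * mT -> R).
Definition ibl g := mu2.-integrable Om (EFin \o g).

Lemma measurable_Omega : measurable Om.
Proof. by apply: measurableX; exact: measurable_itv. Qed.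

Lemma leb2_Omega : mu2 Om = (L ^+ 2)%:E.
Proof.
transitivity (@lebesgue_measure R `[0%R, L] * @lebesgue_measure R `[0%R, L])%E.
  by apply: product_measure1E; exact: measurable_itv.
by rewrite !lebesgue_measure_itv /= lte_fin L0 /= sube0 -EFinM expr2.
Qed.

Lemma ibl_bounded g (C : R) : meas g -> (forall x, `|g x| <= C) -> ibl g.
Proof.
move=> mg gC; apply: measurable_bounded_integrable => //.
- exact: measurable_Omega.
- by rewrite leb2_Omega ltry.
- exists C; split; first exact: num_real.
  by move=> y Cy x _; apply: le_trans (gC x) (ltW Cy).
Qed.

Lemma measD f g : meas f -> meas g -> meas (fun x => f x + g x).
Proof. exact: measurable_funD. Qed.
Lemma measM f g : meas f -> meas g -> meas (fun x => f x * g x).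
Proof. exact: measurable_funM. Qed.
Lemma meas_cst (c : R) : meas (fun=> c).
Proof. exact: measurable_cst. Qed.

Lemma iblD f g : ibl f -> ibl g -> ibl (fun x => f x + g x).
Proof.
move=> hf hg; rewrite /ibl (_ : _ \o _ = (EFin \o f) \+ (EFin \o g))%E //.
exact: (integrableD measurable_Omega).
Qed.

Lemma iblZ f (c : R) : ibl f -> ibl (fun x => c * f x).
Proof.
move=> hf; rewrite /ibl (_ : _ \o _ = (fun x => c%:E * (EFin \o f) x))%E //.
exact: (integrableZl measurable_Omega).
Qed.

Lemma ibl_meas f : ibl f -> meas f.
Proof. by move=> /integrableP[/measurable_EFinP]. Qed.

Lemma ibl_le f g : meas f -> (forall x, `|f x| <= `|g x|) -> ibl g -> ibl f.
Proof.
move=> mf fg; apply: le_integrable; first exact: measurable_Omega.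
  exact/measurable_EFinP.
by move=> x _; rewrite /= lee_fin.
Qed.

Lemma integD f g : ibl f -> ibl g ->
  integ L (fun x => f x + g x) = integ L f + integ L g.
Proof. by move=> hf hg; exact: (RintegralD measurable_Omega). Qed.

Lemma integZ f (c : R) : ibl f -> integ L (fun x => c * f x) = c * integ L f.
Proof. by move=> hf; apply: RintegralZl => //; exact: measurable_Omega. Qed.

Lemma integ0 : integ L (fun=> 0) = 0.
Proof. by rewrite /integ Rintegral_cst ?mul0r //; exact: measurable_Omega. Qed.

Lemma ibl0 : ibl (fun=> 0).
Proof. by apply: (@ibl_bounded _ 0) => [|x]; [exact: meas_cst|rewrite normr0]. Qed.

Lemma ibl_sum (I : Type) (r : seq I) (P : pred I) (f : I -> R * R -> R) :
  (forall i, ibl (f i)) -> ibl (fun x => \sum_(i <- r | P i) f i x).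
Proof.
move=> hf; elim: r => [|i r IH].
  by rewrite (_ : (fun x => _) = fun=> 0) ?ibl0 //; apply/funext => x; rewrite big_nil.
case Pi : (P i); last first.
  rewrite (_ : (fun x => _) = fun x => \sum_(i <- r | P i) f i x) //.
  by apply/funext => x; rewrite big_cons Pi.
rewrite (_ : (fun x => _) = fun x => f i x + \sum_(i <- r | P i) f i x).
  exact: iblD.
by apply/funext => x; rewrite big_cons Pi.
Qed.

Lemma integ_sum (I : Type) (r : seq I) (P : pred I) (f : I -> R * R -> R) :
  (forall i, ibl (f i)) ->
  integ L (fun x => \sum_(i <- r | P i) f i x) = \sum_(i <- r | P i) integ L (f i).
Proof.
move=> hf; elim: r => [|i r IH].
  by rewrite big_nil -[RHS]integ0; congr integ; apply/funext => x; rewrite big_nil.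
rewrite big_cons; case: ifP => Pi; rewrite -IH.
  rewrite -integD //; first by congr integ; apply/funext => x; rewrite big_cons Pi.
  exact: ibl_sum.
by congr integ; apply/funext => x; rewrite big_cons Pi.
Qed.

Lemma integ_ge0 f : (forall x, 0 <= f x) -> 0 <= integ L f.
Proof. by move=> f0; apply: Rintegral_ge0 => x _. Qed.

Lemma L2_meas f : L2 L f -> meas f. Proof. by case. Qed.

Lemma L2_sqr f : L2 L f -> ibl (fun x => f x ^+ 2). Proof. by case. Qed.

Lemma L2_ibl f g : L2 L f -> L2 L g -> ibl (fun x => f x * g x).
Proof.
move=> hf hg; apply: (@ibl_le _ (fun x => f x ^+ 2 + g x ^+ 2)).
- by apply: measM; exact: L2_meas.
- move=> x; rewrite [leRHS]ger0_norm ?addr_ge0 ?sqr_ge0 // normrM.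
  have := amgm `|f x| `|g x|; rewrite !real_normK ?num_real //.
  by have := sqr_ge0 (f x); have := sqr_ge0 (g x); have : 0 <= `|f x| * `|g x| by []; lra.
- by apply: iblD; exact: L2_sqr.
Qed.

Lemma L2D f g : L2 L f -> L2 L g -> L2 L (fun x => f x + g x).
Proof.
move=> hf hg; split; first by apply: measD; exact: L2_meas.
have := iblD (iblD (L2_sqr hf) (L2_sqr hg)) (iblZ 2 (L2_ibl hf hg)).
by congr (_.-integrable _ _); apply/funext => x /=; congr EFin; ring.
Qed.

Lemma L2Z f (c : R) : L2 L f -> L2 L (fun x => c * f x).
Proof.
move=> hf; split; first by apply: measM; [exact: meas_cst|exact: L2_meas].
have := iblZ (c ^+ 2) (L2_sqr hf).
by congr (_.-integrable _ _); apply/funext => x /=; congr EFin; ring.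
Qed.

Lemma L2B f g : L2 L f -> L2 L g -> L2 L (fun x => f x - g x).
Proof.
move=> hf hg; rewrite (_ : (fun x => _) = fun x => f x + (-1) * g x).
  by apply: L2D => //; exact: L2Z.
by apply/funext => x; ring.
Qed.

Lemma L2_bounded f (C : R) : meas f -> (forall x, `|f x| <= C) -> L2 L f.
Proof.
move=> mf fC; split => //; apply: (@ibl_bounded _ (C ^+ 2)).
  by rewrite (_ : (fun x => _) = fun x => f x * f x); [exact: measM|apply/funext => x; rewrite expr2].
move=> x; rewrite normrX lerXn2r ?nnegrE //; exact: le_trans (fC x).
Qed.

Lemma L2_Mbounded f w (C : R) : L2 L f -> meas w -> (forall x, `|w x| <= C) ->
  L2 L (fun x => f x * w x).
Proof.
move=> hf mw wC; split; first by apply: measM => //; exact: L2_meas.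
have C0 : 0 <= C by apply: le_trans (wC (0, 0)).
apply: (@ibl_le _ (fun x => C ^+ 2 * f x ^+ 2)); last exact: (iblZ _ (L2_sqr hf)).
  rewrite (_ : (fun x => _) = fun x => (f x * w x) * (f x * w x)).
    by do 2?apply: measM => //; exact: L2_meas.
  by apply/funext => x; rewrite expr2.
move=> x; rewrite (ger0_norm (sqr_ge0 _)) (ger0_norm (mulr_ge0 (sqr_ge0 C) (sqr_ge0 _))).
rewrite exprMn mulrC ler_wpM2r ?sqr_ge0 // -(real_normK (num_real (w x))).
by rewrite lerXn2r ?nnegrE.
Qed.

Lemma L2_0 : L2 L (fun=> 0).
Proof. by apply: (@L2_bounded _ 0) => [|x]; [exact: meas_cst|rewrite normr0]. Qed.

Lemma L2_sum (I : Type) (r : seq I) (f : I -> R * R -> R) :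
  (forall i, L2 L (f i)) -> L2 L (fun x => \sum_(i <- r) f i x).
Proof.
move=> hf; elim: r => [|i r IH].
  rewrite (_ : (fun x => _) = fun=> 0); first exact: L2_0.
  by apply/funext => x; rewrite big_nil.
rewrite (_ : (fun x => _) = fun x => f i x + \sum_(i <- r) f i x).
  exact: L2D.
by apply/funext => x; rewrite big_cons.
Qed.

Definition n2 f : R := Num.sqrt (integ L (fun x => f x ^+ 2)).

Lemma n2_ge0 f : 0 <= n2 f. Proof. exact: sqrtr_ge0. Qed.

Lemma n2_sqr f : n2 f ^+ 2 = integ L (fun x => f x ^+ 2).
Proof. by rewrite sqr_sqrtr // integ_ge0 // => x; exact: sqr_ge0. Qed.

Lemma integ_CS f g : L2 L f -> L2 L g ->
  `|integ L (fun x => f x * g x)| <= n2 f * n2 g.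
Proof.
move=> hf hg; set A := n2 f; set B := n2 g; set P := integ L _.
have A0 : 0 <= A by exact: n2_ge0. have B0 : 0 <= B by exact: n2_ge0.
have quad (a b : R) : 0 <= a ^+ 2 * A ^+ 2 + 2 * (a * b) * P + b ^+ 2 * B ^+ 2.
  have -> : a ^+ 2 * A ^+ 2 + 2 * (a * b) * P + b ^+ 2 * B ^+ 2 =
      integ L (fun x => (a * f x + b * g x) ^+ 2).
    rewrite /A /B !n2_sqr /P -(integZ _ (L2_sqr hf)) -(integZ _ (L2_sqr hg)) -(integZ _ (L2_ibl hf hg)).
    rewrite -!integD; first by congr integ; apply/funext => x; ring.
    - by apply: iblD; apply: iblZ; [exact: L2_sqr|exact: L2_ibl].
    - by apply: iblZ; exact: L2_sqr.
    - by apply: iblZ; exact: L2_sqr.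
    - by apply: iblZ; exact: L2_ibl.
  by apply: integ_ge0 => x; exact: sqr_ge0.
have hP (sg : R) : sg ^+ 2 = 1 -> sg * P <= A * B.
  move=> sg2; apply: le_eps => e e0.
  have [AB|AB] := eqVneq (A * B) 0.
    rewrite AB add0r leNgt; apply/negP => lt.
    have AB2 : A ^+ 2 * B ^+ 2 = 0 by rewrite -exprMn AB expr0n.
    have P2 : 0 < P ^+ 2.
      have : 0 < (sg * P) ^+ 2 by rewrite exprn_gt0 // (lt_trans e0).
      by rewrite exprMn sg2 mul1r.
    move/eqP: AB; rewrite mulf_eq0 => /orP[] /eqP Z.
      (* With A = 0 the nonnegative form would take the value - P^2 (B^2 + 2) here. *)
      have := quad (B ^+ 2 + 1) (- P); rewrite Z.
      have : 0 < P ^+ 2 * (B ^+ 2 + 2) by rewrite mulr_gt0 // ltr_wpDl ?sqr_ge0.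
      by nra.
    have := quad (- P) (A ^+ 2 + 1); rewrite Z.
    have : 0 < P ^+ 2 * (A ^+ 2 + 2) by rewrite mulr_gt0 // ltr_wpDl ?sqr_ge0.
    by nra.
  have ABp : 0 < A * B by rewrite lt_def AB mulr_ge0.
  have := quad (B * sg) (- A).
  have -> : (B * sg) ^+ 2 * A ^+ 2 + 2 * (B * sg * - A) * P + (- A) ^+ 2 * B ^+ 2 =
    (2 * (A * B)) * (A * B - sg * P).
    by rewrite exprMn sg2; ring.
  have AB2 : 0 < 2 * (A * B) by rewrite mulr_gt0.
  rewrite (pmulr_rge0 _ AB2); lra.
rewrite ler_norml; apply/andP; split.
  by have := hP (-1); rewrite sqrrN expr1n => /(_ erefl); lra.
by have := hP 1 (expr1n _ _); lra.
Qed.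

Local Notation leb := (@lebesgue_measure R).

Lemma int_1d (F f : R -> R) : continuous f -> (forall x, is_derive x (1 : R) F (f x)) ->
  (\int[leb]_(x in `[0%R, L]) (f x)%:E = (F L - F 0)%:E)%E.
Proof.
move=> cf dF; have cF : continuous F.
  move=> x; apply: differentiable_continuous; apply/derivable1_diffP.
  exact: (@ex_derive _ _ _ _ _ _ _ (dF x)).
rewrite (continuous_FTC2 (F := F)) ?EFinB //.
- by apply: continuous_subspaceT => x; exact: cf.
- split; first by move=> x _; exact: (@ex_derive _ _ _ _ _ _ _ (dF x)).
  - by apply: cvg_at_right_filter; exact: cF.
  - by apply: cvg_at_left_filter; exact: cF.
- by move=> x _; rewrite derive1E; exact: (@derive_val _ _ _ _ _ _ _ (dF x)).
Qed.

Lemma integ_prod (a b : R -> R) (A B C : R) :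
  continuous a -> continuous b -> (forall x, `|a x| <= C) -> (forall x, `|b x| <= C) ->
  (\int[leb]_(x in `[0%R, L]) (a x)%:E = A%:E)%E ->
  (\int[leb]_(x in `[0%R, L]) (b x)%:E = B%:E)%E ->
  integ L (fun x => a x.1 * b x.2) = A * B.
Proof.
move=> ca cb aC bC hA hB.
have C0 : 0 <= C by apply: le_trans (aC 0).
have ma : measurable_fun setT (a : mT -> mT) by exact: continuous_measurable_fun.
have mb : measurable_fun setT (b : mT -> mT) by exact: continuous_measurable_fun.
pose F (x : mT * mT) : R := a x.1 * b x.2.
have mF : measurable_fun setT F.
  by apply: measurable_funM; apply: measurableT_comp => //; exact: measurable_funTS.
have iF : ibl F.
  apply: (@ibl_bounded _ (C * C)).
    exact: measurable_funS mF.
  by move=> x; rewrite normrM ler_pM.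
have mI : measurable (`[0, L]%classic : set mT) by exact: measurable_itv.
have iE (g : R -> R) D : measurable_fun setT (g : mT -> mT) -> (forall x, `|g x| <= D) ->
    leb.-integrable `[0, L] (EFin \o g).
  move=> mg gD; apply: measurable_bounded_integrable => //.
  - by rewrite /= lebesgue_measure_itv /= lte_fin L0 /= sube0 ltry.
  - exact: measurable_funS mg.
  - exists D; split; first exact: num_real.
    by move=> y Dy x _; apply: le_trans (gD x) (ltW Dy).
have iF' := (integrable_mkcond _ measurable_Omega).1 iF.
(* Fubini's theorem is applied on the whole plane to the extension by zero; the indicator of the
   square is the product of the indicators of its sides. *)
rewrite /integ /Rintegral integral_mkcond -(integral12_prod_meas1 iF').
rewrite /fubini_F.
have inner x : (\int[leb]_y ((EFin \o F) \_ Om) (x, y) = (((EFin \o a) \_ `[0%R, L]) x * B%:E))%E.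
  rewrite -hB [X in (_ * X)%E]integral_mkcond.
  case: (boolP (x \in `[0%R, L]%classic)) => xI.
    rewrite [((EFin \o a) \_ _) x]patchE xI -integralZl //; last first.
      by apply/(integrable_mkcond _ mI).1; exact: iE bC.
    apply: eq_integral => y _; rewrite !patchE /F /=.
    rewrite (_ : ((x, y) \in Om) = (y \in `[0%R, L]%classic)); last first.
      by rewrite /Omega in_setX /= xI.
    by case: ifP => _; rewrite ?EFinM ?mule0.
  rewrite [((EFin \o a) \_ _) x]patchE (negPf xI) mul0e.
  rewrite integral0_eq // => y _; rewrite patchE (_ : ((x, y) \in Om) = false) //.
  by rewrite /Omega in_setX /= (negPf xI).
under eq_integral do rewrite inner.
rewrite integralZr //; last by apply/(integrable_mkcond _ mI).1; exact: iE aC.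
by rewrite -integral_mkcond [X in (X * _)%E](_ : _ = A%:E).
Qed.

Lemma cossin_2pin (n : nat) : cos (n%:R * (2 * pi)) = 1 :> R /\ sin (n%:R * (2 * pi)) = 0 :> R.
Proof.
elim: n => [|n [c s]]; first by rewrite mul0r cos0 sin0.
rewrite -natr1 mulrDl mul1r cosD sinD c s.
by rewrite mulr_natl cos2pi sin2pi !mul0r !mul1r subr0 add0r.
Qed.

Lemma cos_2pi_int (n : int) : cos (n%:~R * (2 * pi)) = 1 :> R.
Proof.
case: n => n; first exact: (cossin_2pin n).1.
by rewrite NegzE rmorphN /= mulNr cosN; exact: (cossin_2pin n.+1).1.
Qed.

Lemma sin_2pi_int (n : int) : sin (n%:~R * (2 * pi)) = 0 :> R.
Proof.
case: n => n; first exact: (cossin_2pin n).2.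
by rewrite NegzE rmorphN /= mulNr sinN (cossin_2pin n.+1).2 oppr0.
Qed.

Local Notation kap := (kappa0 L).

Lemma kap_gt0 : 0 < kap. Proof. by rewrite divr_gt0 // mulr_gt0 // pi_gt0. Qed.

Lemma kapL : kap * L = 2 * pi. Proof. by rewrite /kappa0 divfK ?gt_eqF. Qed.

Lemma continuous_cosM (a : R) : continuous (fun x => cos (a * x)).
Proof.
by move=> x; apply: continuous_comp; [apply: continuousM; [exact: cst_continuous|exact: cvg_id]|exact: continuous_cos].
Qed.

Lemma continuous_sinM (a : R) : continuous (fun x => sin (a * x)).
Proof.
by move=> x; apply: continuous_comp; [apply: continuousM; [exact: cst_continuous|exact: cvg_id]|exact: continuous_sin].
Qed.

Lemma int_cos (n : int) :
  (\int[leb]_(x in `[0%R, L]) (cos (kap * n%:~R * x))%:E = ((n == 0)%:R * L)%:E)%E.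
Proof.
have [->|n0] := eqVneq n 0.
  have hd x : is_derive x (1 : R) id (cos (kap * 0%:~R * x)).
    by apply: is_derive_eq; rewrite mulr0 mul0r cos0.
  rewrite (int_1d (@continuous_cosM (kap * 0%:~R)) hd).
  by rewrite subr0 mul1r.
have nz : kap * n%:~R != 0.
  by apply: mulf_neq0; [rewrite gt_eqF // kap_gt0|rewrite intr_eq0].
have hd x : is_derive x (1 : R) (fun x => (kap * n%:~R)^-1 * sin (kap * n%:~R * x))
    (cos (kap * n%:~R * x)).
  move: (kap * n%:~R) nz => c cn0.
  by apply: is_derive_eq; rewrite /GRing.scale /=; field.
rewrite (int_1d (@continuous_cosM (kap * n%:~R)) hd).
have -> : kap * n%:~R * L = n%:~R * (2 * pi) by rewrite mulrAC kapL mulrC.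
by rewrite sin_2pi_int (mulr0 (kap * _)) sin0 !mulr0 subrr mul0r.
Qed.

Lemma int_sin (n : int) :
  (\int[leb]_(x in `[0%R, L]) (sin (kap * n%:~R * x))%:E = 0%:E)%E.
Proof.
have [->|n0] := eqVneq n 0.
  have hd x : is_derive x (1 : R) (fun=> 0) (sin (kap * 0%:~R * x)).
    by apply: is_derive_eq; rewrite mulr0 mul0r sin0.
  rewrite (int_1d (@continuous_sinM (kap * 0%:~R)) hd).
  by rewrite subr0.
have nz : kap * n%:~R != 0.
  by apply: mulf_neq0; [rewrite gt_eqF // kap_gt0|rewrite intr_eq0].
have hd x : is_derive x (1 : R) (fun x => - (kap * n%:~R)^-1 * cos (kap * n%:~R * x))
    (sin (kap * n%:~R * x)).
  move: (kap * n%:~R) nz => c cn0.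
  by apply: is_derive_eq; rewrite /GRing.scale /=; field.
rewrite (int_1d (@continuous_sinM (kap * n%:~R)) hd).
have -> : kap * n%:~R * L = n%:~R * (2 * pi) by rewrite mulrAC kapL mulrC.
by rewrite cos_2pi_int (mulr0 (kap * _)) cos0 subrr.
Qed.

Lemma meas_phase (g : R -> R) k : continuous g -> meas (fun x => g (phase L k x)).
Proof.
move=> cg; apply: (@measurable_funS _ _ _ _ setT) => //.
apply: (measurableT_comp (f := (g : mT -> mT))); first exact: continuous_measurable_fun.
apply: measurable_funM => //; apply: measurable_funD; apply: measurable_funM => //.
Qed.

Lemma L2_cos k : L2 L (fun x => cos (phase L k x)).
Proof. by apply: (@L2_bounded _ 1) => [|x]; [apply: meas_phase; exact: continuous_cos|exact: cos_max]. Qed.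

Lemma L2_sin k : L2 L (fun x => sin (phase L k x)).
Proof. by apply: (@L2_bounded _ 1) => [|x]; [apply: meas_phase; exact: continuous_sin|exact: sin_max]. Qed.

Lemma L2_1_ibl f : L2 L f -> ibl f.
Proof.
move=> hf; have h1 : L2 L (fun=> 1).
  by apply: (@L2_bounded _ 1) => [|x]; [exact: meas_cst|rewrite normr1].
have := L2_ibl hf h1; congr (_.-integrable _ _); apply/funext => x /=; congr EFin; ring.
Qed.

Lemma integB f g : ibl f -> ibl g ->
  integ L (fun x => f x - g x) = integ L f - integ L g.
Proof. by move=> hf hg; exact: (RintegralB measurable_Omega). Qed.

Lemma ibl_prod (g h : R -> R) : continuous g -> continuous h ->
  (forall x, `|g x| <= 1) -> (forall x, `|h x| <= 1) ->
  ibl (fun x => g x.1 * h x.2).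
Proof.
move=> cg ch g1 h1; apply: (@ibl_bounded _ 1).
  apply: (@measurable_funS _ _ _ _ setT) => //.
  apply: measurable_funM; apply: measurableT_comp => //; exact: continuous_measurable_fun.
by move=> x; rewrite normrM mulr_ile1.
Qed.

Lemma integ_cos_phase k : integ L (fun x => cos (phase L k x)) = (k == 0)%:R * L ^+ 2.
Proof.
have m1 (c : R) : continuous (fun x => cos (c * x)) by exact: continuous_cosM.
have m2 (c : R) : continuous (fun x => sin (c * x)) by exact: continuous_sinM.
have b1 (c x : R) : `|cos (c * x)| <= 1 by exact: cos_max.
have b2 (c x : R) : `|sin (c * x)| <= 1 by exact: sin_max.
rewrite (_ : (fun x => _) = fun x => cos (kap * k.1%:~R * x.1) * cos (kap * k.2%:~R * x.2) -
   sin (kap * k.1%:~R * x.1) * sin (kap * k.2%:~R * x.2)); last first.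
  by apply/funext => x; rewrite /phase mulrDr !mulrA cosD.
rewrite (integB (ibl_prod (m1 _) (m1 _) (b1 _) (b1 _)) (ibl_prod (m2 _) (m2 _) (b2 _) (b2 _))).
rewrite (integ_prod (m1 _) (m1 _) (b1 _) (b1 _) (int_cos _) (int_cos _)).
rewrite (integ_prod (m2 _) (m2 _) (b2 _) (b2 _) (int_sin _) (int_sin _)).
case: k => k1 k2 /=; rewrite mulr0 subr0 mulrACA -expr2; congr (_ * _).
by rewrite -natrM mulnb -pair_eqE.
Qed.

Lemma integ_sin_phase k : integ L (fun x => sin (phase L k x)) = 0.
Proof.
have m1 (c : R) : continuous (fun x => cos (c * x)) by exact: continuous_cosM.
have m2 (c : R) : continuous (fun x => sin (c * x)) by exact: continuous_sinM.
have b1 (c x : R) : `|cos (c * x)| <= 1 by exact: cos_max.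
have b2 (c x : R) : `|sin (c * x)| <= 1 by exact: sin_max.
rewrite (_ : (fun x => _) = fun x => sin (kap * k.1%:~R * x.1) * cos (kap * k.2%:~R * x.2) +
   cos (kap * k.1%:~R * x.1) * sin (kap * k.2%:~R * x.2)); last first.
  by apply/funext => x; rewrite /phase mulrDr !mulrA sinD.
rewrite (integD (ibl_prod (m2 _) (m1 _) (b2 _) (b1 _)) (ibl_prod (m1 _) (m2 _) (b1 _) (b2 _))).
rewrite (integ_prod (m2 _) (m1 _) (b2 _) (b1 _) (int_sin _) (int_cos _)).
rewrite (integ_prod (m1 _) (m2 _) (b1 _) (b2 _) (int_cos _) (int_sin _)).
by rewrite mul0r mulr0 addr0.
Qed.

End CellIntegrals.

(** * Fourier coefficients, Parseval and Bessel *)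

Section FourierCoefficients.
Context {R : realType}.
Variable L : R.
Hypothesis L0 : 0 < L.
Implicit Types (f g h : R * R -> R) (D : seq Z2).

Local Notation kap := (kappa0 L).

Definition cexp k (x : R * R) : R[i] := Complex (cos (phase L k x)) (sin (phase L k x)).

Lemma phaseD j k x : phase L (j + k) x = phase L j x + phase L k x.
Proof. by rewrite /phase /= !rmorphD /=; ring. Qed.

Lemma phaseN k x : phase L (- k) x = - phase L k x.
Proof. by rewrite /phase /= !rmorphN /=; ring. Qed.

Lemma cexpM j k x : cexp j x * cexp k x = cexp (j + k) x.
Proof.
by rewrite /cexp phaseD cosD sinD; cring.
Qed.

Lemma cexpJ k x : conjc (cexp k x) = cexp (- k) x.
Proof. by rewrite /cexp phaseN cosN sinN. Qed.

(** This is L^-2 times the integral of g against e^(-i kappa0 k.y), whence the sign of the imaginary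
    part. *)
Definition fc g k : R[i] :=
  Complex (L ^- 2 * integ L (fun y => g y * cos (phase L k y)))
          (- (L ^- 2 * integ L (fun y => g y * sin (phase L k y)))).

Lemma L2n0 : L ^+ 2 != 0. Proof. by rewrite expf_neq0 // gt_eqF. Qed.

Lemma ibl_Mbounded f w (C : R) : ibl L f -> meas L w -> (forall x, `|w x| <= C) ->
  ibl L (fun x => f x * w x).
Proof.
move=> hf mw wC; have C0 : 0 <= C by apply: le_trans (wC (0, 0)).
apply: (@ibl_le _ _ _ (fun x => C * f x)); last exact: iblZ.
  by apply: measM => //; exact: ibl_meas.
by move=> x; rewrite !normrM (ger0_norm C0) mulrC ler_wpM2r.
Qed.

Lemma ibl_cos f k : ibl L f -> ibl L (fun x => f x * cos (phase L k x)).
Proof.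
move=> hf; apply: (@ibl_Mbounded _ _ 1) => // [|x]; last exact: cos_max.
exact: (L2_meas (L2_cos L0 k)).
Qed.

Lemma ibl_sin f k : ibl L f -> ibl L (fun x => f x * sin (phase L k x)).
Proof.
move=> hf; apply: (@ibl_Mbounded _ _ 1) => // [|x]; last exact: sin_max.
exact: (L2_meas (L2_sin L0 k)).
Qed.

Lemma fcE_cos g k : integ L (fun y => g y * cos (phase L k y)) = L ^+ 2 * cRe (fc g k).
Proof. by rewrite /= mulrA mulfV ?mul1r // L2n0. Qed.

Lemma fcE_sin g k : integ L (fun y => g y * sin (phase L k y)) = - (L ^+ 2 * cIm (fc g k)).
Proof. by rewrite /= mulrN opprK mulrA mulfV ?mul1r // L2n0. Qed.

Definition trig_val (a : R[i]) k x : R := cRe a * cos (phase L k x) - cIm a * sin (phase L k x).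

Lemma trig_valE a k x : trig_val a k x = cRe (a * cexp k x).
Proof. by rewrite cReM. Qed.

Lemma L2_trig_val a k : L2 L (trig_val a k).
Proof.
apply: L2B; apply: L2Z; [exact: L2_cos|exact: L2_sin].
Qed.

Lemma integ_trig_val a k : integ L (trig_val a k) = cRe a * ((k == 0)%:R * L ^+ 2).
Proof.
rewrite /trig_val integB; last 2 first.
- by apply: iblZ; apply: (L2_1_ibl L0); exact: L2_cos.
- by apply: iblZ; apply: (L2_1_ibl L0); exact: L2_sin.
rewrite integZ; last by apply: (L2_1_ibl L0); exact: L2_cos.
rewrite integZ; last by apply: (L2_1_ibl L0); exact: L2_sin.
by rewrite (integ_cos_phase L0) (integ_sin_phase L0) mulr0 subr0.
Qed.

Lemma fcN g k : ibl L g -> fc g (- k) = conjc (fc g k).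
Proof.
move=> hg; rewrite /fc /=; congr Complex.
  by congr (_ * integ _ _); apply/funext => y; rewrite phaseN cosN.
rewrite opprK -mulrN -mulN1r -integZ; last exact: ibl_sin.
by congr (_ * integ _ _); apply/funext => y; rewrite phaseN sinN; ring.
Qed.

(** The frequencies are indexed and may repeat, as they do in products and in polynomials that list
    both k and -k. Equality in [R[i]] also says that the imaginary part of the sum vanishes. *)
Definition trig_rep (I : Type) (r : seq I) (m : I -> Z2) (a : I -> R[i]) g :=
  forall x, ((g x)%:C)%C = \sum_(i <- r) a i * cexp (m i) x.

Lemma trig_rep_val (I : Type) (r : seq I) (m : I -> Z2) a g : trig_rep r m a g ->
  g = fun x => \sum_(i <- r) trig_val (a i) (m i) x.
Proof.
move=> h; apply/funext => x; have := congr1 (@complex.Re R) (h x); rewrite /= cRe_sum => ->.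
by apply: eq_bigr => i _; rewrite trig_valE.
Qed.

Lemma trig_rep_L2 (I : Type) (r : seq I) (m : I -> Z2) a g : trig_rep r m a g -> L2 L g.
Proof.
by move=> /trig_rep_val ->; apply: (L2_sum L0) => i; exact: L2_trig_val.
Qed.

Lemma fc_trig_rep (I : Type) (r : seq I) (m : I -> Z2) a g k : trig_rep r m a g ->
  fc g k = \sum_(i <- r | m i == k) a i.
Proof.
move=> hg.
have hE x : ((g x)%:C)%C * cexp (- k) x = \sum_(i <- r) a i * cexp (m i - k) x.
  rewrite hg mulr_suml; apply: eq_bigr => i _.
  by rewrite -mulrA cexpM.
have iv i : ibl L (trig_val (a i) (m i - k)).
  by apply: (L2_1_ibl L0); exact: L2_trig_val.
have iw i : ibl L (trig_val (- ('i%C * a i)) (m i - k)).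
  by apply: (L2_1_ibl L0); exact: L2_trig_val.
have c1 : integ L (fun y => g y * cos (phase L k y)) = \sum_(i <- r | m i == k) L ^+ 2 * cRe (a i).
  rewrite (_ : (fun y => _) = fun y => \sum_(i <- r) trig_val (a i) (m i - k) y); last first.
    apply/funext => y; have := congr1 (@complex.Re R) (hE y); rewrite cReM cRe_sum /= phaseN cosN mul0r subr0 => ->.
    by apply: eq_bigr => i _; rewrite trig_valE.
  rewrite (integ_sum L0) // [RHS]big_mkcond; apply: eq_bigr => i _.
  by rewrite integ_trig_val subr_eq0; case: eqP => _; rewrite ?mul1r ?mul0r ?mulr0 1?mulrC.
have c2 : integ L (fun y => g y * sin (phase L k y)) = \sum_(i <- r | m i == k) - (L ^+ 2 * cIm (a i)).
  rewrite (_ : (fun y => _) = fun y => \sum_(i <- r) - 1 * trig_val (- ('i%C * a i)) (m i - k) y); last first.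
    apply/funext => y; have := congr1 (@complex.Im R) (hE y).
    rewrite cImM cIm_sum /= phaseN sinN mul0r addr0 mulrN => /(congr1 -%R); rewrite opprK => ->.
    rewrite -sumrN; apply: eq_bigr => i _; rewrite /trig_val.
    by case: (a i) => a1 a2; rewrite /=; ring.
  rewrite (integ_sum L0); last by move=> i; apply: iblZ.
  rewrite [RHS]big_mkcond; apply: eq_bigr => i _; rewrite integZ // integ_trig_val subr_eq0.
  case: (a i) => a1 a2; case: eqP => _ /=; ring.
apply/eqP; rewrite eq_complex cRe_sum cIm_sum /= c1 c2; apply/andP; split; apply/eqP.
  by rewrite -mulr_sumr mulrA mulVf ?mul1r // L2n0.
by rewrite sumrN -mulr_sumr mulrN opprK mulrA mulVf ?mul1r // L2n0.
Qed.

Lemma fcD f g k : ibl L f -> ibl L g -> fc (fun x => f x + g x) k = fc f k + fc g k.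
Proof.
move=> hf hg; apply/eqP; rewrite eq_complex cReD cImD /= -!opprD -!mulrDr.
rewrite -!integD; try by first [exact: ibl_cos|exact: ibl_sin].
by apply/andP; split; apply/eqP; [congr (_ * integ _ _)|congr (- (_ * integ _ _))];
  apply/funext => x; rewrite mulrDl.
Qed.

Lemma fcZ f (c : R) k : L2 L f -> fc (fun x => c * f x) k = (c%:C)%C * fc f k.
Proof.
move=> hf; apply/eqP; rewrite eq_complex cReM cImM /= !mul0r subr0 addr0.
rewrite mulrN !(mulrCA c) -!(integZ c); try by apply: L2_ibl => //; (exact: L2_cos || exact: L2_sin).
by apply/andP; split; apply/eqP; [congr (_ * integ _ _)|congr (- (_ * integ _ _))];
  apply/funext => x; rewrite mulrA.
Qed.

Lemma fcB f g k : L2 L f -> L2 L g -> fc (fun x => f x - g x) k = fc f k - fc g k.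
Proof.
move=> hf hg; rewrite (_ : (fun x => _) = fun x => f x + (-1) * g x).
  rewrite (fcD _ (L2_1_ibl L0 hf) (L2_1_ibl L0 (L2Z _ hg))) fcZ //.
  by case: (fc f k) (fc g k) => a b [c d]; cring.
by apply/funext => x; ring.
Qed.

Lemma n2_cos_le k : n2 L (fun x => cos (phase L k x)) <= L.
Proof.
have hc := L2_cos L0 k; have hs := L2_sin L0 k.
apply: le_sqrtP; first exact: ltW.
rewrite n2_sqr; apply: (@le_trans _ _ (integ L (fun x => cos (phase L k x) ^+ 2 + sin (phase L k x) ^+ 2))).
  rewrite integD; [|exact: L2_sqr|exact: L2_sqr].
  by rewrite lerDl; apply: integ_ge0 => // x; exact: sqr_ge0.
rewrite (_ : (fun x => _) = fun x => cos (phase L 0 x)).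
  by rewrite (integ_cos_phase L0) eqxx mul1r.
by apply/funext => x; rewrite cos2Dsin2 /phase /= !mul0r addr0 mulr0 cos0.
Qed.

Lemma n2_sin_le k : n2 L (fun x => sin (phase L k x)) <= L.
Proof.
have hc := L2_cos L0 k; have hs := L2_sin L0 k.
apply: le_sqrtP; first exact: ltW.
rewrite n2_sqr; apply: (@le_trans _ _ (integ L (fun x => cos (phase L k x) ^+ 2 + sin (phase L k x) ^+ 2))).
  rewrite integD; [|exact: L2_sqr|exact: L2_sqr].
  by rewrite lerDr; apply: integ_ge0 => // x; exact: sqr_ge0.
rewrite (_ : (fun x => _) = fun x => cos (phase L 0 x)).
  by rewrite (integ_cos_phase L0) eqxx mul1r.
by apply/funext => x; rewrite cos2Dsin2 /phase /= !mul0r addr0 mulr0 cos0.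
Qed.

Lemma fc_le f k : L2 L f -> cn (fc f k) <= 2 * n2 L f / L.
Proof.
move=> hf; apply: le_trans (cn_le_ReIm _) _.
have i2 : 0 <= L ^- 2 by rewrite invr_ge0 sqr_ge0.
rewrite /= normrN !normrM !(ger0_norm i2).
have h1 := integ_CS hf (L2_cos L0 k); have h2 := integ_CS hf (L2_sin L0 k).
have n0 := n2_ge0 L f.
have h1' := le_trans h1 (ler_wpM2l n0 (n2_cos_le k)).
have h2' := le_trans h2 (ler_wpM2l n0 (n2_sin_le k)).
rewrite -mulrDr; apply: le_trans (ler_wpM2l i2 (lerD h1' h2')) _.
by apply: le_of_eq; field; rewrite gt_eqF.
Qed.

Lemma ibl_trig_val f a k : ibl L f -> ibl L (fun x => f x * trig_val a k x).
Proof.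
move=> hf; rewrite (_ : (fun x => _) = fun x => cRe a * (f x * cos (phase L k x)) +
    - cIm a * (f x * sin (phase L k x))); last by apply/funext => x; rewrite /trig_val; ring.
by apply: iblD; apply: iblZ; [exact: ibl_cos|exact: ibl_sin].
Qed.

Lemma integ_trig_valM f a k : ibl L f ->
  integ L (fun x => f x * trig_val a k x) = L ^+ 2 * cRe (a * conjc (fc f k)).
Proof.
move=> hf; rewrite (_ : (fun x => _) = fun x => cRe a * (f x * cos (phase L k x)) +
    - cIm a * (f x * sin (phase L k x))); last by apply/funext => x; rewrite /trig_val; ring.
have hc := ibl_cos k hf; have hs := ibl_sin k hf.
rewrite integD ?integZ //; try exact: iblZ.
by rewrite fcE_cos fcE_sin cReM cReJ cImJ; ring.
Qed.

Lemma integ_trig_rep (I : Type) (r : seq I) (m : I -> Z2) a f g :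
  trig_rep r m a f -> L2 L g ->
  integ L (fun x => f x * g x) = L ^+ 2 * \sum_(i <- r) cRe (a i * conjc (fc g (m i))).
Proof.
move=> /trig_rep_val -> hg.
have hi i : ibl L (fun x => trig_val (a i) (m i) x * g x).
  by apply: L2_ibl => //; exact: L2_trig_val.
rewrite (_ : (fun x => _) = fun x => \sum_(i <- r) trig_val (a i) (m i) x * g x); last first.
  by apply/funext => x; rewrite mulr_suml.
rewrite (integ_sum L0) // mulr_sumr; apply: eq_bigr => i _.
rewrite -integ_trig_valM ?(L2_1_ibl L0) //.
by congr (integ L _); apply/funext => x; rewrite mulrC.
Qed.

Definition pr D g : R * R -> R := fun x => \sum_(k <- D) trig_val (fc g k) k x.

(** Symmetry makes the complex partial sums over [D] real; unlike in [symm], the zero mode is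
    allowed. *)
Definition nsymm D := uniq D /\ forall k, (- k \in D) = (k \in D).

Lemma sum_nsymm (V : nmodType) D (F : Z2 -> V) : nsymm D ->
  \sum_(k <- D) F (- k) = \sum_(k <- D) F k.
Proof.
move=> [uD sD]; apply: (@sum_invol _ _ D (fun k => - k) F uD); first exact: oppr_inj.
by move=> _ /mapP[k kD ->]; rewrite sD.
Qed.

Lemma pr_rep D g : nsymm D -> L2 L g -> trig_rep D id (fc g) (pr D g).
Proof.
move=> sD hg x; apply/eqP; rewrite eq_complex cRe_sum cIm_sum /=; apply/andP; split; apply/eqP.
  by apply: eq_bigr => k _; rewrite trig_valE.
have e : \sum_(k <- D) cIm (fc g k * cexp k x) = - \sum_(k <- D) cIm (fc g k * cexp k x).
  rewrite -{1}(sum_nsymm _ sD) -sumrN; apply: eq_bigr => k _.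
  by rewrite (fcN _ (L2_1_ibl L0 hg)) -cexpJ; case: (fc g k) (cexp k x) => a b [c d] /=; ring.
lra.
Qed.

Lemma big_uniq_pick (V : nmodType) D (a : Z2 -> V) k : uniq D ->
  \sum_(i <- D | i == k) a i = if k \in D then a k else 0.
Proof.
move=> uD; rewrite -big_filter; case: ifP => kD.
  by rewrite filter_pred1_uniq // big_seq1.
by rewrite big_filter big_seq_cond big1 // => i /andP[iD /eqP ie]; rewrite -ie iD in kD.
Qed.

Lemma fc_rep D (a : Z2 -> R[i]) g k : uniq D -> trig_rep D id a g ->
  fc g k = if k \in D then a k else 0.
Proof. by move=> uD h; rewrite (fc_trig_rep _ h) big_uniq_pick. Qed.

Lemma integ_pr D f g : nsymm D -> L2 L f -> L2 L g ->
  integ L (fun x => pr D f x * g x) = L ^+ 2 * \sum_(k <- D) cRe (fc f k * conjc (fc g k)).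
Proof. by move=> sD hf hg; exact: (integ_trig_rep (pr_rep sD hf)). Qed.

Lemma n2_rep D (a : Z2 -> R[i]) f : uniq D -> trig_rep D id a f ->
  n2 L f ^+ 2 = L ^+ 2 * \sum_(k <- D) cn (a k) ^+ 2.
Proof.
move=> uD h; rewrite n2_sqr (_ : (fun x => _) = fun x => f x * f x); last first.
  by apply/funext => x; rewrite expr2.
rewrite (integ_trig_rep h (trig_rep_L2 h)); congr (_ * _).
rewrite big_seq [RHS]big_seq; apply: eq_bigr => k kD.
have e : fc f k = a k by rewrite (fc_rep k uD h) kD.
by rewrite cn_sqr_dot -{3}e.
Qed.

Lemma pr_L2 D g : nsymm D -> L2 L g -> L2 L (pr D g).
Proof. by move=> sD hg; exact: trig_rep_L2 (pr_rep sD hg). Qed.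

Lemma n2_pr D g : nsymm D -> L2 L g ->
  n2 L (pr D g) ^+ 2 = L ^+ 2 * \sum_(k <- D) cn (fc g k) ^+ 2.
Proof. by move=> sD hg; exact: n2_rep sD.1 (pr_rep sD hg). Qed.

(** The pairing of the partial sum with [g] is the square of its own norm; Cauchy-Schwarz
    concludes. *)
Lemma bessel D g : nsymm D -> L2 L g -> n2 L (pr D g) <= n2 L g.
Proof.
move=> sD hg; have hp := pr_L2 sD hg.
have [Z|Z] := eqVneq (n2 L (pr D g)) 0; first by rewrite Z n2_ge0.
have p0 : 0 < n2 L (pr D g) by rewrite lt_def Z n2_ge0.
have h := integ_CS hp hg.
have e : integ L (fun x => pr D g x * g x) = n2 L (pr D g) ^+ 2.
  rewrite n2_pr // integ_pr //; congr (_ * _); apply: eq_bigr => k _.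
  by rewrite cn_sqr_dot.
by rewrite e ger0_norm ?sqr_ge0 // expr2 ler_pM2l in h.
Qed.

End FourierCoefficients.

(** * Divergence-free fields and weak gradients through their coefficients *)

Section VectorFields.
Context {R : realType}.
Variable L : R.
Hypothesis L0 : 0 < L.
Implicit Types (f g h : R * R -> R) (D : seq Z2).

Local Notation kap := (kappa0 L).

Lemma sum_I2 (V : nmodType) (F : 'I_2 -> V) : \sum_(i < 2) F i = F ord0 + F ord_max.
Proof.
by rewrite !big_ord_recl big_ord0 addr0; congr (F _ + F _); exact: val_inj.
Qed.

Lemma I2_cases (i : 'I_2) : i = ord0 \/ i = ord_max.
Proof. by case: i => [[|[|//]] hi]; [left|right]; exact: val_inj. Qed.

Lemma is_derive_line (f : R * R -> R) (x v : R * R) (df : R) :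
  is_derive (0 : R) (1 : R) (fun h : R => f (h *: v + x)) df -> is_derive x v f df.
Proof.
move=> hd; have e : (fun h : R => h^-1 *: ((f \o shift x) (h *: v) - f x)) =
    (fun h : R => h^-1 *: (((fun t : R => f (t *: v + x)) \o shift (0 : R)) (h *: (1 : R)) -
      (fun t : R => f (t *: v + x)) 0)).
  by apply/funext => h; rewrite /= scale0r add0r /GRing.scale /= mulr1 addr0.
split.
  have := @ex_derive _ _ _ _ _ _ _ hd; rewrite /derivable => H.
  by rewrite e.
have := @derive_val _ _ _ _ _ _ _ hd; rewrite /derive => <-.
by rewrite e.
Qed.

Lemma phase_line k (x v : R * R) (h : R) :
  phase L k (h *: v + x) = phase L k x + h * phase L k v.
Proof.
have e1 : (h *: v + x).1 = h * v.1 + x.1 by [].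
have e2 : (h *: v + x).2 = h * v.2 + x.2 by [].
by rewrite /phase e1 e2; ring.
Qed.

Definition kc (k : Z2) (j : 'I_2) : R := (if j == ord0 then k.1 else k.2)%:~R.

Lemma phase_basis k j : phase L k (@basis_vec R j) = kap * kc k j.
Proof.
by rewrite /phase /basis_vec /kc; case: (j == ord0) => /=; rewrite mulr1 mulr0 ?addr0 ?add0r.
Qed.

Lemma trig_val_derive (a : R[i]) k x v :
  is_derive x v (trig_val L a k) (trig_val L ('i%C * (phase L k v)%:C%C * a) k x).
Proof.
apply: is_derive_line.
rewrite (_ : (fun h : R => _) = fun h : R => cRe a * cos (phase L k x + h * phase L k v) -
    cIm a * sin (phase L k x + h * phase L k v)); last first.
  by apply/funext => h; rewrite /trig_val phase_line.
apply: is_derive_eq; rewrite /trig_val /GRing.scale /= !mul0r !addr0.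
by case: a => a1 a2 /=; ring.
Qed.

Lemma is_derive_bigsum (I : Type) (r : seq I) (F : I -> R * R -> R) (dF : I -> R) x v :
  (forall i, is_derive x v (F i) (dF i)) ->
  is_derive x v (fun y => \sum_(i <- r) F i y) (\sum_(i <- r) dF i).
Proof.
move=> hd; elim: r => [|i r IH].
  rewrite big_nil (_ : (fun y => _) = cst 0); first exact: is_derive_cst.
  by apply/funext => s; rewrite big_nil.
rewrite big_cons (_ : (fun y => _) = F i \+ (fun y => \sum_(i <- r) F i y)); last first.
  by apply/funext => s; rewrite big_cons.
exact: is_deriveD.
Qed.

Lemma trig_rep_derive (I : Type) (r : seq I) (m : I -> Z2) (a : I -> R[i]) g v :
  trig_rep L r m a g ->
  trig_rep L r m (fun i => 'i%C * (phase L (m i) v)%:C%C * a i) (fun x => 'D_v g x).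
Proof.
move=> hg x; apply/eqP; rewrite eq_complex cRe_sum cIm_sum; apply/andP; split; apply/eqP => /=.
  rewrite (trig_rep_val hg).
  rewrite (@derive_val _ _ _ _ _ _ _ (is_derive_bigsum r (fun i => trig_val_derive (a i) (m i) x v))).
  by apply: eq_bigr => i _; rewrite trig_valE.
(* The imaginary part of the derived sum must vanish too: it is the derivative of the imaginary part
   of the sum, which is identically zero. *)
have z : (fun y => \sum_(i <- r) trig_val L (- ('i%C * a i)) (m i) y) = cst 0.
  apply/funext => y; have := congr1 (@complex.Im R) (hg y); rewrite /= cIm_sum => hz.
  apply/esym; rewrite [LHS]hz.
  by apply: eq_bigr => i _; rewrite /trig_val; case: (a i) => a1 a2 /=; ring.
have := @derive_val _ _ _ _ _ _ _ (is_derive_bigsum r (fun i => trig_val_derive (- ('i%C * a i)) (m i) x v)).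
rewrite z derive_cst => hz; rewrite [LHS]hz.
by apply: eq_bigr => i _; rewrite /trig_val; case: (a i) => a1 a2 /=; ring.
Qed.

Lemma nsymm_box M : nsymm (box M).
Proof. by split; [exact: uniq_box|move=> k; exact: boxN]. Qed.

Lemma trig_rep_box (I : Type) (r : seq I) (m : I -> Z2) (a : I -> R[i]) g M :
  trig_rep L r m a g -> fc L g 0 = 0 ->
  all (fun k => k \in 0 :: box M) [seq m i | i <- r] ->
  trig_rep L (box M) id (fc L g) g.
Proof.
move=> hg g0 hM x; rewrite hg.
have u0 : uniq (0 :: box M) by rewrite /= mem_box eqxx uniq_box.
transitivity (\sum_(k <- 0 :: box M) fc L g k * cexp L k x); last first.
  by rewrite big_cons g0 mul0r add0r.
under [RHS]eq_bigr do rewrite (fc_trig_rep L0 _ hg) mulr_suml.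
rewrite (exchange_big_dep xpredT) //.
move: (0 :: box M) u0 hM => S u0 hM.
elim: r hM {hg} => [|i r IH]; first by rewrite !big_nil.
move=> /andP[iM rM]; rewrite !big_cons IH //; congr (_ + _).
rewrite (eq_bigl (fun k => k == m i)); last by move=> k; rewrite eq_sym.
by rewrite (big_uniq_pick (fun k => a i * cexp L k x) _ u0) iM.
Qed.

(* The properties of a field of [inH] seen by its Fourier coefficients. *)
Record hcoef (u : vfield R) : Prop := HCoef {
  hc_L2 : forall i, L2 L (u i);
  hc_0 : forall i, fc L (u i) 0 = 0;
  hc_div : forall k, (kc k ord0)%:C%C * fc L (u ord0) k + (kc k ord_max)%:C%C * fc L (u ord_max) k = 0 }.

Lemma trig_poly_rep p : trig_poly L p -> exists (r : seq (bool * Z2)) (m : bool * Z2 -> Z2)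
  (a : 'I_2 -> bool * Z2 -> R[i]), forall i, trig_rep L r m (a i) (p i).
Proof.
move=> [K [a [b hp]]].
(* With h = (a - i b) / 2, a cosine plus sine term is h e^(i kappa0 k.x) plus its conjugate; the
   boolean index tells k from -k. *)
pose half i k : R[i] := Complex (a k i / 2) (- (b k i / 2)).
exists (allpairs pair [:: true; false] K), (fun e => if e.1 then e.2 else - e.2),
  (fun i e => if e.1 then half i e.2 else conjc (half i e.2)) => i x.
have -> : \sum_(e <- allpairs pair [:: true; false] K)
    (if e.1 then half i e.2 else (half i e.2)^*%C) * cexp L (if e.1 then e.2 else - e.2) x =
  \sum_(k <- K) (half i k * cexp L k x + conjc (half i k) * cexp L (- k) x).
  by rewrite /= cats0 big_cat !big_map big_split.
rewrite hp.
apply/eqP; rewrite eq_complex cRe_sum cIm_sum; apply/andP; split; apply/eqP.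
  apply: eq_bigr => k _; rewrite /half /cexp /= phaseN cosN sinN /=.
  by move: (a k i) (b k i) (cos _) (sin _) => a1 b1 c1 s1; field.
transitivity (0 : R) => //; rewrite big1 // => k _; rewrite /half /cexp /= phaseN cosN sinN /=.
by move: (a k i) (b k i) (cos _) (sin _) => a1 b1 c1 s1; field.
Qed.

Lemma sol_trig_poly_rep p : sol_trig_poly L p -> hcoef p /\
  exists M0, forall M, (M0 <= M)%N ->
    (forall i, trig_rep L (box M) id (fc L (p i)) (p i)) /\
    forall i j, trig_rep L (box M) id (fun k => 'i%C * (kap * kc k j)%:C%C * fc L (p i) k) (cgrad p i j).
Proof.
move=> [/trig_poly_rep[r [m [a hr]]] hdiv hint].
have p2 i : L2 L (p i) by exact: trig_rep_L2 (hr i).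
have p0 i : fc L (p i) 0 = 0.
  apply/eqP; rewrite eq_complex /=; apply/andP; split; apply/eqP.
    rewrite (_ : (fun y => _) = p i) ?hint ?mulr0 //; apply/funext => y.
    by rewrite /phase /= !mul0r addr0 mulr0 cos0 mulr1.
  rewrite (_ : (fun y => _) = fun=> 0) ?integ0 ?mulr0 ?oppr0 //; apply/funext => y.
  by rewrite /phase /= !mul0r addr0 mulr0 sin0 mulr0.
have [M0 hM0] := box_cover [seq m i | i <- r].
have hbox i M : (M0 <= M)%N -> trig_rep L (box M) id (fc L (p i)) (p i).
  move=> MM; apply: (trig_rep_box (hr i) (p0 i)); apply/allP => k kr; rewrite inE.
  by have [//|k0] := eqVneq k 0; exact: sub_box MM _ (hM0 k kr k0).
have hgrad i j M : (M0 <= M)%N ->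
    trig_rep L (box M) id (fun k => 'i%C * (kap * kc k j)%:C%C * fc L (p i) k) (cgrad p i j).
  move=> /(hbox i) h x; have := trig_rep_derive (@basis_vec R j) h x; rewrite /cgrad => ->.
  by apply: eq_bigr => k _; rewrite phase_basis.
split; last by exists M0 => M MM; split => [i|i j]; [exact: hbox|exact: hgrad].
split => // k.
have [M hM] := box_cover [:: k].
pose M1 := maxn M0 M.
have h0 := hgrad ord0 ord0 M1 (leq_maxl _ _).
have h1 := hgrad ord_max ord_max M1 (leq_maxl _ _).
have [->|k0] := eqVneq k 0; first by rewrite !p0 !mulr0 addr0.
have kM : k \in box M1.
  by apply: (sub_box (leq_maxr M0 M)); apply: hM => //; rewrite inE.
have hz : trig_rep L (box M1) id (fun k => 'i%C * (kap * kc k ord0)%:C%C * fc L (p ord0) k +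
    'i%C * (kap * kc k ord_max)%:C%C * fc L (p ord_max) k) (fun=> 0).
  move=> x; have e := hdiv x; rewrite sum_I2 in e.
  transitivity ((cgrad p ord0 ord0 x + cgrad p ord_max ord_max x)%:C%C); first by rewrite e.
  rewrite rmorphD /= h0 h1 -big_split /=.
  by apply: eq_bigr => j _; rewrite mulrDl.
have := fc_rep L0 k (uniq_box M1) hz; rewrite kM.
have -> : fc L (fun=> 0) k = 0.
  apply/eqP; rewrite eq_complex /=.
  by do 2 (rewrite (_ : (fun y => _) = fun=> 0) ?integ0 ?mulr0 ?oppr0 ?eqxx //; last by apply/funext => y; rewrite mul0r).
have kp := kap_gt0 L0.
move=> /esym h; apply/eqP; rewrite -(inj_eq (mulfI (_ : 'i%C * kap%:C%C != 0))); last first.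
  by rewrite mulf_neq0 // eq_complex /= ?eqxx ?oner_eq0 ?(gt_eqF kp).
rewrite mulr0 -h; apply/eqP.
by case: (fc L (p ord0) k) (fc L (p ord_max) k) => a1 a2 [b1 b2];
  cring.
Qed.

Lemma normH_sqr (u : vfield R) : normH L u ^+ 2 = n2 L (u ord0) ^+ 2 + n2 L (u ord_max) ^+ 2.
Proof.
have e i : integ L (fun x => u i x * u i x) = n2 L (u i) ^+ 2.
  by rewrite n2_sqr; congr integ; apply/funext => x; rewrite expr2.
by rewrite /normH /ipH sum_I2 !e sqr_sqrtr // addr_ge0 ?sqr_ge0.
Qed.

Lemma n2_le_normH (u : vfield R) i : n2 L (u i) <= normH L u.
Proof.
apply: le_sqrtP; first exact: sqrtr_ge0.
by rewrite normH_sqr; have [->|->] := I2_cases i; rewrite ?lerDl ?lerDr sqr_ge0.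
Qed.

Lemma normH_le (u : vfield R) (a : R) : (forall i, n2 L (u i) <= a) -> normH L u <= 2 * a.
Proof.
move=> h; have a0 : 0 <= a by apply: le_trans (n2_ge0 L (u ord0)) (h _).
apply: le_sqrtP; first by rewrite mulr_ge0.
rewrite normH_sqr; have := h ord0; have := h ord_max.
by have := n2_ge0 L (u ord0); have := n2_ge0 L (u ord_max); nra.
Qed.

Lemma normT_sqr (G : tfield R) : normT L G ^+ 2 = normH L (G ord0) ^+ 2 + normH L (G ord_max) ^+ 2.
Proof.
have e i : ipH L (G i) (G i) = normH L (G i) ^+ 2.
  rewrite sqr_sqrtr // /ipH sumr_ge0 // => j _; apply: integ_ge0 => x.
  by rewrite -expr2 sqr_ge0.
by rewrite /normT /ipT sum_I2 !e sqr_sqrtr // addr_ge0 ?sqr_ge0.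
Qed.

Lemma n2_le_normT (G : tfield R) i j : n2 L (G i j) <= normT L G.
Proof.
apply: le_trans (n2_le_normH _ _) _; apply: le_sqrtP; first exact: sqrtr_ge0.
by rewrite normT_sqr; have [->|->] := I2_cases i; rewrite ?lerDl ?lerDr sqr_ge0.
Qed.

Lemma normT_le (G : tfield R) (a : R) : (forall i j, n2 L (G i j) <= a) -> normT L G <= 4 * a.
Proof.
move=> h; have a0 : 0 <= a by apply: le_trans (n2_ge0 L (G ord0 ord0)) (h _ _).
apply: le_sqrtP; first by rewrite mulr_ge0.
rewrite normT_sqr; have h1 := normH_le (h ord0); have h2 := normH_le (h ord_max).
have : 0 <= normH L (G ord0) by exact: sqrtr_ge0.
have : 0 <= normH L (G ord_max) by exact: sqrtr_ge0.
by nra.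
Qed.

Lemma cn_small (z : R[i]) : (forall e, 0 < e -> cn z <= e) -> z = 0.
Proof.
move=> h; have z0 : cn z <= 0 by apply: le_eps => e e0; rewrite add0r h.
have {}z0 : cn z ^+ 2 = 0 by apply/eqP; rewrite expf_eq0 /= eq_le z0 cn_ge0.
move: z0; rewrite cn_sqr => /eqP; rewrite paddr_eq0 ?sqr_ge0 // !expf_eq0 /= => h'.
by apply/eqP; rewrite eq_complex.
Qed.

Lemma fc_close f g k (e : R) : L2 L f -> L2 L g -> n2 L (fun x => f x - g x) < e ->
  cn (fc L f k - fc L g k) <= 2 * e / L.
Proof.
move=> hf hg he; rewrite -fcB //; apply: le_trans (fc_le L0 k (L2B hf hg)) _.
by rewrite ler_pM2r ?invr_gt0 // ler_pM2l // ltW.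
Qed.

Lemma inH_hcoef u : inH L u -> hcoef u.
Proof.
move=> [u2 happ]; split => // [i|k]; apply: cn_small => e e0.
  have e1 : 0 < e * L / 2 by rewrite divr_gt0 // mulr_gt0.
  have [p hp hup] := happ _ e1; have [[p2 p0 pd] _] := sol_trig_poly_rep hp.
  have := fc_close 0 (u2 i) (p2 i) (le_lt_trans (n2_le_normH (u - p) i) hup).
  rewrite p0 subr0 => /le_trans; apply.
  by apply: le_of_eq; field; rewrite gt_eqF.
set c := `|kc k ord0| + `|kc k ord_max| + 1.
have c0 : 0 < c by rewrite ltr_wpDl // addr_ge0.
have e1 : 0 < e * L / (2 * c) by rewrite divr_gt0 // mulr_gt0.
have [p hp hup] := happ _ e1; have [[p2 p0 pd] _] := sol_trig_poly_rep hp.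
have h i := fc_close k (u2 i) (p2 i) (le_lt_trans (n2_le_normH (u - p) i) hup).
rewrite -[X in cn X]subr0 -(pd k).
rewrite (_ : _ - _ = (kc k ord0)%:C%C * (fc L (u ord0) k - fc L (p ord0) k) +
   (kc k ord_max)%:C%C * (fc L (u ord_max) k - fc L (p ord_max) k)); last by ring.
apply: le_trans (cnD _ _) _; rewrite !cnM !cn_real.
have E : 2 * (e * L / (2 * c)) / L = e / c by field; rewrite !gt_eqF.
have h0 := h ord0; have h1 := h ord_max; rewrite E in h0 h1.
apply: le_trans (lerD (ler_wpM2l (normr_ge0 _) h0) (ler_wpM2l (normr_ge0 _) h1)) _.
rewrite -mulrDl mulrCA ler_piMr ?(ltW e0) // ler_pdivrMr // mul1r /c; lra.
Qed.

Lemma n2D_le f g : L2 L f -> L2 L g -> n2 L (fun x => f x + g x) <= n2 L f + n2 L g.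
Proof.
move=> hf hg; apply: le_sqrtP; first by rewrite addr_ge0 ?n2_ge0.
rewrite n2_sqr (_ : (fun x => _) = fun x => f x ^+ 2 + (2 * (f x * g x) + g x ^+ 2)); last first.
  by apply/funext => x; ring.
have i1 := L2_sqr hf; have i2 := L2_ibl hf hg; have i3 := L2_sqr hg.
rewrite (integD i1 (iblD (iblZ 2 i2) i3)) (integD (iblZ 2 i2) i3) (integZ 2 i2) -!n2_sqr.
have := le_trans (ler_norm _) (integ_CS hf hg); rewrite sqrrD mulr2n; lra.
Qed.

Lemma n2N f : n2 L (fun x => - f x) = n2 L f.
Proof. by rewrite /n2; congr (Num.sqrt (integ _ _)); apply/funext => x; rewrite sqrrN. Qed.

Lemma n2B_le f g : L2 L f -> L2 L g -> n2 L (fun x => f x - g x) <= n2 L f + n2 L g.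
Proof.
move=> hf hg; rewrite -(n2N g); apply: n2D_le => //.
rewrite (_ : (fun x => _) = fun x => (-1) * g x); first exact: L2Z.
by apply/funext => x; ring.
Qed.

Lemma pr_fix D a g : nsymm D -> trig_rep L D id a g -> pr L D g = g.
Proof.
move=> [uD sD] h; rewrite {2}(trig_rep_val h); apply/funext => x; rewrite /pr.
by rewrite big_seq [RHS]big_seq; apply: eq_bigr => k kD; rewrite (fc_rep L0 k uD h) kD.
Qed.

Lemma prB D f g x : L2 L f -> L2 L g -> pr L D (fun y => f y - g y) x = pr L D f x - pr L D g x.
Proof.
move=> hf hg; rewrite /pr -sumrB; apply: eq_bigr => k _; rewrite fcB // /trig_val cReB cImB; ring.
Qed.

(** Partial sums fix [g], so f - pr f = (f - g) - pr (f - g), and Bessel's inequality applies.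
    Approximation by unspecified polynomials thus becomes convergence of the Fourier series. *)
Lemma pr_close D a f g (e : R) : nsymm D -> L2 L f -> trig_rep L D id a g ->
  n2 L (fun x => f x - g x) < e -> n2 L (fun x => f x - pr L D f x) <= 2 * e.
Proof.
move=> sD hf hg he; have g2 := trig_rep_L2 L0 hg.
have fg2 := L2B hf g2.
rewrite (_ : (fun x => _) = fun x => (f x - g x) - pr L D (fun y => f y - g y) x); last first.
  by apply/funext => x; rewrite prB // (pr_fix sD hg); ring.
apply: le_trans (n2B_le fg2 (pr_L2 L0 sD fg2)) _.
have := bessel L0 sD fg2; lra.
Qed.

(* What [H1_limit u G] says in terms of Fourier coefficients. *)
Record vcoef (u : vfield R) (G : tfield R) : Prop := VCoef {
  vc_h : hcoef u;
  vc_L2 : forall i j, L2 L (G i j);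
  vc_grad : forall i j k, fc L (G i j) k = 'i%C * (kap * kc k j)%:C%C * fc L (u i) k;
  vc_lim : forall e, 0 < e -> exists M0, forall M, (M0 <= M)%N ->
    (forall i, n2 L (fun x => u i x - pr L (box M) (u i) x) <= e) /\
    (forall i j, n2 L (fun x => G i j x - pr L (box M) (G i j) x) <= e) }.

Lemma H1_limit_inH u G : H1_limit L u G -> inH L u.
Proof.
by move=> [u2 _ happ]; split => // e e0; have [p [hp h _]] := happ e e0; exists p.
Qed.

Lemma H1_limit_vcoef u G : H1_limit L u G -> vcoef u G.
Proof.
move=> hu; have hc := inH_hcoef (H1_limit_inH hu); case: hu => u2 G2 happ; split => //.
- move=> i j k; apply/eqP; rewrite -subr_eq0; apply/eqP; apply: cn_small => e e0.
  set c := `|kap * kc k j| + 1; have c0 : 0 < c by rewrite ltr_wpDl.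
  have e1 : 0 < e * L / (2 * c) by rewrite divr_gt0 // mulr_gt0.
  have [p [hp h1 h2]] := happ _ e1.
  have [[p2 _ _] [M0 hM0]] := sol_trig_poly_rep hp.
  have [M hM] := box_cover [:: k].
  have [hr hg] := hM0 (maxn M0 M) (leq_maxl _ _).
  have g2 : L2 L (cgrad p i j) by exact: trig_rep_L2 (hg i j).
  have E : 2 * (e * L / (2 * c)) / L = e / c by field; rewrite !gt_eqF.
  have h3 := fc_close k (u2 i) (p2 i) (le_lt_trans (n2_le_normH (u - p) i) h1).
  have h4 := fc_close k (G2 i j) g2 (le_lt_trans (n2_le_normT (G - cgrad p) i j) h2).
  rewrite E in h3 h4.
  have hgk : fc L (cgrad p i j) k = 'i%C * (kap * kc k j)%:C%C * fc L (p i) k.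
    rewrite (fc_rep L0 k (uniq_box _) (hg i j)); case: ifP => // kM.
    have [->|k0] := eqVneq k 0; first by have [[_ -> _] _] := sol_trig_poly_rep hp; rewrite mulr0.
    rewrite (sub_box (leq_maxr M0 M)) // in kM; apply: hM => //; by rewrite inE.
  rewrite (_ : _ - _ = (fc L (G i j) k - fc L (cgrad p i j) k) -
     'i%C * (kap * kc k j)%:C%C * (fc L (u i) k - fc L (p i) k)); last by rewrite hgk; ring.
  apply: le_trans (cnB _ _) _; rewrite !cnM cn_i cn_real mul1r.
  apply: le_trans (lerD h4 (ler_wpM2l (normr_ge0 _) h3)) _.
  by rewrite -{1}[e / c]mul1r -mulrDl mulrCA [1 + _]addrC -/c mulfV ?mulr1 ?gt_eqF.
- move=> e e0; have e1 : 0 < e / 2 by rewrite divr_gt0.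
  have [p [hp h1 h2]] := happ _ e1.
  have [[p2 _ _] [M0 hM0]] := sol_trig_poly_rep hp.
  exists M0 => M /hM0 [hr hg]; have e2 : 2 * (e / 2) = e by field.
  split=> [i|i j]; rewrite -e2.
    exact: pr_close (nsymm_box M) (u2 i) (hr i) (le_lt_trans (n2_le_normH (u - p) i) h1).
  exact: pr_close (nsymm_box M) (G2 i j) (hg i j) (le_lt_trans (n2_le_normT (G - cgrad p) i j) h2).
Qed.

(** Both gradients have the same coefficients, hence the same partial sums, which converge to
    either. *)
Lemma vcoef_grad_unique u G G' i j : vcoef u G -> vcoef u G' ->
  n2 L (fun x => G i j x - G' i j x) = 0.
Proof.
move=> hG hG'; apply/eqP; rewrite eq_le n2_ge0 andbT; apply: le_eps => e e0.
have e1 : 0 < e / 2 by rewrite divr_gt0.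
have [M1 h1] := vc_lim hG e1; have [M2 h2] := vc_lim hG' e1.
have [_ {}h1] := h1 (maxn M1 M2) (leq_maxl _ _).
have [_ {}h2] := h2 (maxn M1 M2) (leq_maxr _ _).
have sB := nsymm_box (maxn M1 M2).
have eP : pr L (box (maxn M1 M2)) (G i j) = pr L (box (maxn M1 M2)) (G' i j).
  by apply/funext => x; apply: eq_bigr => k _; rewrite (vc_grad hG) (vc_grad hG').
rewrite (_ : (fun x => _) = fun x => (G i j x - pr L (box (maxn M1 M2)) (G i j) x) -
   (G' i j x - pr L (box (maxn M1 M2)) (G' i j) x)); last first.
  by apply/funext => x; rewrite eP; ring.
have q1 := vc_L2 hG i j; have q2 := vc_L2 hG' i j.
apply: le_trans (n2B_le (L2B q1 (pr_L2 L0 sB q1)) (L2B q2 (pr_L2 L0 sB q2))) _.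
by rewrite add0r [leRHS](_ : e = e / 2 + e / 2) ?lerD //; field.
Qed.

Lemma inV_vcoef u : inV L u -> vcoef u (grad L u).
Proof.
move=> [G hG]; apply: H1_limit_vcoef; rewrite /grad.
by apply: (@xgetPex _ 0 [set G | H1_limit L u G]); exists G.
Qed.

Lemma H1_limit_poly p : sol_trig_poly L p -> H1_limit L p (cgrad p).
Proof.
move=> hp; have [[p2 _ _] [M0 hM0]] := sol_trig_poly_rep hp.
have [hr hg] := hM0 M0 (leqnn _).
have z (u : vfield R) : normH L (u - u) = 0.
  apply/eqP; rewrite eq_le sqrtr_ge0 andbT -[leRHS](mulr0 2); apply: normH_le => i.
  rewrite (_ : (u - u) i = fun=> 0); last by apply/funext => x; rewrite subrr.
  by rewrite /n2 (_ : (fun x => _) = fun=> 0) ?integ0 ?sqrtr0 //; apply/funext => x; rewrite expr0n.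
split => // [i j|e e0]; first exact: trig_rep_L2 (hg i j).
exists p; split => //; first by rewrite z.
rewrite (_ : normT L _ = 0) //; apply/eqP; rewrite eq_le sqrtr_ge0 andbT -[leRHS](mulr0 4).
apply: normT_le => i j; rewrite (_ : (cgrad p - cgrad p) i j = fun=> 0); last first.
  by apply/funext => x; rewrite subrr.
by rewrite /n2 (_ : (fun x => _) = fun=> 0) ?integ0 ?sqrtr0 //; apply/funext => x; rewrite expr0n.
Qed.

End VectorFields.

(** * From fields to scalar coefficients *)

Section StreamCoefficients.
Context {R : realType}.
Variable L : R.
Hypothesis L0 : 0 < L.
Implicit Types (f g h : R * R -> R) (D : seq Z2).

Local Notation kap := (kappa0 L).

(* The unit vector orthogonal to [k]; at [k = 0] the division gives [0]. *)
Definition evec (k : Z2) (i : 'I_2) : R := (if i == ord0 then - k.2%:~R else k.1%:~R) / nk k.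

Lemma evec_0 i : evec 0 i = 0.
Proof. by rewrite /evec nk0 invr0 mulr0. Qed.

Lemma evecN k i : evec (- k) i = - evec k i.
Proof. by rewrite /evec nkN /= !rmorphN /= -mulNr; case: ifP. Qed.

Lemma kc_evec k : kc k ord0 * evec k ord0 + kc k ord_max * evec k ord_max = 0 :> R.
Proof. by rewrite /kc /evec /=; ring. Qed.

Lemma kc_sqr k : kc k ord0 ^+ 2 + kc k ord_max ^+ 2 = nk k ^+ 2 :> R.
Proof. by rewrite nk_sqr. Qed.

Lemma evec_sqr k : k != 0 -> evec k ord0 ^+ 2 + evec k ord_max ^+ 2 = 1.
Proof.
move=> k0; have n0 := nk_gt0 (R := R) k0.
rewrite /evec /= !expr_div_n -mulrDl sqrrN addrC -nk_sqr mulfV //.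
by rewrite expf_neq0 // gt_eqF.
Qed.

Lemma evec_le1 k i : `|evec k i| <= 1.
Proof.
have [->|k0] := eqVneq k 0; first by rewrite evec_0 normr0.
rewrite -sqrtr_sqr -[leRHS]sqrtr1 ler_sqrt //.
by rewrite -(evec_sqr k0); have [->|->] := I2_cases i; rewrite ?lerDl ?lerDr sqr_ge0.
Qed.

(* The coordinate of the k-th Fourier coefficient of [u] along [evec k]. *)
Definition sc (u : vfield R) k : R[i] := \sum_(i < 2) (evec k i)%:C%C * fc L (u i) k.

Lemma sc_0 u : sc u 0 = 0.
Proof. by rewrite /sc sum_I2 !evec_0 !mul0r addr0. Qed.

Lemma sc_rl (u : vfield R) : (forall i, L2 L (u i)) -> rl (sc u).
Proof.
move=> u2 k; rewrite /sc !sum_I2 !evecN !(fcN L0 _ (L2_1_ibl L0 (u2 _))).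
by case: (fc L (u ord0) k) (fc L (u ord_max) k) => a b [c d]; cring.
Qed.

(** In the plane the vectors orthogonal to k form the line of [evec k]. The relation is real-linear
    and is applied to real and imaginary parts separately. *)
Lemma fc_sc u i k : hcoef L u -> fc L (u i) k = (evec k i)%:C%C * sc u k.
Proof.
move=> hu; have [->|k0] := eqVneq k 0; first by rewrite hc_0 // evec_0 mul0r.
have n0 := nk_gt0 (R := R) k0.
have perp (a b : R) : kc k ord0 * a + kc k ord_max * b = 0 ->
    a = evec k ord0 * (evec k ord0 * a + evec k ord_max * b) /\
    b = evec k ord_max * (evec k ord0 * a + evec k ord_max * b).
  rewrite /evec /kc /= => h; have := nk_sqr (R := R) k.
  move: (k.1%:~R) (k.2%:~R) (nk k) n0 h => x y n n0 h hn.
  have n1 : n != 0 by rewrite gt_eqF.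
  have xa : x * a = - (y * b) by apply/eqP; rewrite -addr_eq0 h.
  split; apply: (mulfI (_ : n ^+ 2 != 0)); rewrite ?expf_neq0 //; apply/eqP; rewrite -subr_eq0.
    rewrite (_ : _ - _ = (n ^+ 2 - y ^+ 2) * a + x * (y * b)); last by field.
    by rewrite hn [X in X == _](_ : _ = x * (x * a + y * b)); [rewrite h mulr0|ring].
  rewrite (_ : _ - _ = (n ^+ 2 - x ^+ 2) * b + y * (x * a)); last by field.
  by rewrite hn [X in X == _](_ : _ = y * (x * a + y * b)); [rewrite h mulr0|ring].
have := hc_div hu k; rewrite /sc sum_I2.
have -> : fc L (u i) k = if i == ord0 then fc L (u ord0) k else fc L (u ord_max) k.
  by have [->|->] := I2_cases i.
move: (fc L (u ord0) k) (fc L (u ord_max) k) => [a1 a2] [b1 b2] hd.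
have h1 := congr1 (@complex.Re R) hd; have h2 := congr1 (@complex.Im R) hd.
rewrite /= in h1 h2.
have [] := perp a1 b1 _; first by rewrite -[RHS]h1; ring.
have [] := perp a2 b2 _; first by rewrite -[RHS]h2; ring.
move=> p1 p2 p3 p4; have [->|->] := I2_cases i; rewrite /=; apply/eqP; rewrite eq_complex /=;
 apply/andP; split; apply/eqP.
- by rewrite [LHS]p3; ring.
- by rewrite [LHS]p1; ring.
- by rewrite [LHS]p4; ring.
- by rewrite [LHS]p2; ring.
Qed.

Lemma sum_cn_fc u k : hcoef L u -> \sum_(i < 2) cn (fc L (u i) k) ^+ 2 = cn (sc u k) ^+ 2.
Proof.
move=> hu; rewrite sum_I2 !(fc_sc _ k hu) !cnM !cn_real !exprMn !real_normK ?num_real // -mulrDl.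
have [->|k0] := eqVneq k 0; first by rewrite sc_0 cn0 expr0n mulr0.
by rewrite evec_sqr // mul1r.
Qed.

Lemma sum_cn_fc_grad u G k : vcoef L u G ->
  \sum_(i < 2) \sum_(j < 2) cn (fc L (G i j) k) ^+ 2 = kap ^+ 2 * (nk k * cn (sc u k)) ^+ 2.
Proof.
move=> hu; have e i : \sum_(j < 2) cn (fc L (G i j) k) ^+ 2 = kap ^+ 2 * nk k ^+ 2 * cn (fc L (u i) k) ^+ 2.
  rewrite sum_I2 !(vc_grad hu) !cnM !cn_real cn_i !mul1r ![(_ * cn _) ^+ 2]exprMn.
  by rewrite !real_normK ?num_real // -kc_sqr; ring.
by rewrite (eq_bigr _ (fun i _ => e i)) -mulr_sumr (sum_cn_fc k (vc_h hu)) -mulrA; congr (_ * _); rewrite exprMn.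
Qed.

Lemma sum_n2_pr D g : nsymm D -> L2 L g -> L ^+ 2 * \sum_(k <- D) cn (fc L g k) ^+ 2 <= n2 L g ^+ 2.
Proof.
move=> sD hg; rewrite -n2_pr //.
have := bessel L0 sD hg; have := n2_ge0 L (pr L D g); have := n2_ge0 L g; nra.
Qed.

Lemma l2b_sc u : hcoef L u -> l2b (fun k => cn (sc u k)) (normH L u / L).
Proof.
move=> hu; apply: (@l2b_box _ _ _ 0); first by rewrite sc_0 cn0.
move=> K _; have L2p : 0 < L ^+ 2 by rewrite exprn_gt0.
rewrite expr_div_n ler_pdivlMr // mulrC normH_sqr.
rewrite (eq_bigr _ (fun k _ => esym (sum_cn_fc k hu))) exchange_big sum_I2 mulrDr.
by apply: lerD; apply: sum_n2_pr; first [exact: nsymm_box|exact: hc_L2].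
Qed.

Lemma l2b_sc_grad u G : vcoef L u G -> l2b (fun k => nk k * cn (sc u k)) (normT L G / (kap * L)).
Proof.
move=> hu; apply: (@l2b_box _ _ _ 0); first by rewrite nk0 mul0r.
move=> K _; have L2p : 0 < L ^+ 2 by rewrite exprn_gt0.
have k2p : 0 < kap ^+ 2 by rewrite exprn_gt0 // kap_gt0.
rewrite expr_div_n (_ : (kap * L) ^+ 2 = L ^+ 2 * kap ^+ 2); last by rewrite exprMn mulrC.
rewrite (ler_pdivlMr _ _ (mulr_gt0 L2p k2p)) mulrC -mulrA.
rewrite normT_sqr !normH_sqr mulr_sumr.
rewrite (eq_bigr _ (fun k _ => esym (sum_cn_fc_grad k hu))) exchange_big sum_I2 mulrDr.
apply: lerD; rewrite exchange_big sum_I2 mulrDr; apply: lerD;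
  by apply: sum_n2_pr; first [exact: nsymm_box|exact: vc_L2 hu _ _].
Qed.

Lemma cRe_conj (z w : R[i]) : cRe (z * conjc w) = cRe z * cRe w + cIm z * cIm w.
Proof. by rewrite cReM cReJ cImJ; ring. Qed.

(** A real part is taken, so the field is real and divergence-free for every [s] and every [D], with
    no symmetry. With a single mode and s = 1 or s = i it is the test field that reads off the real
    or imaginary part of a coordinate. *)
Definition tf D (s : Z2 -> R[i]) : vfield R := fun i x =>
  \sum_(k <- D) trig_val L ((evec k i)%:C%C * s k) k x.

Lemma tf_L2 D s i : L2 L (tf D s i).
Proof. by apply: (L2_sum L0) => k; exact: L2_trig_val. Qed.

Lemma integ_tf D s f i : ibl L f ->
  integ L (fun x => f x * tf D s i x) = L ^+ 2 * \sum_(k <- D) evec k i * cRe (s k * conjc (fc L f k)).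
Proof.
move=> hf; rewrite (_ : (fun x => _) = fun x => \sum_(k <- D) f x * trig_val L ((evec k i)%:C%C * s k) k x).
  rewrite (integ_sum L0) => [|k]; last exact: ibl_trig_val.
  rewrite mulr_sumr; apply: eq_bigr => k _; rewrite integ_trig_valM //; congr (_ * _).
  by rewrite !cRe_conj cReM cImM /=; ring.
by apply/funext => x; rewrite mulr_sumr.
Qed.

Lemma ipH_tf (u : vfield R) D s : (forall i, L2 L (u i)) ->
  ipH L u (tf D s) = L ^+ 2 * \sum_(k <- D) cRe (s k * conjc (sc u k)).
Proof.
move=> u2; rewrite /ipH sum_I2 !integ_tf; try exact: (L2_1_ibl L0).
rewrite -mulrDr -big_split; congr (_ * _); apply: eq_bigr => k _.
by rewrite /sc sum_I2 !cRe_conj !cReD !cImD !cReM !cImM /=; ring.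
Qed.

Lemma tf_trig_poly D s : trig_poly L (tf D s).
Proof.
exists D, (fun k i => cRe ((evec k i)%:C%C * s k)), (fun k i => - cIm ((evec k i)%:C%C * s k)).
by move=> i x; apply: eq_bigr => k _; rewrite /trig_val mulNr.
Qed.

Lemma cgrad_tf D s i j x :
  cgrad (tf D s) i j x = \sum_(k <- D) trig_val L ('i%C * (kap * kc k j)%:C%C * ((evec k i)%:C%C * s k)) k x.
Proof.
rewrite /cgrad (@derive_val _ _ _ _ _ _ _ (is_derive_bigsum D (fun k =>
   trig_val_derive L ((evec k i)%:C%C * s k) k x (@basis_vec R j)))).
by apply: eq_bigr => k _; rewrite phase_basis.
Qed.

Lemma tf_sol D s : sol_trig_poly L (tf D s).
Proof.
split; first exact: tf_trig_poly.
  move=> x; rewrite sum_I2 !cgrad_tf -big_split big1 // => k _ /=.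
  have := kc_evec k; rewrite /trig_val; case: (s k) => a b /= h.
  by rewrite [LHS](_ : _ = kap * (kc k ord0 * evec k ord0 + kc k ord_max * evec k ord_max) *
     - (b * cos (phase L k x) + a * sin (phase L k x))); [rewrite h mulr0 mul0r|ring].
move=> i; rewrite /tf (integ_sum L0) => [|k]; last by apply: (L2_1_ibl L0); exact: L2_trig_val.
rewrite big1 // => k _; rewrite integ_trig_val //.
by have [->|_] := eqVneq k 0; rewrite ?evec_0 ?mul0r ?mulr0 //= mul0r.
Qed.

Lemma tf_inV D s : inV L (tf D s).
Proof. by exists (cgrad (tf D s)); exact: H1_limit_poly (tf_sol D s). Qed.

Lemma tf_vcoef D s : vcoef L (tf D s) (cgrad (tf D s)).
Proof. exact: (H1_limit_vcoef L0 (H1_limit_poly L0 (tf_sol D s))). Qed.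

(** Fields obtained by choice, such as [grad] and [dtH], are determined up to a null set only; this
    exchanges them for explicit ones under an integral. *)
Lemma integ_n2_0 f g h : L2 L f -> L2 L g -> L2 L h -> n2 L (fun x => g x - h x) = 0 ->
  integ L (fun x => f x * g x) = integ L (fun x => f x * h x).
Proof.
move=> hf hg hh h0; apply/eqP; rewrite -subr_eq0 -integB; try exact: L2_ibl.
rewrite (_ : (fun x => _) = fun x => f x * (g x - h x)); last by apply/funext => x; ring.
by have := integ_CS hf (L2B hg hh); rewrite h0 mulr0 normr_le0.
Qed.

Lemma pairA_tf z D s : inV L z ->
  pairA L z (tf D s) = L ^+ 2 * \sum_(k <- D) (kap * nk k) ^+ 2 * cRe (s k * conjc (sc z k)).
Proof.
move=> hz; have vz := inV_vcoef L0 hz; have vw := inV_vcoef L0 (tf_inV D s); have vc := tf_vcoef D s.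
have e i j : integ L (fun x => grad L z i j x * grad L (tf D s) i j x) =
    L ^+ 2 * \sum_(k <- D) (kap * kc k j) ^+ 2 * evec k i ^+ 2 * cRe (s k * conjc (sc z k)).
  rewrite (@integ_n2_0 _ _ (cgrad (tf D s) i j)); last first.
  - exact: (vcoef_grad_unique L0 i j vw vc).
  - exact: vc_L2 vc i j.
  - exact: vc_L2 vw i j.
  - exact: vc_L2 vz i j.
  rewrite (_ : (fun x => _) = fun x => \sum_(k <- D) grad L z i j x *
     trig_val L ('i%C * (kap * kc k j)%:C%C * ((evec k i)%:C%C * s k)) k x); last first.
    by apply/funext => x; rewrite cgrad_tf mulr_sumr.
  have ig : ibl L (grad L z i j) by apply: (L2_1_ibl L0); exact: vc_L2 vz i j.
  rewrite (integ_sum L0) => [|k]; last exact: ibl_trig_val.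
  rewrite mulr_sumr; apply: eq_bigr => k _; rewrite integ_trig_valM // (vc_grad vz) (fc_sc _ _ (vc_h vz)).
  by congr (_ * _); rewrite !cRe_conj; case: (s k) (sc z k) => a b [c d] /=; ring.
rewrite /pairA /ipT /ipH sum_I2 !sum_I2 !e -!mulrDr -!big_split; congr (_ * _); apply: eq_bigr => k _ /=.
have [->|k0] := eqVneq k 0; first by rewrite nk0 !evec_0 !(mulr0, expr0n, mul0r) /= !(mulr0, mul0r, addr0).
rewrite -!mulrDl; congr (_ * _); rewrite [RHS]exprMn -kc_sqr -[RHS]mulr1 -(evec_sqr k0) !exprMn; ring.
Qed.

End StreamCoefficients.

(** * The equation in Fourier coordinates *)

Section NavierStokesCoefficients.
Context {R : realType}.
Variable L : R.
Hypothesis L0 : 0 < L.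
Implicit Types (f g h : R * R -> R) (D : seq Z2) (u : vfield R) (G : tfield R).

Local Notation kap := (kappa0 L).

Lemma integ_le f g : ibl L f -> ibl L g -> (forall x, f x <= g x) -> integ L f <= integ L g.
Proof.
move=> hf hg fg; rewrite -subr_ge0 -integB //; apply: integ_ge0 => x.
by rewrite subr_ge0.
Qed.

Lemma n2_Mbounded f w (C : R) : L2 L f -> meas L w -> (forall x, `|w x| <= C) ->
  n2 L (fun x => f x * w x) <= C * n2 L f.
Proof.
move=> hf mw wC; have C0 : 0 <= C by apply: le_trans (wC (0, 0)).
apply: le_sqrtP; first by rewrite mulr_ge0 ?n2_ge0.
have h := L2_Mbounded hf mw wC.
rewrite exprMn !n2_sqr -(integZ _ (L2_sqr hf)).
apply: integ_le; [exact: L2_sqr|exact: (iblZ _ (L2_sqr hf))|move=> x].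
rewrite exprMn mulrC ler_wpM2r ?sqr_ge0 // -(real_normK (num_real (w x))).
by rewrite lerXn2r ?nnegrE.
Qed.

Lemma fcM_le f g k : L2 L f -> L2 L g ->
  cn (fc L (fun x => f x * g x) k) <= 2 / L ^+ 2 * (n2 L f * n2 L g).
Proof.
move=> hf hg; apply: le_trans (cn_le_ReIm _) _.
have i2 : 0 <= L ^- 2 by rewrite invr_ge0 sqr_ge0.
rewrite /= normrN !normrM !(ger0_norm i2).
have hw w : meas L w -> (forall x, `|w x| <= 1) ->
    `|integ L (fun y => f y * g y * w y)| <= n2 L f * n2 L g.
  move=> mw w1; rewrite (_ : (fun y => _) = fun y => f y * (g y * w y)); last first.
    by apply/funext => y; rewrite mulrA.
  apply: le_trans (integ_CS hf (L2_Mbounded hg mw w1)) _.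
  rewrite ler_wpM2l ?n2_ge0 //; apply: le_trans (n2_Mbounded hg mw w1) _; by rewrite mul1r.
have h1 := hw _ (L2_meas (L2_cos L0 k)) (fun x => cos_max _).
have h2 := hw _ (L2_meas (L2_sin L0 k)) (fun x => sin_max _).
rewrite -mulrDr; apply: le_trans (ler_wpM2l i2 (lerD h1 h2)) _.
by apply: le_of_eq; field; rewrite gt_eqF.
Qed.

(* The coordinate of the k-th Fourier coefficient of (u . grad) u along [evec k],
   for [G] the gradient of [u]. *)
Definition bc u G k : R[i] :=
  \sum_(i < 2) \sum_(j < 2) (evec k i)%:C%C * fc L (fun x => u j x * G i j x) k.

Lemma bc_rl u G : (forall i, L2 L (u i)) -> (forall i j, L2 L (G i j)) -> rl (bc u G).
Proof.
move=> u2 G2 k; rewrite /bc !sum_I2 !evecN.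
have e i j : fc L (fun x => u j x * G i j x) (- k) = conjc (fc L (fun x => u j x * G i j x) k).
  by apply: (fcN L0); exact: L2_ibl.
rewrite !e.
move: (fc L _ k) (fc L _ k) (fc L _ k) (fc L _ k) => [a1 a2] [b1 b2] [c1 c2] [d1 d2]; cring.
Qed.

Lemma pairB_tf u D s : inV L u ->
  pairB L u u (tf L D s) = L ^+ 2 * \sum_(k <- D) cRe (s k * conjc (bc u (grad L u) k)).
Proof.
move=> hu; have vu := inV_vcoef L0 hu.
have ib i j : ibl L (fun x => u j x * grad L u i j x).
  by apply: L2_ibl; [exact: hc_L2 (vc_h vu) j|exact: vc_L2 vu i j].
rewrite /pairB sum_I2 !sum_I2 !(integ_tf L0) // -!mulrDr -!big_split; congr (_ * _).
apply: eq_bigr => k _; rewrite /bc sum_I2 !sum_I2 !cRe_conj !(cReD, cImD, cReM, cImM) /=; ring.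
Qed.

Lemma fc_prM D f g k : nsymm D -> L2 L f -> L2 L g ->
  fc L (fun x => pr L D f x * pr L D g x) k = \sum_(p <- prs D D [:: k]) fc L f p.1 * fc L g p.2.
Proof.
move=> sD hf hg.
have h : trig_rep L (allpairs pair D D) (fun p : Z2 * Z2 => p.1 + p.2) (fun p => fc L f p.1 * fc L g p.2)
    (fun x => pr L D f x * pr L D g x).
  move=> x; rewrite rmorphM /= (pr_rep L0 sD hf) (pr_rep L0 sD hg) mulr_suml big_allpairs.
  apply: eq_bigr => j _; rewrite mulr_sumr; apply: eq_bigr => l _ /=.
  by rewrite mulrACA cexpM.
rewrite (fc_trig_rep L0 k h) /prs big_filter; apply: eq_bigl => p.
by rewrite inE.
Qed.

Lemma evec_q j l : \sum_(i < 2) \sum_(c < 2) evec (j + l) i * (evec j c * (kc l c * evec l i)) = q j l :> R.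
Proof.
rewrite sum_I2 !sum_I2 /evec /kc /= /q /dot /crs !invfM.
by move: (nk j)^-1 (nk l)^-1 (nk (j + l))^-1 => A B C; ring.
Qed.

Lemma Bs_pr u G M k : vcoef L u G ->
  kap%:C%C * Bs (box M) (sc L u) k =
  \sum_(i < 2) \sum_(j < 2) (evec k i)%:C%C * fc L (fun x => pr L (box M) (u j) x * pr L (box M) (G i j) x) k.
Proof.
move=> hu; have hc := vc_h hu.
under [RHS]eq_bigr => i _.
  under eq_bigr => j _.
    rewrite fc_prM; [|exact: nsymm_box|exact: hc_L2 hc j|exact: vc_L2 hu i j].
    rewrite mulr_sumr; over.
  rewrite exchange_big; over.
rewrite exchange_big /Bs mulr_sumr big_seq [RHS]big_seq; apply: eq_bigr => -[j l].
rewrite mem_prs inE => /and3P[_ _ /eqP /= <-].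
rewrite -evec_q; under [RHS]eq_bigr do under eq_bigr do rewrite (vc_grad hu) !(fc_sc _ _ hc).
rewrite sum_I2 !sum_I2; case: (sc L u j) (sc L u l) => a1 a2 [b1 b2]; cring.
Qed.

Lemma sumI2_le (F : 'I_2 -> R) (a : R) : (forall i, F i <= a) -> \sum_(i < 2) F i <= 2 * a.
Proof. by move=> h; rewrite sum_I2; have := h ord0; have := h ord_max; lra. Qed.

(** The truncations of u and of its gradient converge in L^2, so their products converge in L^1, and
    with them each Fourier coefficient. *)
Lemma isB_bc u G k : vcoef L u G -> isB kap (sc L u) k (bc u G k).
Proof.
move=> hu e e0; have hc := vc_h hu.
pose Y := normH L u + normT L G.
have nu i : n2 L (u i) <= Y by rewrite ler_wpDr ?sqrtr_ge0 // n2_le_normH.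
have nG i j : n2 L (G i j) <= Y by rewrite ler_wpDl ?sqrtr_ge0 // n2_le_normT.
have Y0 : 0 <= Y := le_trans (n2_ge0 L (u ord0)) (nu _).
have L2p : 0 < L ^+ 2 by rewrite exprn_gt0.
(* Each of the four products contributes at most 4 d Y / L^2, which is below e / 4. *)
pose d := e * L ^+ 2 / (16 * (Y + 1)).
have d0 : 0 < d by rewrite divr_gt0 ?mulr_gt0 // ltr_wpDl.
have [M0 hM] := vc_lim hu d0; exists M0 => M /hM[hM1 hM2].
have sB := nsymm_box M.
rewrite (Bs_pr M k hu) /bc -sumrB.
under eq_bigr do rewrite -sumrB.
apply: le_trans (cn_sum _ _ _) _.
rewrite [leRHS](_ : e = 2 * (2 * (e / 4))); last by field.
apply: sumI2_le => i; apply: le_trans (cn_sum _ _ _) _; apply: sumI2_le => j.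
have u2 := hc_L2 hc j; have G2 := vc_L2 hu i j.
have pu2 := pr_L2 L0 sB u2; have pG2 := pr_L2 L0 sB G2.
have ib1 := L2_ibl u2 G2; have ib2 := L2_ibl pu2 pG2.
have ib3 := L2_ibl (L2B u2 pu2) G2; have ib4 := L2_ibl pu2 (L2B G2 pG2).
have split_fc : fc L (fun x => u j x * G i j x) k -
    fc L (fun x => pr L (box M) (u j) x * pr L (box M) (G i j) x) k =
  fc L (fun x => (u j x - pr L (box M) (u j) x) * G i j x) k +
  fc L (fun x => pr L (box M) (u j) x * (G i j x - pr L (box M) (G i j) x)) k.
  apply/eqP; rewrite subr_eq addrAC -addrA -!(fcD L0) //; last exact: iblD.
  by apply/eqP; congr (fc L _ k); apply/funext => x; ring.
rewrite -mulrBr split_fc cnM cn_real.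
apply: le_trans (ler_wpM2r (cn_ge0 _) (evec_le1 k i)) _; rewrite mul1r.
apply: le_trans (cnD _ _) _.
apply: le_trans (lerD (fcM_le k (L2B u2 pu2) G2) (fcM_le k pu2 (L2B G2 pG2))) _.
rewrite -mulrDr.
have b1 : n2 L (fun x => u j x - pr L (box M) (u j) x) * n2 L (G i j) <= d * Y.
  by rewrite ler_pM ?n2_ge0.
have b2 : n2 L (pr L (box M) (u j)) * n2 L (fun x => G i j x - pr L (box M) (G i j) x) <= Y * d.
  by rewrite ler_pM ?n2_ge0 // (le_trans (bessel L0 sB u2)).
have c0 : 0 <= 2 / L ^+ 2 by rewrite divr_ge0 // ltW.
apply: le_trans (ler_wpM2l c0 (lerD b1 b2)) _.
rewrite [Y * d]mulrC -mulrDl -mulr2n.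
rewrite [leLHS](_ : _ = e / 4 * (Y / (Y + 1))); last first.
  by rewrite /d; field; rewrite !gt_eqF // ltr_wpDl.
by rewrite ler_piMr ?divr_ge0 ?(ltW e0) // ler_pdivrMr ?ltr_wpDl // mul1r lerDl.
Qed.

Lemma scD (u v : vfield R) k : (forall i, L2 L (u i)) -> (forall i, L2 L (v i)) ->
  sc L (fun i x => u i x + v i x) k = sc L u k + sc L v k.
Proof. by move=> hu hv; rewrite /sc -big_split; apply: eq_bigr => i _; rewrite (fcD L0 _ (L2_1_ibl L0 (hu i)) (L2_1_ibl L0 (hv i))) mulrDr. Qed.

Lemma scB (u v : vfield R) k : (forall i, L2 L (u i)) -> (forall i, L2 L (v i)) ->
  sc L (fun i x => u i x - v i x) k = sc L u k - sc L v k.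
Proof. by move=> hu hv; rewrite /sc -sumrB; apply: eq_bigr => i _; rewrite fcB // mulrBr. Qed.

Lemma scZ (u : vfield R) (c : R) k : (forall i, L2 L (u i)) ->
  sc L (fun i x => c * u i x) k = c%:C%C * sc L u k.
Proof.
by move=> hu; rewrite /sc mulr_sumr; apply: eq_bigr => i _; rewrite fcZ // mulrCA.
Qed.

Lemma ipH_mode (u : vfield R) k : (forall i, L2 L (u i)) ->
  cRe (sc L u k) = L ^- 2 * ipH L u (tf L [:: k] (fun=> 1)) /\
  cIm (sc L u k) = L ^- 2 * ipH L u (tf L [:: k] (fun=> 'i%C)).
Proof.
move=> u2; rewrite !(ipH_tf L0) // !big_seq1 !cRe_conj /=.
by split; rewrite mulrA mulVf ?(L2n0 L0) //; ring.
Qed.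

(** The weak equation is tested with the one-mode fields of coordinates 1 and i, which are
    divergence-free polynomials. *)
Lemma nse_cder (nu : R) (F u : R -> vfield R) t k :
  (forall t, inV L (u t)) -> (forall t i, L2 L (F t i)) -> nse_solution L nu F u ->
  cder (fun s => sc L (u s) k) t
    (- ((nu * kap ^+ 2 * nk k ^+ 2)%:C%C * sc L (u t) k) +
      (sc L (F t) k - bc (u t) (grad L (u t)) k)).
Proof.
move=> hu hF hs.
have u2 s i : L2 L (u s i) by exact: hc_L2 (vc_h (inV_vcoef L0 (hu s))) i.
have key (c : R[i]) : is_derive t (1 : R) (fun s => L ^- 2 * ipH L (u s) (tf L [:: k] (fun=> c)))
    (cRe (c * conjc (- ((nu * kap ^+ 2 * nk k ^+ 2)%:C%C * sc L (u t) k) +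
      (sc L (F t) k - bc (u t) (grad L (u t)) k)))).
  have := hs t _ (tf_inV L0 [:: k] (fun=> c)).
  rewrite (ipH_tf L0) // (pairA_tf L0) // pairB_tf // !big_seq1 => hd.
  apply: is_derive_eq; rewrite /GRing.scale /=.
  transitivity (cRe (c * conjc (sc L (F t) k)) - nu * ((kap * nk k) ^+ 2 * cRe (c * conjc (sc L (u t) k))) -
     cRe (c * conjc (bc (u t) (grad L (u t)) k))); first by field; rewrite gt_eqF.
  by rewrite !cRe_conj !(cReD, cImD, cReN, cImN, cReM, cImM) /=; ring.
split.
  rewrite (_ : (fun s => _) = fun s => L ^- 2 * ipH L (u s) (tf L [:: k] (fun=> 1))); last first.
    by apply/funext => s; rewrite (ipH_mode k (u2 s)).1.
  by apply: is_derive_eq (key 1) _; rewrite cRe_conj /=; ring.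
rewrite (_ : (fun s => _) = fun s => L ^- 2 * ipH L (u s) (tf L [:: k] (fun=> 'i%C))); last first.
  by apply/funext => s; rewrite (ipH_mode k (u2 s)).2.
by apply: is_derive_eq (key 'i%C) _; rewrite cRe_conj /=; ring.
Qed.

Lemma nse_traj (nu C : R) (F u : R -> vfield R) :
  (forall t, inV L (u t)) -> (forall t, normV L (u t) <= C) ->
  (forall t i, L2 L (F t i)) -> nse_solution L nu F u ->
  traj kap nu (fun t => sc L (u t)) (fun t => bc (u t) (grad L (u t))) (fun t => sc L (F t)).
Proof.
move=> hu hC hF hs; have vu t := inV_vcoef L0 (hu t).
split => [t|t| |t k k0|t k k0].
- by apply: (sc_rl L0) => i; exact: hc_L2 (vc_h (vu t)) i.
- exact: sc_0.
- have kL : 0 < kap * L by rewrite mulr_gt0 ?kap_gt0.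
  have C0 : 0 <= C := le_trans (sqrtr_ge0 _) (hC 0).
  exists (C / (kap * L)) => [|t]; first by rewrite divr_ge0 // ltW.
  apply: l2b_leX (l2b_sc_grad L0 (vu t)); first by rewrite divr_ge0 ?sqrtr_ge0 // ltW.
  by rewrite ler_pM2r ?invr_gt0 //; exact: hC.
- exact: isB_bc.
- exact: nse_cder.
Qed.

End NavierStokesCoefficients.

(** * Trigonometric fields, modal projection, inverse Stokes operator, time derivative *)

Section TrigonometricFields.
Context {R : realType}.
Variable L : R.
Hypothesis L0 : 0 < L.
Implicit Types (f g : R * R -> R) (D : seq Z2) (u : vfield R) (G : tfield R) (s : Z2 -> R[i]).

Local Notation kap := (kappa0 L).

Lemma tf_rep D s i : symm D -> rl s -> trig_rep L D id (fun k => (evec k i)%:C%C * s k) (tf L D s i).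
Proof.
move=> [uD D0 sD] rs x; apply/eqP; rewrite eq_complex cRe_sum cIm_sum /=; apply/andP; split; apply/eqP.
  by apply: eq_bigr => k _; rewrite trig_valE.
have e : \sum_(k <- D) cIm ((evec k i)%:C%C * s k * cexp L k x) =
    - \sum_(k <- D) cIm ((evec k i)%:C%C * s k * cexp L k x).
  rewrite -{1}(sum_nsymm _ (conj uD sD)) -sumrN; apply: eq_bigr => k _.
  by rewrite evecN rs -cexpJ; case: (s k) (cexp L k x) => a b [c d] /=; ring.
lra.
Qed.

Lemma fc_tf D s i k : symm D -> rl s -> fc L (tf L D s i) k = if k \in D then (evec k i)%:C%C * s k else 0.
Proof. by move=> sD rs; rewrite (fc_rep L0 k _ (tf_rep i sD rs)); case: sD. Qed.

Lemma sc_tf D s k : symm D -> rl s -> sc L (tf L D s) k = if k \in D then s k else 0.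
Proof.
move=> sD rs; rewrite /sc sum_I2 !fc_tf //; case: ifP => [kD|_]; last by rewrite !mulr0 addr0.
have k0 : k != 0 by apply: contraTneq kD => ->; case: sD.
have := evec_sqr (R := R) k0; case: (s k) => a b h.
apply/eqP; rewrite eq_complex /=; apply/andP; split; apply/eqP.
  by rewrite -[RHS]mul1r -h; ring.
by rewrite -[RHS]mul1r -h; ring.
Qed.

Lemma normH_tf D s : symm D -> rl s -> normH L (tf L D s) ^+ 2 = L ^+ 2 * \sum_(k <- D) cn (s k) ^+ 2.
Proof.
move=> sD rs; have [uD D0 _] := sD.
rewrite normH_sqr !(n2_rep L0 uD (tf_rep _ sD rs)) -mulrDr -big_split; congr (_ * _).
rewrite big_seq [RHS]big_seq; apply: eq_bigr => k kD /=.
have k0 : k != 0 by apply: contraTneq kD => ->.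
by rewrite !cnM !cn_real !exprMn !real_normK ?num_real // -mulrDl evec_sqr // mul1r.
Qed.

Lemma n2_trig_val a k : n2 L (trig_val L a k) <= 2 * L * cn a.
Proof.
have c2 := L2_cos L0 k; have s2 := L2_sin L0 k.
have nZ (c : R) f : L2 L f -> n2 L (fun x => c * f x) = `|c| * n2 L f.
  move=> hf; rewrite /n2 -[`|c|]sqrtr_sqr -sqrtrM ?sqr_ge0 // -(integZ _ (L2_sqr hf)).
  by congr (Num.sqrt (integ L _)); apply/funext => x; rewrite exprMn.
apply: le_trans (n2B_le (L2Z _ c2) (L2Z _ s2)) _; rewrite !nZ //.
have h1 := ler_pM (normr_ge0 _) (n2_ge0 L _) (cRe_le a) (n2_cos_le L0 k).
have h2 := ler_pM (normr_ge0 _) (n2_ge0 L _) (cIm_le a) (n2_sin_le L0 k).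
by apply: le_trans (lerD h1 h2) _; rewrite (_ : _ + _ = 2 * L * cn a) //; ring.
Qed.

Lemma normH_tf_le D s : normH L (tf L D s) <= 4 * L * \sum_(k <- D) cn (s k).
Proof.
rewrite (_ : 4 * L * _ = 2 * (\sum_(k <- D) 2 * L * cn (s k))); last by rewrite -mulr_sumr; ring.
apply: normH_le => i; rewrite /tf; elim: D => [|k D IH].
  rewrite big_nil /n2 (_ : (fun x => _) = fun=> 0) ?integ0 ?sqrtr0 //.
  by apply/funext => x; rewrite big_nil expr0n.
rewrite big_cons (_ : (fun x => _) = fun x => trig_val L ((evec k i)%:C%C * s k) k x +
   \sum_(j <- D) trig_val L ((evec j i)%:C%C * s j) j x); last by apply/funext => x; rewrite big_cons.
apply: le_trans (n2D_le (L2_trig_val L0 _ _) (tf_L2 L0 D s i)) _; apply: lerD => //.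
apply: le_trans (n2_trig_val _ _) _; rewrite cnM cn_real ler_wpM2l ?mulr_ge0 ?(ltW L0) //.
by rewrite ler_piMl ?cn_ge0 // evec_le1.
Qed.

Lemma inH_lim u (e : R) : inH L u -> 0 < e -> exists M0, forall M, (M0 <= M)%N ->
  forall i, n2 L (fun x => u i x - pr L (box M) (u i) x) <= e.
Proof.
move=> [u2 happ] e0; have e1 : 0 < e / 2 by rewrite divr_gt0.
have [p hp h1] := happ _ e1; have [_ [M0 hM0]] := sol_trig_poly_rep L0 hp.
exists M0 => M /hM0 [hr _] i; rewrite (_ : e = 2 * (e / 2)); last by field.
have h2 : n2 L (fun x => u i x - p i x) < e / 2 := le_lt_trans (n2_le_normH L (u - p) i) h1.
exact: (pr_close L0 (nsymm_box M) (u2 i) (hr i) h2).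
Qed.

Lemma n2_le_coef f (X : R) : 0 <= X -> L2 L f ->
  (forall e, 0 < e -> exists M, n2 L (fun x => f x - pr L (box M) f x) <= e) ->
  (forall M, \sum_(k <- box M) cn (fc L f k) ^+ 2 <= X ^+ 2) -> n2 L f <= L * X.
Proof.
move=> X0 hf hlim hX; apply: le_eps => e e0; have [M hM] := hlim e e0.
have p2 := pr_L2 L0 (nsymm_box M) hf.
rewrite (_ : f = fun x => pr L (box M) f x + (f x - pr L (box M) f x)); last first.
  by apply/funext => x; ring.
apply: le_trans (n2D_le p2 (L2B hf p2)) _; apply: lerD => //.
apply: le_sqrtP; first by rewrite mulr_ge0 // ltW.
by rewrite (n2_pr L0 (nsymm_box M) hf) exprMn ler_wpM2l ?sqr_ge0.
Qed.

(** A converse of [l2b_sc] with a crude constant: it serves to show that the suprema in [Cb_norm]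
    are taken over bounded sets. *)
Lemma normH_le_l2b u (X : R) : 0 <= X -> inH L u -> l2b (fun k => cn (sc L u k)) X -> normH L u <= 2 * (L * X).
Proof.
move=> X0 hu hX; have hc := inH_hcoef L0 hu; apply: normH_le => i.
apply: n2_le_coef => // [|e e0|M]; first exact: hc_L2.
  by have [M hM] := inH_lim hu e0; exists M; exact: hM.
apply: le_trans (hX _ (uniq_box M)); apply: ler_sum => k _.
by rewrite (fc_sc _ _ hc) cnM cn_real lerXn2r ?nnegrE ?mulr_ge0 ?cn_ge0 // ler_piMl ?cn_ge0 ?evec_le1.
Qed.

Lemma kc_le k j : `|kc k j| <= nk k :> R.
Proof.
rewrite -sqrtr_sqr -[leRHS]ger0_norm ?nk_ge0 // -[leRHS]sqrtr_sqr ler_sqrt ?sqr_ge0 // -kc_sqr.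
by have [->|->] := I2_cases j; rewrite ?lerDl ?lerDr sqr_ge0.
Qed.

Lemma normT_le_l2b u G (X : R) : 0 <= X -> vcoef L u G -> l2b (fun k => nk k * cn (sc L u k)) X ->
  normT L G <= 4 * (L * (kap * X)).
Proof.
have kp := kap_gt0 L0.
move=> X0 hu hX; have hc := vc_h hu; apply: normT_le => i j.
apply: n2_le_coef => [| |e e0|M]; first by rewrite mulr_ge0 // ltW.
- exact: vc_L2 hu i j.
- by have [M hM] := vc_lim hu e0; exists M; exact: (hM _ (leqnn _)).2.
rewrite [(kap * X) ^+ 2]exprMn.
apply: le_trans (_ : kap ^+ 2 * \sum_(k <- box M) (nk k * cn (sc L u k)) ^+ 2 <= _); last first.
  by rewrite ler_wpM2l ?sqr_ge0 //; exact: hX _ (uniq_box M).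
rewrite mulr_sumr; apply: ler_sum => k _.
rewrite (vc_grad hu) (fc_sc _ _ hc) !cnM !cn_real cn_i mul1r -[leRHS]exprMn.
rewrite ler_sqr ?nnegrE; last 2 first.
- by rewrite !mulr_ge0 // cn_ge0.
- by rewrite (mulr_ge0 (ltW kp)) // mulr_ge0 ?nk_ge0 ?cn_ge0.
rewrite normrM (gtr0_norm kp) -mulrA; apply: (ler_wpM2l (ltW kp)).
by rewrite ler_pM ?mulr_ge0 ?cn_ge0 // ?kc_le // ler_piMl ?cn_ge0 ?evec_le1.
Qed.

Lemma low_box (N : R) : exists M0, forall k, k != 0 -> nk k < N -> k \in box M0.
Proof.
have [N0|N0] := leP 0 N; last first.
  by exists 0 => k _ h; have := nk_ge0 (R := R) k; lra.
exists (Num.Def.archi_bound N) => k k0 kN; rewrite mem_box k0 /=.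
have hM := archi_boundP N0.
have key (a : int) : `|a%:~R| <= nk k :> R -> `|a| <= (Num.Def.archi_bound N)%:Z.
  move=> h; rewrite -(ler_int R) intr_norm; lra.
by apply/andP; split; apply: key; [exact: (kc_le k ord0)|exact: (kc_le k ord_max)].
Qed.

Lemma projN_tf (N : R) : exists K0, forall K, (K0 <= K)%N -> forall u, hcoef L u ->
  projN L N u = tf L (box K) (fun k => (low N k)%:C%C * sc L u k).
Proof.
have [K0 hK0] := low_box N; exists K0 => K KK u hu; apply/funext => i; apply/funext => x.
(* The index set of [projN] contains the zero mode when N is positive; its term vanishes because the
   mean of u is zero. *)
pose r := [seq k <- 0 :: box K | nk k < N :> R].
have ur : uniq r by rewrite filter_uniq //= mem_box eqxx uniq_box.
rewrite /projN (_ : [set k : Z2 | mode_norm k < N] = [set` r]); last first.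
  apply/seteqP; split => k /=; rewrite mem_filter; last by case/andP.
  move=> kN; rewrite kN inE; have [//|k0] := eqVneq k 0.
  exact: (sub_box KK) (hK0 k k0 kN).
rewrite -fsbig_seq // big_filter big_cons.
have -> (b : bool) (y z : R) : y = 0 -> (if b then y + z else z) = z by move=> ->; case: b; rewrite ?add0r.
  rewrite big_mkcond /tf; apply: eq_bigr => k _.
  rewrite (_ : _ * (_ * _) = (low N k)%:C%C * fc L (u i) k); last by rewrite (fc_sc _ _ hu); ring.
  rewrite /trig_val /low; case: ifP => _ /=; ring.
have := hc_0 hu i; rewrite /fc => /eqP; rewrite eq_complex /= => /andP[/eqP -> /eqP h].
by rewrite -[L ^- 2 * integ L (fun y => u i y * sin _)]opprK h; ring.
Qed.

Lemma sc_projN (N : R) u k : hcoef L u -> sc L (projN L N u) k = (low N k)%:C%C * sc L u k.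
Proof.
move=> hu; have [K0 hK] := projN_tf N; have [M hM] := low_box N.
pose K := maxn K0 M; rewrite (hK K (leq_maxl _ _) u hu) sc_tf; last 2 first.
- exact: symm_box.
- by apply: rl_scale; [apply: (sc_rl L0); exact: hc_L2|move=> j; rewrite /low nkN].
case: ifP => // kK; rewrite /low; case: ltP => [kN|_]; last by rewrite mul0r.
have [->|k0] := eqVneq k 0; first by rewrite sc_0 mulr0.
by rewrite (sub_box (leq_maxr K0 M)) // in kK; exact: hM.
Qed.

Lemma projN_inV (N : R) u : hcoef L u -> inV L (projN L N u).
Proof. by move=> hu; have [K0 /(_ _ (leqnn _) u hu) ->] := projN_tf N; exact: tf_inV. Qed.

Lemma normH_projN (N : R) : exists K0, forall K, (K0 <= K)%N -> forall u, hcoef L u ->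
  normH L (projN L N u) ^+ 2 = L ^+ 2 * \sum_(k <- box K) (low N k * cn (sc L u k)) ^+ 2.
Proof.
have [K0 hK0] := projN_tf N; exists K0 => K KK u hu; rewrite (hK0 K KK u hu) normH_tf.
- by congr (_ * _); apply: eq_bigr => k _; rewrite cnM cn_real ger0_norm ?low_ge0.
- exact: symm_box.
- by apply: rl_scale; [apply: (sc_rl L0); exact: hc_L2|move=> j; rewrite /low nkN].
Qed.

Lemma inV_inH u : inV L u -> inH L u.
Proof. by move=> [G hG]; exact: H1_limit_inH hG. Qed.

Lemma inV_hcoef u : inV L u -> hcoef L u.
Proof. by move=> /inV_inH; exact: inH_hcoef. Qed.

Lemma fc_n2_0 f g k : L2 L f -> L2 L g -> n2 L (fun x => f x - g x) = 0 -> fc L f k = fc L g k.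
Proof.
move=> hf hg h0; apply/eqP; rewrite -subr_eq0 -fcB //; apply/eqP; apply: cn_small => e e0.
by apply: le_trans (fc_le L0 k (L2B hf hg)) _; rewrite h0 mulr0 mul0r ltW.
Qed.

(** Equality with a trigonometric field is asked up to a null set, since [g] may be a time
    derivative obtained by choice. Dividing each coordinate by (kap |k|)^2 gives a solution;
    whichever solution [invA] selects, one-mode tests determine its coordinates. *)
Lemma invA_tf (g : vfield R) D s : (forall i, L2 L (g i)) -> (forall i, n2 L (fun x => g i x - tf L D s i x) = 0) ->
  symm D ->
  inV L (invA L g) /\ forall k, ((kap * nk k) ^+ 2)%:C%C * sc L (invA L g) k = sc L g k.
Proof.
move=> g2 gs [uD D0 _].
have t2 i : L2 L (tf L D s i) by exact: tf_L2.
have [hz hzw] : inV L (invA L g) /\ forall w, inV L w -> pairA L (invA L g) w = ipH L g w.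
  rewrite /invA; apply: (@xgetPex _ 0 [set z | inV L z /\ forall w, inV L w -> pairA L z w = ipH L g w]).
  exists (tf L D (fun k => (((kap * nk k) ^+ 2)^-1)%:C%C * s k)); split; first exact: tf_inV.
  move=> w hw; have wc := inV_hcoef hw.
  have -> : ipH L g w = ipH L w (tf L D s).
    rewrite /ipH; apply: eq_bigr => i _.
    rewrite -(integ_n2_0 (hc_L2 wc i) (g2 i) (t2 i) (gs i)).
    by congr (integ L _); apply/funext => x; exact: mulrC.
  have -> z : pairA L z w = pairA L w z.
    rewrite /pairA /ipT /ipH; apply: eq_bigr => i _; apply: eq_bigr => j _.
    by congr integ; apply/funext => x; rewrite (mulrC (grad L z i j x)).
  rewrite (pairA_tf L0) // (ipH_tf L0); last exact: hc_L2 wc.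
  congr (_ * _); rewrite big_seq [RHS]big_seq; apply: eq_bigr => k kD.
  have k0 : k != 0 by apply: contraTneq kD => ->.
  rewrite -mulrA cReMl mulrA mulfV ?mul1r // expf_neq0 // mulf_neq0 // gt_eqF ?nk_gt0 //.
  exact: kap_gt0.
split => // k.
have h c : (kap * nk k) ^+ 2 * cRe (c * conjc (sc L (invA L g) k)) = cRe (c * conjc (sc L g k)).
  have := hzw _ (tf_inV L0 [:: k] (fun=> c)).
  by rewrite (pairA_tf L0) // (ipH_tf L0) // !big_seq1 => /(mulfI (L2n0 L0)).
have h1 := h 1; have h2 := h 'i%C; rewrite !cRe_conj /= in h1 h2.
by apply/eqP; rewrite eq_complex cReM cImM /=; apply/andP; split; apply/eqP; lra.
Qed.

Lemma cder_quotient (z : R -> R[i]) t dz : cder z t dz ->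
  cn ((h^-1)%:C%C * (z (t + h) - z t) - dz) @[h --> 0^'] --> (0 : R).
Proof.
have real (f : R -> R) df : is_derive t (1 : R) f df ->
    `|h^-1 * (f (t + h) - f t) - df| @[h --> 0^'] --> (0 : R).
  move=> hf; have h1 := @ex_derive _ _ _ _ _ _ _ hf.
  have h2 := @derive_val _ _ _ _ _ _ _ hf.
  have : h^-1 *: ((f \o shift t) (h *: (1 : R)) - f t) @[h --> 0^'] --> df.
    by rewrite -h2; exact: h1.
  move=> /cvgrPdist_le hc; apply/cvgrPdist_le => e e0.
  have := hc e e0; apply: filterS => h /=.
  have -> : h^-1 * (f (t + h) - f t) = h^-1 *: (f (h *: (1 : R) + t) - f t).
    by rewrite (_ : h *: (1 : R) = h) ?[t + h]addrC // -[LHS]/(h * 1) mulr1.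
  by rewrite sub0r normrN normr_id distrC.
move=> [/real h1 /real h2]; apply: (@squeeze_cvgr _ _ _ _ (fun=> 0) (fun h : R =>
  `|h^-1 * (cRe (z (t + h)) - cRe (z t)) - cRe dz| + `|h^-1 * (cIm (z (t + h)) - cIm (z t)) - cIm dz|)
  (fun h : R => cn ((h^-1)%:C%C * (z (t + h) - z t) - dz))).
- apply: nearW => h; rewrite cn_ge0 /=; apply: le_trans (cn_le_ReIm _) _.
  by rewrite cReB cImB cReM cImM cReB cImB /= !mul0r subr0 addr0.
- exact: cvg_cst.
- have h3 := cvgD h1 h2; rewrite (addr0 (0 : R)) in h3; exact: h3.
Qed.

Lemma cvg_sum0 (T : Type) (F : set_system T) {FF : Filter F} (I : Type) (r : seq I) (a : I -> T -> R) :
  (forall i, a i h @[h --> F] --> (0 : R)) -> (fun h => \sum_(i <- r) a i h) @ F --> (0 : R).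
Proof.
move=> ha; elim: r => [|i r IH].
  rewrite (_ : (fun h => _) = fun=> 0); first exact: cvg_cst.
  by apply/funext => h; rewrite big_nil.
rewrite (_ : (fun h => _) = fun h => a i h + \sum_(j <- r) a j h); last by apply/funext => h; rewrite big_cons.
have h3 := cvgD (ha i) IH; rewrite (addr0 (0 : R)) in h3; exact: h3.
Qed.

(** With finitely many modes, differentiability of the coordinates gives a limit in H. The limit
    selected by [dtH] agrees with it: both are close to the difference quotient at one common small
    h. *)
Lemma dtH_tf D (S : R -> Z2 -> R[i]) (dS : Z2 -> R[i]) t :
  (forall k, cder (fun r => S r k) t (dS k)) ->
  inH L (dtH L (fun r => tf L D (S r)) t) /\
  forall i, n2 L (fun x => dtH L (fun r => tf L D (S r)) t i x - tf L D dS i x) = 0.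
Proof.
move=> hS; set phi := fun r => tf L D (S r).
pose Q (h : R) : vfield R := fun i x => h^-1 * (phi (t + h) i x - phi t i x).
have lim0 : normH L (fun i x => Q h i x - tf L D dS i x) @[h --> 0^'] --> (0 : R).
  apply: (@squeeze_cvgr _ _ _ _ (fun=> 0) (fun h : R => 4 * L *
    \sum_(k <- D) cn ((h^-1)%:C%C * (S (t + h) k - S t k) - dS k))
    (fun h : R => normH L (fun i x => Q h i x - tf L D dS i x))).
  - apply: nearW => h; rewrite sqrtr_ge0 /=.
    apply: le_trans (normH_tf_le D (fun k => (h^-1)%:C%C * (S (t + h) k - S t k) - dS k)).
    apply: le_of_eq; congr (normH L _).
    apply/funext => i; apply/funext => x; rewrite /Q /phi /tf -sumrB mulr_sumr -sumrB.
    apply: eq_bigr => k _; rewrite /trig_val !(cReM, cImM, cReB, cImB) /=; ring.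
  - exact: cvg_cst.
  - have hs := cvg_sum0 D (fun k => cder_quotient (hS k)).
    have h3 := cvgM (cvg_cst (4 * L)) (hs _); rewrite (mulr0 (4 * L)) in h3; exact: h3.
have [zH zl] : inH L (dtH L phi t) /\ normH L (fun i x => Q h i x - dtH L phi t i x) @[h --> 0^'] --> (0 : R).
  rewrite /dtH; apply: (@xgetPex _ 0 [set z | inH L z /\
    normH L (fun i x => Q h i x - z i x) @[h --> 0^'] --> (0 : R)]).
  by exists (tf L D dS); split; [exact: inV_inH (tf_inV L0 D dS)|exact: lim0].
split=> // i; apply/eqP; rewrite eq_le n2_ge0 andbT; apply: le_eps => e e0; rewrite add0r.
have e1 : 0 < e / 2 by rewrite divr_gt0.
have small (z : vfield R) : normH L (fun i x => Q h i x - z i x) @[h --> 0^'] --> (0 : R) ->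
    \forall h \near 0^', normH L (fun i x => Q h i x - z i x) <= e / 2.
  move=> /cvgrPdist_le /(_ _ e1); apply: filterS => h.
  by rewrite sub0r normrN ger0_norm ?sqrtr_ge0.
have [h [h1 h2]] := @filter_ex _ _ (Proper_dnbhs_numFieldType (0 : R)) _ (filterI (small _ zl) (small _ lim0)).
have Q2 : L2 L (Q h i) by apply: L2Z; apply: L2B; exact: tf_L2.
have z2 := hc_L2 (inH_hcoef L0 zH) i; have t2 := tf_L2 L0 D dS i.
rewrite (_ : (fun x => _) = fun x => (Q h i x - tf L D dS i x) - (Q h i x - dtH L phi t i x)); last first.
  by apply/funext => x; ring.
apply: le_trans (n2B_le (L2B Q2 t2) (L2B Q2 z2)) _.
rewrite (_ : e = e / 2 + e / 2); last by field.
apply: lerD.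
  exact: le_trans (n2_le_normH L (fun i x => Q h i x - tf L D dS i x) i) h2.
exact: le_trans (n2_le_normH L (fun i x => Q h i x - dtH L phi t i x) i) h1.
Qed.

(** The size of [C] is irrelevant to the conclusion, but some bound is required: the [sup] of an
    unbounded set is 0 by convention. *)
Lemma le_Cb_norm (normX : vfield R -> R) (phi : R -> vfield R) (C : R) t :
  (forall t, normX (phi t) <= C) -> normX (phi t) <= Cb_norm normX phi.
Proof.
move=> hC; apply: ub_le_sup; last by exists t.
by exists C => _ [r _ <-].
Qed.

End TrigonometricFields.

(** * The estimate in the original norms *)

Section Assembly.
Context {R : realType}.
Variable L : R.
Hypothesis L0 : 0 < L.
Implicit Types (u : vfield R) (N : R).

Local Notation kap := (kappa0 L).

Lemma low_idem N k : low N k * low N k = low N k :> R.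
Proof. by rewrite /low; case: (nk k < N); rewrite ?mulr1 ?mulr0. Qed.

Lemma hcoefB (a b : vfield R) : hcoef L a -> hcoef L b -> hcoef L (fun i x => a i x - b i x).
Proof.
move=> ha hb; have a2 := hc_L2 ha; have b2 := hc_L2 hb; split => [i|i|k].
- exact: L2B.
- by rewrite fcB // !hc_0 // subrr.
- by rewrite !fcB // !mulrBr addrACA -opprD !hc_div // subrr.
Qed.

Lemma normH_le_normV u (C : R) : inV L u -> normV L u <= C -> normH L u <= 2 * (L * (C / (kap * L))).
Proof.
move=> hu hC; have hc := inV_vcoef L0 hu.
have kL : 0 < kap * L by rewrite mulr_gt0 ?kap_gt0.
have C0 : 0 <= C := le_trans (sqrtr_ge0 _) hC.
apply: (normH_le_l2b L0); [by rewrite divr_ge0 // ltW|exact: inV_inH|].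
apply: (l2b_le (y := fun k => nk k * cn (sc L u k))) => [k|].
  have [->|k0] := eqVneq k 0; first by rewrite sc_0 cn0 mulr0.
  rewrite !ger0_norm ?mulr_ge0 ?cn_ge0 ?nk_ge0 // ler_peMl ?cn_ge0 //; exact: nk_ge1.
apply: l2b_leX (l2b_sc_grad L0 hc); first by rewrite divr_ge0 ?sqrtr_ge0 // ltW.
by rewrite ler_pM2r ?invr_gt0.
Qed.

Lemma l2b_sc_V u (C : R) : inV L u -> normV L u <= C ->
  l2b (fun k => nk k * cn (sc L u k)) (C / (kap * L)).
Proof.
move=> hu hC; have kL : 0 < kap * L by rewrite mulr_gt0 ?kap_gt0.
apply: l2b_leX (l2b_sc_grad L0 (inV_vcoef L0 hu)); first by rewrite divr_ge0 ?sqrtr_ge0 // ltW.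
by rewrite ler_pM2r ?invr_gt0.
Qed.

Lemma l2b_sc_H u (C : R) : hcoef L u -> normH L u <= C -> l2b (fun k => cn (sc L u k)) (C / L).
Proof.
move=> hu hC; apply: l2b_leX (l2b_sc L0 hu); first by rewrite divr_ge0 ?sqrtr_ge0 // ltW.
by rewrite ler_pM2r ?invr_gt0.
Qed.

Lemma cn_sc_projN N u k : hcoef L u -> cn (sc L (projN L N u) k) = low N k * cn (sc L u k).
Proof. by move=> hu; rewrite sc_projN // cnM cn_real ger0_norm ?low_ge0. Qed.

Lemma normV_projN_le N u (C : R) : inV L u -> normV L u <= C ->
  normV L (projN L N u) <= 4 * (L * (kap * (C / (kap * L)))).
Proof.
move=> hu hC; have hc := inV_hcoef L0 hu.
have kL : 0 < kap * L by rewrite mulr_gt0 ?kap_gt0.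
have C0 : 0 <= C := le_trans (sqrtr_ge0 _) hC.
apply: (normT_le_l2b L0); first by rewrite divr_ge0 // ltW.
  exact: (inV_vcoef L0 (projN_inV L0 N hc)).
apply: l2b_le (l2b_sc_V hu hC) => k; rewrite cn_sc_projN // mulrCA normrM.
by rewrite ler_piMl // ger0_norm ?low_ge0 ?low_le1.
Qed.

Lemma normH_projN_le N u (C : R) : inV L u -> normV L u <= C ->
  normH L (projN L N u) <= 2 * (L * (4 * (L * (kap * (C / (kap * L)))) / (kap * L))).
Proof.
move=> hu hC; apply: normH_le_normV; last exact: normV_projN_le.
exact: (projN_inV L0 N (inV_hcoef L0 hu)).
Qed.

Lemma cn_bc_le u G k : (forall i, L2 L (u i)) -> (forall i j, L2 L (G i j)) ->
  cn (bc L u G k) <= 8 / L ^+ 2 * (normH L u * normT L G).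
Proof.
move=> u2 G2; have c0 : 0 <= 2 / L ^+ 2 by rewrite divr_ge0 // sqr_ge0.
rewrite (_ : 8 / L ^+ 2 * _ = 2 * (2 * (2 / L ^+ 2 * (normH L u * normT L G)))); last by ring.
apply: le_trans (cn_sum _ _ _) _; apply: sumI2_le => i.
apply: le_trans (cn_sum _ _ _) _; apply: sumI2_le => j.
rewrite cnM cn_real; apply: le_trans (ler_wpM2r (cn_ge0 _) (evec_le1 k i)) _; rewrite mul1r.
apply: le_trans (fcM_le L0 k (u2 j) (G2 i j)) _.
by rewrite ler_wpM2l // ler_pM ?n2_ge0 ?n2_le_normH ?n2_le_normT.
Qed.

(** This converts the norms of A^-1 P_N u and of A^-1 applied to its time derivative, as they occur
    in M2, into l^2 bounds; [X] makes the supremum finite. *)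
Lemma Cb_invA (phi : R -> vfield R) D (S : R -> Z2 -> R[i]) (X : R) : symm D ->
  (forall t, inH L (phi t)) ->
  (forall t i, n2 L (fun x => phi t i x - tf L D (S t) i x) = 0) ->
  (forall t, normH L (phi t) <= X) ->
  forall t, l2b (fun k => cn (sc L (phi t) k) / (kap ^+ 2 * nk k ^+ 2))
    (Cb_norm (normH L) (fun t => invA L (phi t)) / L).
Proof.
move=> sD hH hn hX t0; have kp := kap_gt0 L0.
have hc t : hcoef L (phi t) by exact: (inH_hcoef L0 (hH t)).
have hi t := invA_tf L0 (hc_L2 (hc t)) (hn t) sD.
have X0 : 0 <= X := le_trans (sqrtr_ge0 _) (hX 0).
have e t k : k != 0 -> cn (sc L (phi t) k) / (kap ^+ 2 * nk k ^+ 2) = cn (sc L (invA L (phi t)) k).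
  move=> k0; have n0 := nk_gt0 (R := R) k0.
  rewrite -(hi t).2 cnM cn_real ger0_norm ?sqr_ge0 // -exprMn mulrAC mulfV ?mul1r //.
  by rewrite expf_neq0 // mulf_neq0 // gt_eqF.
have kk0 k : 0 <= kap ^+ 2 * nk k ^+ 2 by rewrite mulr_ge0 // sqr_ge0.
have bd t : normH L (invA L (phi t)) <= 2 * (L * (X / L / kap ^+ 2)).
  have [iV _] := hi t.
  apply: (normH_le_l2b L0); [by rewrite !divr_ge0 ?sqr_ge0 // ltW|exact: inV_inH|].
  move=> F uF; rewrite expr_div_n.
  apply: (@le_trans _ _ (\sum_(k <- F) cn (sc L (phi t) k) ^+ 2 / (kap ^+ 2) ^+ 2)).
    apply: ler_sum => k _; have [->|k0] := eqVneq k 0.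
      by rewrite sc_0 cn0 expr0n divr_ge0 ?sqr_ge0.
    rewrite -e // -expr_div_n ler_sqr ?nnegrE ?divr_ge0 ?cn_ge0 ?sqr_ge0 //.
    have k2 : 0 < kap ^+ 2 by rewrite exprn_gt0.
    have n2 : 0 < nk k ^+ 2 :> R by rewrite exprn_gt0 // nk_gt0.
    rewrite ler_wpM2l ?cn_ge0 // lef_pV2 ?posrE ?(mulr_gt0 k2 n2) //.
    rewrite ler_peMr ?sqr_ge0 // -[leLHS](expr1n _ 2) ler_sqr ?nnegrE ?nk_ge0 //; exact: nk_ge1.
  rewrite -mulr_suml ler_wpM2r ?invr_ge0 ?sqr_ge0 //.
  exact: (l2b_sc_H (hc t) (hX t) uF).
have iV := (hi t0).1.
have h := l2b_sc_H (inV_hcoef L0 iV) (le_Cb_norm (normX := normH L) (phi := fun t => invA L (phi t)) t0 bd).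
apply: l2b_le h => k; have [->|k0] := eqVneq k 0; last by rewrite e.
by rewrite sc_0 cn0 mul0r normr0.
Qed.

Lemma cder_scale (z : R -> R[i]) t dz (c : R) : cder z t dz ->
  cder (fun r => c%:C%C * z r) t (c%:C%C * dz).
Proof.
move=> [h1 h2]; split.
  rewrite (_ : (fun r => _) = fun r => c * cRe (z r)); last by apply/funext => r; rewrite cReM /=; ring.
  by apply: is_derive_eq; rewrite cReM /GRing.scale /=; ring.
rewrite (_ : (fun r => _) = fun r => c * cIm (z r)); last by apply/funext => r; rewrite cImM /=; ring.
by apply: is_derive_eq; rewrite cImM /GRing.scale /=; ring.
Qed.

Lemma normH_n2_0 (a b : vfield R) (X : R) : (forall i, L2 L (a i)) -> (forall i, L2 L (b i)) ->
  (forall i, n2 L (fun x => a i x - b i x) = 0) -> normH L b <= X -> normH L a <= 2 * X.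
Proof.
move=> a2 b2 h hX; apply: normH_le => i.
rewrite (_ : a i = fun x => (a i x - b i x) + b i x); last by apply/funext => x; ring.
apply: le_trans (n2D_le (L2B (a2 i) (b2 i)) (b2 i)) _; rewrite h add0r.
exact: le_trans (n2_le_normH L b i) hX.
Qed.

Lemma inf_energy_le (s t : R) (phi : R -> vfield R) r : s <= r <= t ->
  inf_energy L s t phi <= normH L (phi r) ^+ 2.
Proof.
move=> hr; apply: ge_inf; last by exists r => //=; rewrite in_itv.
by exists 0 => _ [x _ <-]; exact: sqr_ge0.
Qed.

(** Raising the cut-off adds nonnegative modal energies; the positivity assumed for P_n u thus
    passes to P_N u. *)
Lemma inf_energy_mono (s t n N : R) (u : R -> vfield R) : s < t -> n <= N ->
  (forall t, hcoef L (u t)) ->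
  inf_energy L s t (fun r => projN L n (u r)) <= inf_energy L s t (fun r => projN L N (u r)).
Proof.
move=> st nN hu; apply: lb_le_inf.
  by exists (normH L (projN L N (u s)) ^+ 2), s => //=; rewrite in_itv /= lexx ltW.
move=> _ [r /= rI <-]; rewrite in_itv in rI; apply: le_trans (inf_energy_le _ rI) _.
have [K1 h1] := normH_projN L0 n; have [K2 h2] := normH_projN L0 N.
have e1 := h1 (maxn K1 K2) (leq_maxl _ _) _ (hu r); have e2 := h2 (maxn K1 K2) (leq_maxr _ _) _ (hu r).
rewrite [leLHS]e1 [leRHS]e2.
rewrite ler_wpM2l ?sqr_ge0 //; apply: ler_sum => k _.
rewrite ler_sqr ?nnegrE ?mulr_ge0 ?cn_ge0 ?low_ge0 // ler_wpM2r ?cn_ge0 // /low.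
by case: (ltP (nk k) n) => [kn|_]; rewrite ?ler0n // (lt_le_trans kn nN).
Qed.

Lemma add_le_sqrt2 (a b : R) : a + b <= Num.sqrt 2 * Num.sqrt (a ^+ 2 + b ^+ 2).
Proof.
rewrite -sqrtrM // (le_trans (ler_norm _)) // -sqrtr_sqr ler_sqrt.
  by have := sqr_ge0 (a - b); nra.
by rewrite mulr_ge0 // addr_ge0 ?sqr_ge0.
Qed.

Lemma sqrt2_ge : 5 / 4 <= Num.sqrt 2 :> R.
Proof. rewrite -[leLHS]ger0_norm ?divr_ge0 // -sqrtr_sqr ler_sqrt //; lra. Qed.

Lemma sqrt5_ge : 2 <= Num.sqrt 5 :> R.
Proof. rewrite -[leLHS]ger0_norm // -sqrtr_sqr ler_sqrt //; lra. Qed.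

(** The factor sqrt 2 pays for replacing a sum by the root of a sum of squares. Dropping the force
    instead and using mu0 >= 1 and sqrt 2 >= 5/4 gives the factor 4/5. *)
Lemma Mconst_ge (normX : vfield R -> R) (nu0 mu0 : R) (f phi : R -> vfield R) :
  0 < nu0 -> 1 <= mu0 -> 0 <= Cb_norm normX phi ->
  Cb_norm normX f / (nu0 * kap ^+ 2) + mu0 * Cb_norm normX phi <= Mconst L normX nu0 mu0 f phi /\
  Cb_norm normX phi <= 4 / 5 * Mconst L normX nu0 mu0 f phi.
Proof.
move=> nu00 mu01 P0; set F := Cb_norm normX f; set P := Cb_norm normX phi in P0 *.
have -> : Mconst L normX nu0 mu0 f phi =
    Num.sqrt 2 * Num.sqrt ((F / (nu0 * kap ^+ 2)) ^+ 2 + (mu0 * P) ^+ 2).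
  rewrite /Mconst -/F -/P; congr (_ * Num.sqrt (_ + _)); last by rewrite [RHS]exprMn.
  by rewrite [RHS]expr_div_n mul1r mulrC.
split; first exact: add_le_sqrt2.
have mP0 : 0 <= mu0 * P by rewrite mulr_ge0 //; lra.
have h : P <= Num.sqrt ((F / (nu0 * kap ^+ 2)) ^+ 2 + (mu0 * P) ^+ 2).
  apply: (@le_trans _ _ (mu0 * P)); first by rewrite ler_peMl.
  by rewrite -[leLHS]ger0_norm // -sqrtr_sqr ler_sqrt ?addr_ge0 ?sqr_ge0 // lerDr sqr_ge0.
by have := sqrt2_ge; nra.
Qed.

Lemma c0_ge1 : 1 <= (c0 : R) ^+ 2.
Proof.
have h : 0 <= 1 / (2 * pi) :> R by rewrite divr_ge0 // mulr_ge0 // ltW // pi_gt0.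
by rewrite /c0 sqr_sqrtr ?addr_ge0 // lerDl.
Qed.

End Assembly.

(** * Arithmetic of the constants *)

Section Numerics.
Context {R : realType}.

Lemma Cb_normH_ge0 (L : R) (phi : R -> vfield R) : 0 <= Cb_norm (normH L) phi.
Proof.
rewrite /Cb_norm; case: (pselect (has_sup [set normH L (phi t) | t in [set: R]])) => [[_ hub]|/sup_out->//].
by apply: le_trans (ub_le_sup hub _); [exact: (sqrtr_ge0 (ipH L (phi 0) (phi 0)))|exists 0].
Qed.

(** The chain is 8 a <= 2 A <= 8 M / 5 < nu0 k N / 5; its last step is the condition on N, its first
    the bound k L >= 4. *)
Lemma enstrophy_small (nu0 k L A M N a : R) : 0 < nu0 -> 0 < k -> 4 <= k * L -> 0 <= A ->
  A <= 4 / 5 * M -> 8 / (nu0 * k) * M < N -> a <= A / (k * L) -> 8 * a <= nu0 * k * N / 5.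
Proof.
move=> nu00 k0 kL A0 AM MN aA.
have nk0 : 0 < nu0 * k by rewrite mulr_gt0.
have kLp : 0 < k * L by apply: lt_le_trans kL.
have h1 : 8 * M < nu0 * k * N.
  by move: MN; rewrite mulrAC ltr_pdivrMr // [N * _]mulrC.
have h2 : A / (k * L) <= A / 4 by rewrite ler_wpM2l // lef_pV2 ?posrE.
lra.
Qed.

(* The factor 20 / (k L) is at most 5 as [k L = 2 pi]; then [q <= 4 / 5 H]
   brings 5 down to 4, and [r] stands for the square root of 5. *)
Lemma error_le (nu0 k L a w V H N q r c : R) : 0 < nu0 -> 0 < k -> 0 < L -> 4 <= k * L -> 0 < N ->
  0 <= a -> a <= w -> w = V / (k * L) -> 0 <= q -> q <= 4 / 5 * H -> 2 <= r -> 1 <= c ->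
  L ^+ 2 * (8 / k * (5 / 4 * a / (nu0 * N) * (a + w) * (q / L))) <=
  2 * r * c / (nu0 * k ^+ 2) * H * V ^+ 2 / N.
Proof.
move=> nu00 k0 L0 kL N0 a0 aw wE q0 qH r2 c1.
have kLp : 0 < k * L by apply: lt_le_trans kL.
have H0 : 0 <= H by lra.
have c0 : 0 < nu0 * k ^+ 2 * N by rewrite !mulr_gt0 // exprn_gt0.
have VE : V = w * (k * L) by rewrite wE divfK // gt_eqF.
rewrite (_ : L ^+ 2 * _ = (10 * (k * L) * (a * (a + w)) * q) / (nu0 * k ^+ 2 * N)); last first.
  by field; rewrite !gt_eqF.
rewrite (_ : 2 * r * c / _ * H * _ / N = (2 * (r * c) * H * V ^+ 2) / (nu0 * k ^+ 2 * N)); last first.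
  by field; rewrite !gt_eqF.
rewrite ler_pM2r ?invr_gt0 // VE.
have aw2 : a * (a + w) <= 2 * w ^+ 2 by nra.
have w0 : 0 <= w by lra.
have rc : 2 <= r * c by nra.
apply: (@le_trans _ _ (10 * (k * L) * (2 * w ^+ 2) * (4 / 5 * H))).
  apply: ler_pM => //.
    by rewrite (mulr_ge0 (mulr_ge0 _ (ltW kLp))) // mulr_ge0 // addr_ge0.
  by rewrite ler_wpM2l // mulr_ge0 // ltW.
have wH : 0 <= w ^+ 2 * H by rewrite mulr_ge0 ?sqr_ge0.
rewrite (_ : 10 * _ * _ * _ = (w ^+ 2 * H * (k * L)) * 16); last by field.
rewrite (_ : 2 * _ * H * _ = (w ^+ 2 * H * (k * L)) * (2 * (r * c) * (k * L))); last by ring.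
apply: ler_wpM2l; first by rewrite mulr_ge0 // ltW.
nra.
Qed.

(** Dividing by nu0 k^2 N^2 reduces mu to mu0, and the factor N^-2 left on the force is at most 1.
    This matches the bound of [traj_enstrophy] with [Mconst]. *)
Lemma forcing_ratio (nu0 k l mu0 N F P M : R) : 0 < nu0 -> 0 < k -> 0 < l -> 1 <= N -> 0 <= F ->
  F / (nu0 * k ^+ 2) + mu0 * P <= M ->
  (F / l + mu0 * nu0 * k ^+ 2 * N ^+ 2 * (P / l)) / (nu0 * k ^+ 2 * N ^+ 2) <= M / l.
Proof.
move=> nu00 k0 l0 N1 F0 h; have Np : 0 < N by apply: lt_le_trans N1.
have c0 : 0 < nu0 * k ^+ 2 by rewrite mulr_gt0 // exprn_gt0.
rewrite (_ : _ / _ = (F / (nu0 * k ^+ 2) / N ^+ 2 + mu0 * P) / l); last first.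
  by field; rewrite !gt_eqF.
rewrite ler_pM2r ?invr_gt0 //; apply: le_trans h; rewrite lerD2r.
by rewrite ler_pdivrMr ?exprn_gt0 // ler_peMr ?(divr_ge0 F0 (ltW c0)) // exprn_ege1.
Qed.

(** Here [l] is L, the ratio between the norm of L^2 on the cell and the l^2 norm of the
    coefficients; the gap estimate is quadratic in these norms. *)
Lemma unscale_gap (l D E x c g a b q w : R) : 0 < l ->
  D * (E / l ^+ 2 - x) <= (c * (a / l) + b / l + g * (q / l)) * (w / l) ->
  D * (E - l ^+ 2 * x) <= (c * a + b + g * q) * w.
Proof.
move=> l0; have l2 : 0 < l ^+ 2 by rewrite exprn_gt0.
rewrite -(ler_pM2l l2) (_ : l ^+ 2 * (D * _) = D * (E - l ^+ 2 * x)); last first.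
  by field; rewrite gt_eqF.
by rewrite (_ : l ^+ 2 * (_ * (w / l)) = (c * a + b + g * q) * w) //; field; rewrite gt_eqF.
Qed.

Lemma absorb_error (D E T A : R) : 0 <= D -> 0 < E -> T <= E / 2 -> D * (E - T) <= A ->
  D <= 2 * A / E.
Proof. by move=> D0 E0 TE h; rewrite ler_pdivlMr //; nra. Qed.

End Numerics.

Theorem theorem6p2 (R : realType) (L nu0 nu1 nu : R) (f u : R -> vfield R)
    (n s t mu0 N : R) :
  0 < L ->
  0 < nu0 -> nu0 < nu1 ->
  CbV L f ->
  CbV L u ->
  nu0 <= nu <= nu1 ->
  nse_solution L nu f u ->
  1 <= n -> s < t ->
  0 < inf_energy L s t (fun r => projN L n (u r)) ->
  nu1 / nu0 <= mu0 ->
  1 <= N ->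
  let mu := mu0 * nu0 * kappa0 L ^+ 2 * N ^+ 2 in
  let delta := expR (- (mu0 * nu0 * kappa0 L ^+ 2 * (t - s))) in
  let PNu := fun r => projN L N (u r) in
  let M1 := M1const L nu0 mu0 f PNu in
  let M2 := fun gamma => M2const L mu (delta `^ (N ^+ 2)) gamma PNu in
  Num.max (8 / (nu0 * kappa0 L) * Mconst L (normV L) nu0 mu0 f u)
    (Num.max n (2 * M1 / inf_energy L s t PNu)) < N ->
  forall gamma : R, nu0 <= gamma <= nu1 ->
  forall v : R -> vfield R, determining_solution L f mu N gamma PNu v ->
  `|nu - gamma| <= 2 * M2 gamma / inf_energy L s t PNu *
    Cb_norm (normH L) (fun r => projN L N (v r) - PNu r).
Proof.
move=> L0 nu00 nu01 [fV _ [Cf hCf]] [uV _ [Cu hCu]] /andP[nuge _] nseu n1 st En mu0ge N1 mu delta PNu M1 M2.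
rewrite !gt_max => /and3P[NU nN NE] gam /andP[gamge _] v [[vV _ [Cv hCv]] nsev].
have fh r := inV_hcoef L0 (fV r). have uh r := inV_hcoef L0 (uV r). have vh r := inV_hcoef L0 (vV r).
have u2 r := hc_L2 (uh r). have f2 r := hc_L2 (fh r).
pose k := kappa0 L; rewrite -/k in NU.
have k0 : 0 < k by exact: kap_gt0.
have kL : 4 <= k * L by rewrite /k kapL //; have := pi_ge2 R; lra.
have mu01 : 1 <= mu0 by apply: le_trans mu0ge; rewrite ler_pdivlMr // mul1r ltW.
have k20 : 0 < k ^+ 2 by rewrite exprn_gt0.
have N20 : 0 < N ^+ 2 by rewrite exprn_gt0 //; lra.
have Np : 0 < N by apply: lt_le_trans N1.
have nupos : 0 <= nu by apply: le_trans nuge; exact: ltW.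
have gam0 : 0 <= gam by apply: le_trans gamge; exact: ltW.
have c0 : 0 < nu0 * k ^+ 2 by rewrite mulr_gt0.
have muge : nu0 * k ^+ 2 * N ^+ 2 <= mu.
  by rewrite /mu -/k ler_wpM2r ?(ltW N20) // -mulrA ler_peMl // ltW.
have mupos : 0 < mu by apply: lt_le_trans muge; rewrite mulr_gt0.
have PV r : inV L (PNu r) by exact: projN_inV.
have Ph r := inV_hcoef L0 (PV r).
have vPh r : hcoef L (projN L N (v r)) by apply: (inV_hcoef L0); exact: projN_inV.
set E := inf_energy L s t PNu in NE *.
have E0 : 0 < E by apply: lt_le_trans En _; apply: inf_energy_mono => //; exact: ltW.
pose FV := Cb_norm (normV L) f; pose UV := Cb_norm (normV L) u; pose QV := Cb_norm (normV L) PNu.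
pose QH := Cb_norm (normH L) PNu.
have hFV r : normV L (f r) <= FV by exact: le_Cb_norm hCf.
have hUV r : normV L (u r) <= UV by exact: le_Cb_norm hCu.
have hQV r : normV L (PNu r) <= QV by apply: le_Cb_norm => x; apply: normV_projN_le => //; exact: hCu.
have bP x : normH L (PNu x) <= 2 * (L * (4 * (L * (k * (Cu / (k * L)))) / (k * L))).
  by apply: normH_projN_le => //; exact: hCu.
have hQH r : normH L (PNu r) <= QH by exact: le_Cb_norm bP.
have FV0 : 0 <= FV := le_trans (sqrtr_ge0 _) (hFV 0).
have UV0 : 0 <= UV := le_trans (sqrtr_ge0 _) (hUV 0).
have QV0 : 0 <= QV := le_trans (sqrtr_ge0 _) (hQV 0).
have QH0 : 0 <= QH := le_trans (sqrtr_ge0 _) (hQH 0).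
have [MV1 _] := Mconst_ge L f nu00 mu01 QV0; have [_ MH2] := Mconst_ge L f nu00 mu01 QH0.
have [_ MU2] := Mconst_ge L f nu00 mu01 UV0.
set MV := Mconst L (normV L) nu0 mu0 f PNu in MV1.
set MH := Mconst L (normH L) nu0 mu0 f PNu in MH2.
have kLp : 0 < k * L by rewrite mulr_gt0.
pose U r := sc L (u r); pose V r := sc L (v r); pose fh' r := sc L (f r).
pose B r := bc L (u r) (grad L (u r)); pose B' r := bc L (v r) (grad L (v r)).
have trU : traj k nu U B fh' by exact: nse_traj uV hCu f2 nseu.
have trV : traj k gam V B' (fun r j => fh' r j + (mu * low N j)%:C%C * (U r j - V r j)).
  have F2 r i : L2 L (fun x => f r i x + mu * (PNu r i x - projN L N (v r) i x)).
    by apply: L2D => //; apply: L2Z; apply: L2B; [exact: hc_L2 (Ph r) i|exact: hc_L2 (vPh r) i].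
  have := nse_traj L0 vV hCv F2 nsev.
  congr (traj _ _ _ _ _); apply/funext => r; apply/funext => j.
  have P2 i := hc_L2 (Ph r) i; have vP2 i := hc_L2 (vPh r) i.
  rewrite (scD L0 j (f2 r)) => [|i]; last by apply: L2Z; exact: L2B.
  rewrite (scZ L0 mu j) => [|i]; last exact: L2B.
  rewrite (scB L0 j P2 vP2) !sc_projN // -mulrBr mulrA; congr (_ + _ * _).
  by cring.
pose W := MV / (k * L).
have hfl r : l2b (fun j => nk j * cn (fh' r j)) (FV / (k * L)) := l2b_sc_V L0 (fV r) (hFV r).
have hpl r : l2b (fun j => nk j * cn ((low N j)%:C%C * U r j)) (QV / (k * L)).
  by apply: l2b_le (l2b_sc_V L0 (PV r) (hQV r)) => j; rewrite sc_projN.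
have W1 : (FV / (k * L) + mu * (QV / (k * L))) / (nu0 * k ^+ 2 * N ^+ 2) <= W :=
  forcing_ratio nu00 k0 kLp N1 FV0 MV1.
have FVk0 : 0 <= FV / (k * L) := divr_ge0 FV0 (ltW kLp).
have QVk0 : 0 <= QV / (k * L) := divr_ge0 QV0 (ltW kLp).
have W0' : 0 <= (FV / (k * L) + mu * (QV / (k * L))) / (nu0 * k ^+ 2 * N ^+ 2) :=
  divr_ge0 (addr_ge0 FVk0 (mulr_ge0 (ltW mupos) QVk0)) (ltW (mulr_gt0 c0 N20)).
have W0 : 0 <= W := le_trans W0' W1.
(* One enstrophy bound serves both trajectories: u also solves the equation nudged towards P_N u,
   since the nudging term then vanishes. *)
have hW (g : R) X (Y Z : R -> Z2 -> R[i]) : nu0 <= g -> traj k g X Y Z ->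
    (forall r j, Z r j = fh' r j + (mu * low N j)%:C%C * ((low N j)%:C%C * U r j - X r j)) ->
    forall r, l2b (fun j => nk j * cn (X r j)) W.
  move=> hg tr hZ r; have e : Z = fun r j => fh' r j + (mu * low N j)%:C%C * ((low N j)%:C%C * U r j - X r j).
    by apply/funext => x; apply/funext => j.
  rewrite e in tr.
  exact: (l2b_leX W0' W1 (traj_enstrophy k0 nu00 hg Np muge FVk0 QVk0 hfl hpl tr r)).
have UW r : l2b (fun j => nk j * cn (U r j)) W.
  apply: (hW nu U B fh' nuge trU) => x j.
  have -> : (mu * low N j)%:C%C * ((low N j)%:C%C * U x j - U x j) =
     (mu * (low N j * low N j - low N j))%:C%C * U x j.
    by rewrite !(rmorphM, rmorphB) /=; ring.
  by rewrite low_idem subrr mulr0 mul0r addr0.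
have VW r : l2b (fun j => nk j * cn (V r j)) W.
  apply: (hW gam V B' _ gamge trV) => x j; congr (_ + _).
  by rewrite /low; case: (nk j < N); rewrite ?mul1r // mulr0 !mul0r.
(* Two bounds on the enstrophy of u are needed at once: [X] meets the condition on N, which involves
   M_V(u), and [W] leads to M1, which involves M_V(P_N u). *)
pose X := UV / (k * L); pose Um := Num.min W X.
have X0 : 0 <= X := divr_ge0 UV0 (ltW kLp).
have Um0 : 0 <= Um by rewrite le_min W0 X0.
have UmW : Um <= W by rewrite ge_min lexx.
have UmX : Um <= X by rewrite ge_min lexx orbT.
have UUm r : l2b (fun j => nk j * cn (U r j)) Um.
  by rewrite /Um /Num.min; case: ifP => _; [exact: UW|exact: (l2b_sc_V L0 (uV r) (hUV r))].
have small : 8 * Um <= nu0 * k * N / 5 := enstrophy_small nu00 k0 kL UV0 MU2 NU UmX.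
pose zeta := 5 / 4 * Um / (nu0 * N).
have zeta0 : 0 <= zeta.
  by rewrite /zeta (divr_ge0 _ (ltW (mulr_gt0 nu00 Np))) // mulr_ge0 // divr_ge0.
have hz := traj_diff k0 nu00 nuge gamge N1 muge FVk0 hfl Um0 UUm small trU trV.
pose Lw := Cb_norm (normH L) (fun r => projN L N (v r) - PNu r).
have dh r : hcoef L (projN L N (v r) - PNu r) by exact: hcoefB (vPh r) (Ph r).
have bd r : normH L (projN L N (v r) - PNu r) <=
    2 * (2 * (L * (4 * (L * (k * (Cv / (k * L)))) / (k * L))) + 2 * (L * (4 * (L * (k * (Cu / (k * L)))) / (k * L)))).
  apply: normH_le => i; apply: le_trans (n2B_le (hc_L2 (vPh r) i) (hc_L2 (Ph r) i)) _; apply: lerD.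
    by apply: le_trans (n2_le_normH L _ i) _; apply: normH_projN_le => //; exact: hCv.
  exact: le_trans (n2_le_normH L _ i) (bP r).
have hLw r : normH L (projN L N (v r) - PNu r) <= Lw by exact: (le_Cb_norm (phi := fun r => projN L N (v r) - PNu r) r bd).
have Lw0 : 0 <= Lw := le_trans (sqrtr_ge0 _) (hLw 0).
have hL r : l2b (fun j => low N j * cn (V r j - U r j)) (Lw / L).
  apply: l2b_le (l2b_sc_H L0 (dh r) (hLw r)) => j.
  rewrite (scB L0 j (hc_L2 (vPh r)) (hc_L2 (Ph r))) !sc_projN // -mulrBr cnM cn_real.
  by rewrite [`|low N j|]ger0_norm ?low_ge0.
have hP r : l2b (fun j => low N j * cn (U r j)) (QH / L).
  by apply: l2b_le (l2b_sc_H L0 (Ph r) (hQH r)) => j; rewrite (cn_sc_projN L0 N j (uh r)).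
have [K0 hK0] := projN_tf L N; have [K1 hK1] := normH_projN L0 N; have [K2 hK2] := low_box N.
(* Beyond [K0] and [K1] the formulas for P_N u and for its norm hold on the box; beyond [K2] the box
   contains all nonzero modes below N. *)
pose K := maxn (maxn K0 K1) K2.
pose S r j := (low N j)%:C%C * U r j.
have PE : PNu = fun r => tf L (box K) (S r).
  by apply/funext => r; apply: hK0 (uh r); rewrite /K -maxnA leq_maxl.
pose dU r j := - ((nu * k ^+ 2 * nk j ^+ 2)%:C%C * U r j) + (fh' r j - B r j).
pose dS r j := (low N j)%:C%C * dU r j.
have hder r j : cder (fun x => S x j) r (dS r j).
  by apply: cder_scale; exact: nse_cder.
have dz r := dtH_tf L0 (box K) (hder r); rewrite -PE in dz.
have rdS r : rl (dS r).
  apply: rl_scale; last by move=> j; rewrite /low nkN.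
  have rU : rl (U r) by exact: (sc_rl L0).
  have rf : rl (fh' r) by exact: (sc_rl L0).
  have rB : rl (B r) by apply: (bc_rl L0) => // i j; exact: vc_L2 (inV_vcoef L0 (uV r)) i j.
  move=> j; rewrite /dU nkN rU rf rB; case: (U r j) (fh' r j) (B r j) => a1 a2 [b1 b2] [d1 d2]; cring.
pose QA := Cb_norm (normH L) (fun r => invA L (PNu r)).
pose QD := Cb_norm (normH L) (fun r => invA L (dtH L PNu r)).
have bA r : l2b (fun j => low N j / (k ^+ 2 * nk j ^+ 2) * cn (U r j)) (QA / L).
  have h0 x i : n2 L (fun y => PNu x i y - tf L (box K) (S x) i y) = 0.
    rewrite PE (_ : (fun y => _) = fun=> 0) ?/n2; last by apply/funext => y; rewrite subrr.
    by rewrite (_ : (fun y => _) = fun=> 0) ?integ0 ?sqrtr0 //; apply/funext => y; rewrite expr0n.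
  have := Cb_invA L0 (symm_box K) (fun x => inV_inH (PV x)) h0 bP r.
  by apply: l2b_le => j; rewrite (cn_sc_projN L0 N j (uh r)) mulrAC.
(* Any bound will do, to make the supremum [QD] finite; it is read off the equation on the finitely
   many modes of the box. *)
have [Z hZ] : exists Z, forall r, normH L (dtH L PNu r) <= Z.
  pose Hu := 2 * (L * (Cu / (k * L))); pose Hf := 2 * (L * (Cf / (k * L))).
  pose Y j := nu * k ^+ 2 * nk j ^+ 2 * (Hu / L) + (Hf / L + 8 / L ^+ 2 * (Hu * Cu)).
  have huH r : normH L (u r) <= Hu by apply: normH_le_normV => //; exact: hCu.
  have hfH r : normH L (f r) <= Hf by apply: normH_le_normV => //; exact: hCf.
  have pt (w : vfield R) (H : R) j : hcoef L w -> normH L w <= H -> cn (sc L w j) <= H / L.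
    move=> hw wH; have := l2b_pt j _ (l2b_sc_H L0 hw wH); rewrite ger0_norm ?cn_ge0 //; apply.
    by rewrite divr_ge0 ?(ltW L0) // (le_trans (sqrtr_ge0 _) wH).
  exists (2 * (4 * L * \sum_(j <- box K) Y j)) => r; have [zH z0] := dz r.
  apply: (normH_n2_0 (hc_L2 (inH_hcoef L0 zH)) (tf_L2 L0 (box K) (dS r)) z0).
  apply: le_trans (normH_tf_le L0 _ _) _; rewrite ler_wpM2l ?mulr_ge0 ?(ltW L0) //.
  apply: ler_sum => j _; rewrite /dS cnM cn_real ger0_norm ?low_ge0 //.
  apply: le_trans (ler_wpM2r (cn_ge0 _) (low_le1 _ _)) _; rewrite mul1r /dU /Y.
  apply: le_trans (cnD _ _) _; apply: lerD.
    have vj : 0 <= nu * k ^+ 2 * nk j ^+ 2 := mulr_ge0 (mulr_ge0 nupos (sqr_ge0 k)) (sqr_ge0 (nk j)).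
    by rewrite cnN cnM cn_real (ger0_norm vj) (ler_wpM2l vj) // (pt _ _ j (uh r) (huH r)).
  apply: le_trans (cnB _ _) _; apply: lerD; first exact: pt.
  apply: le_trans (cn_bc_le L0 _ (u2 r) (vc_L2 (inV_vcoef L0 (uV r)))) _.
  rewrite ler_wpM2l ?divr_ge0 ?sqr_ge0 // ler_pM ?sqrtr_ge0 //; exact: hCu.
have bD r : l2b (fun j => low N j / (k ^+ 2 * nk j ^+ 2) * cn (dU r j)) (QD / L).
  have := Cb_invA L0 (symm_box K) (fun x => (dz x).1) (fun x => (dz x).2) hZ r.
  apply: l2b_le => j; have [zH z0] := dz r.
  have -> : sc L (dtH L PNu r) j = sc L (tf L (box K) (dS r)) j.
    by apply: eq_bigr => i _; rewrite (fc_n2_0 L0 j (hc_L2 (inH_hcoef L0 zH) i) (tf_L2 L0 _ _ i) (z0 i)).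
  rewrite (sc_tf L0 _ (symm_box K) (rdS r)); have [->|j0] := eqVneq j 0.
    by rewrite nk0 expr0n mulr0 invr0 !mulr0 mul0r normr0.
  case: ifP => [_|jK]; first by rewrite cnM cn_real [`|low N j|]ger0_norm ?low_ge0 // mulrAC.
  have -> : low N j = 0 :> R.
    rewrite /low; case: ltP => // jN; move: jK; rewrite (sub_box (leq_maxr (maxn K0 K1) K2)) //; exact: hK2.
  by rewrite !mul0r normr0.
have QA0 : 0 <= QA / L.
  by rewrite divr_ge0 ?Cb_normH_ge0 // ltW.
have QD0 : 0 <= QD / L by rewrite divr_ge0 ?Cb_normH_ge0 // ltW.
have hm r : s <= r <= t -> E / L ^+ 2 <= \sum_(j <- box K) (low N j * cn (U r j)) ^+ 2.
  move=> hr; rewrite ler_pdivrMr ?exprn_gt0 // mulrC -hK1 //; first exact: inf_energy_le.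
  by rewrite /K -maxnA maxnCA leq_maxl.
pose d := delta `^ (N ^+ 2).
(* The exponent N^2 on [delta] supplies the factor N^2 of mu. *)
have dE : d = expR (- (mu * (t - s))).
  rewrite /d /delta /powR gt_eqF ?expR_gt0 // expRK; congr expR.
  by rewrite /mu -/k; ring.
have Pb0 : 0 <= QH / L by rewrite divr_ge0 // ltW.
have Lb0 : 0 <= Lw / L by rewrite divr_ge0 // ltW.
have gap := viscosity_gap k0 mupos gam0 st trU trV zeta0 Um0 W0 Pb0 Lb0 QA0 QD0 hz UUm VW hP hL bA bD hm dE.
pose T := L ^+ 2 * (8 / k * (zeta * (Um + W) * (QH / L))).
have gap' : `|nu - gam| * (E - T) <= M2 gam * Lw := unscale_gap L0 gap.
have TE : T <= E / 2.
  have h : T <= M1 / N by exact: (error_le nu00 k0 L0 kL Np Um0 UmW erefl QH0 MH2 sqrt5_ge c0_ge1).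
  apply: le_trans h _; move: NE; rewrite ltr_pdivrMr // => NE.
  by rewrite ler_pdivrMr // mulrAC ler_pdivlMr // mulrC [E * _]mulrC ltW.
have := absorb_error (normr_ge0 _) E0 TE gap'.
by rewrite mulrA mulrAC.
Qed.
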